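(* Let $\Omega\subset\mathbb{R}^n$ be a bounded domain with smooth boundary $\partial\Omega$, and assume that all eigenvalues of the Dirichlet Laplacian $A=\Delta$ on $L^2(\Omega)$, with domain $D(A)=H^1_0(\Omega)\cap H^2(\Omega)$, are simple. Let $\omega$ be any nonempty open subset of $\Omega$ and let $T>0$ be arbitrary. Then the heat equation with distributed control $$\begin{cases} z_t(x,t)=\Delta z(x,t)+\mathbf{1}_\omega(x) u(x,t), & (x,t)\in\Omega\times(0,T),\\ z(x,t)=0, & (x,t)\in\partial\Omega\times(0,T),\\ z(x,0)=z_0(x), & x\in\Omega,\end{cases}$$ with controls $u\in L^2(0,T;L^2(\Omega))$, is approximately controllable at time $T$ on $L^2(\Omega)$.
   Context: $\mathbf{1}_\omega$ is the characteristic function of $\omega$, and $S(t)$ denotes the $C_0$-semigroup generated by $A$ on $H=L^2(\Omega)$. The solution is the mild solution $z(t)=S(t)z_0+\int_0^t S(t-s)Bu(s)\,ds$, where $B:L^2(\Omega)\to L^2(\Omega)$ is $Bv=\mathbf{1}_\omega v$. The system is approximately controllable at time $T$ if for all $z_0,z_1\in H$ and every $\varepsilon>0$ there is a control $u\in L^2(0,T;L^2(\Omega))$ such that the corresponding mild solution satisfies $\|z(T)-z_1\|_{L^2(\Omega)}\le\varepsilon$. *)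

(* Defs.v *)
From HB Require Import structures.
From mathcomp Require Import all_boot all_order all_algebra.
From mathcomp Require Import all_classical all_reals all_analysis.
From mathcomp Require Import measurable_realfun ess_sup_inf.
Set Implicit Arguments. Unset Strict Implicit. Unset Printing Implicit Defensive.
Import Order.TTheory GRing.Theory Num.Theory.
Import numFieldNormedType.Exports.
Local Open Scope classical_set_scope.
Local Open Scope ring_scope.

(* The library defines LspaceType mu p1 as the type of classes of functions
   modulo a.e. equality, without algebraic structure. We make it a normed
   vector space; elements coerce to (chosen representative) functions. *)
Section Lspace_normed.
Local Open Scope quotient_scope.
Context d (T : measurableType d) (R : realType) (mu : {measure set T -> \bar R}).
Context (p : \bar R) (p1 : (1 <= p)%E).
Notation Lp := (LspaceType mu p1).
Implicit Types (f g h : Lp).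

Lemma Lspace_eqP f g : (f = g %[ae mu]) -> f = g.
Proof.
case: f g => [f [[cf]]] [g [[cg]]] /= fg.
have {}fg : f = g :> {mfun_ mu, T >-> measurableTypeR R}.
  rewrite -[f]reprK -[g]reprK; apply/eqP; rewrite eqmodE; exact/asboolP.
by move: cf cg; rewrite fg => cf cg; rewrite (Prop_irrelevance cf cg).
Qed.

Lemma ae_eq_Lnorm (u v : T -> R) : measurable_fun setT u -> measurable_fun setT v ->
  u = v %[ae mu] -> ('N[mu]_p[EFin \o u] = 'N[mu]_p[EFin \o v])%E.
Proof.
move=> mu_ mv uv; rewrite unlock /Lnorm; case: p p1 => //= [r _|_].
  congr (_ `^ _)%E; apply: ge0_ae_eq_integral => //.
  - by apply/measurable_EFinP/(measurableT_comp (measurable_powR _)); exact: measurableT_comp.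
  - by apply/measurable_EFinP/(measurableT_comp (measurable_powR _)); exact: measurableT_comp.
  - by case: uv => N [mN N0 uvN]; exists N; split=> // x xn; apply: uvN => uvx; apply: xn => _; rewrite uvx.
case: ifPn => // _; apply: eq_ess_sup.
by case: uv => N [mN N0 uvN]; exists N; split=> // x xn; apply: uvN => uvx; apply: xn => /=; rewrite uvx.
Qed.

Lemma Lspace_Lfun f : (f : T -> R) \in Lfun mu p.
Proof.
rewrite inE; apply/andP; split; rewrite inE/=; last exact: Lebesgue_finite.
exact: (@measurable_funPT _ _ _ _ (repr (f : {mfun_ mu, T >-> measurableTypeR R}))).
Qed.

Section toLspace.
Context (u : T -> R) (uL : u \in Lfun mu p).
Let um : {mfun T >-> measurableTypeR R} :=
  HB.pack_for {mfun T >-> measurableTypeR R} u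
    (@isMeasurableFun.Build _ _ T (measurableTypeR R) u (set_mem (sub_Lfun_mfun uL))).
Let q : {mfun_ mu, T >-> measurableTypeR R} := \pi um.
Let qE : (q : T -> R) = u %[ae mu].
Proof.
have /eqP : repr q = um %[mod {mfun_ mu, T >-> measurableTypeR R}] by rewrite reprK.
by rewrite eqmodE => /asboolP.
Qed.
Let qf : finite_norm mu p (q : T -> R).
Proof.
have := set_mem (sub_Lfun_finLfun uL); rewrite /= /finite_norm (@ae_eq_Lnorm (q : T -> R) u)//.
- exact: (@measurable_funPT _ _ _ _ (repr q)).
- exact: (@measurable_funPT _ _ _ _ um).
Qed.
Definition Lspace_of : Lp := HB.pack q (isFinLebesgue.Build _ _ _ _ _ p1 q qf).
Lemma Lspace_ofE : Lspace_of = u %[ae mu].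
Proof. exact: qE. Qed.
End toLspace.

HB.instance Definition _ := gen_eqMixin Lp.
HB.instance Definition _ := gen_choiceMixin Lp.

Let LfunD f g : (f : T -> R) \+ g \in Lfun mu p.
Proof. exact: (Lfun_addr_closed mu p1).2 (Lspace_Lfun f) (Lspace_Lfun g). Qed.
Let Lfun0 : (cst 0 : T -> R) \in Lfun mu p.
Proof. exact: (Lfun_addr_closed mu p1).1. Qed.
Let LfunZ (a : R) f : a \*: (f : T -> R) \in Lfun mu p.
Proof.
have := (Lfun_submod_closed mu p1).2 a _ _ (Lspace_Lfun f) Lfun0.
by rewrite (_ : _ + _ = a \*: (f : T -> R))//; apply/funext => x; rewrite fctE addr0.
Qed.

Definition Lspace_zero : Lp := Lspace_of Lfun0.
Definition Lspace_add f g : Lp := Lspace_of (LfunD f g).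
Definition Lspace_scale (a : R) f : Lp := Lspace_of (LfunZ a f).
Definition Lspace_opp f : Lp := Lspace_scale (-1) f.

Let addE f g : \forall x \ae mu, Lspace_add f g x = f x + g x.
Proof. by apply: filterS (Lspace_ofE (LfunD f g)) => x /(_ I). Qed.
Let zeroE : \forall x \ae mu, Lspace_zero x = 0.
Proof. by apply: filterS (Lspace_ofE Lfun0) => x /(_ I). Qed.
Let scaleE a f : \forall x \ae mu, Lspace_scale a f x = a * f x.
Proof. by apply: filterS (Lspace_ofE (LfunZ a f)) => x /(_ I). Qed.

Let eqP_ f g : (\forall x \ae mu, f x = g x) -> f = g.
Proof. by move=> fg; apply: Lspace_eqP; apply: filterS fg. Qed.

Let addA : associative Lspace_add.
Proof.
move=> f g h; apply: eqP_.
apply: filterS2 (filterI (addE f (Lspace_add g h)) (addE g h))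
  (filterI (addE (Lspace_add f g) h) (addE f g)) => x [-> ->] [-> ->].
exact: addrA.
Qed.
Let addC : commutative Lspace_add.
Proof.
move=> f g; apply: eqP_.
by apply: filterS2 (addE f g) (addE g f) => x -> ->; exact: addrC.
Qed.
Let add0 : left_id Lspace_zero Lspace_add.
Proof.
move=> f; apply: eqP_.
by apply: filterS2 (addE Lspace_zero f) zeroE => x -> ->; exact: add0r.
Qed.
Let addN : left_inverse Lspace_zero Lspace_opp Lspace_add.
Proof.
move=> f; apply: eqP_.
apply: filterS3 (addE (Lspace_opp f) f) (scaleE (-1) f) zeroE => x -> -> ->.
by rewrite mulN1r addNr.
Qed.
HB.instance Definition _ := GRing.isZmodule.Build Lp addA addC add0 addN.

Let scaleA a b f : Lspace_scale a (Lspace_scale b f) = Lspace_scale (a * b) f.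
Proof.
apply: eqP_; apply: filterS3 (scaleE a (Lspace_scale b f)) (scaleE b f)
  (scaleE (a * b) f) => x -> -> ->.
exact: mulrA.
Qed.
Let scale1 : left_id 1 Lspace_scale.
Proof. by move=> f; apply: eqP_; apply: filterS (scaleE 1 f) => x ->; rewrite mul1r. Qed.
Let scaleDr : right_distributive Lspace_scale +%R.
Proof.
move=> a f g; apply: eqP_.
apply: filterS2 (filterI (scaleE a (Lspace_add f g)) (addE f g))
  (filterI (filterI (scaleE a f) (scaleE a g))
  (addE (Lspace_scale a f) (Lspace_scale a g))) => x [-> ->] [[+ +] ->] => -> ->.
exact: mulrDr.
Qed.
Let scaleDl f : {morph Lspace_scale^~ f : a b / a + b}.
Proof.
move=> a b; apply: eqP_.
apply: filterS2 (scaleE (a + b) f)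
  (filterI (filterI (scaleE a f) (scaleE b f))
  (addE (Lspace_scale a f) (Lspace_scale b f))) => x -> [[+ +] ->] => -> ->.
exact: mulrDl.
Qed.
HB.instance Definition _ := GRing.Zmodule_isLmodule.Build R Lp
  scaleA scale1 scaleDr scaleDl.

Lemma Lspace_addE f g : \forall x \ae mu, (f + g : Lp) x = f x + g x.
Proof. exact: addE. Qed.
Lemma Lspace_zeroE : \forall x \ae mu, (0 : Lp) x = 0.
Proof. exact: zeroE. Qed.
Lemma Lspace_scaleE a f : \forall x \ae mu, (a *: f : Lp) x = a * f x.
Proof. exact: scaleE. Qed.

Definition Lspace_norm f : R := fine ('N[mu]_p[EFin \o f])%E.

Lemma Lspace_normE f : (Lspace_norm f)%:E = ('N[mu]_p[EFin \o f])%E.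
Proof.
rewrite fineK// fin_numElt (lt_le_trans ltNy0) ?Lnorm_ge0//=.
exact: Lebesgue_finite.
Qed.

Let meas f : measurable_fun setT (f : T -> R).
Proof. exact: set_mem (sub_Lfun_mfun (Lspace_Lfun f)). Qed.

Let normD f g : Lspace_norm (f + g) <= Lspace_norm f + Lspace_norm g.
Proof.
rewrite -lee_fin EFinD !Lspace_normE.
rewrite (@ae_eq_Lnorm _ (f \+ g : T -> R))//; last 2 first.
- exact: measurable_funD.
- by apply: filterS (Lspace_addE f g) => x.
exact: eminkowski.
Qed.
Let normZ a f : Lspace_norm (a *: f) = `|a| * Lspace_norm f.
Proof.
apply: EFin_inj; rewrite EFinM !Lspace_normE.
rewrite (@ae_eq_Lnorm _ (a \*: (f : T -> R)))//; last 2 first.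
- exact: measurable_funM.
- by apply: filterS (Lspace_scaleE a f) => x.
exact: (LnormZ (Lfun_Sub p1 (Lspace_Lfun f))).
Qed.
Let norm0 f : Lspace_norm f = 0 -> f = 0.
Proof.
move=> f0; apply: eqP_.
have := @fine_Lnormr_eq0 _ _ _ _ _ p1 (Lfun_Sub p1 (Lspace_Lfun f)) f0.
by apply: filterS2 Lspace_zeroE => x -> /(_ I).
Qed.
HB.instance Definition _ := Lmodule_isNormed.Build R Lp normD normZ norm0.

Lemma Lspace_normrE f : `|f|%:E = ('N[mu]_p[EFin \o f])%E.
Proof. exact: Lspace_normE. Qed.
End Lspace_normed.

(* R^n with the sigma-algebra generated by the coordinates, i.e. the Borel
   sigma-algebra (see open_measurable_rV). *)
Section rV_measurable.
Context (R : realType) (n : nat).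

Let coord (i : 'I_n) (v : 'rV[R]_n) : R := v ord0 i.

Let rV_set0 : g_sigma_preimage coord set0.
Proof. exact: sigma_algebra0. Qed.

Let rV_setC A : g_sigma_preimage coord A -> g_sigma_preimage coord (~` A).
Proof. exact: sigma_algebraC. Qed.

Let rV_bigcup (F : (set 'rV[R]_n)^nat) : (forall i, g_sigma_preimage coord (F i)) ->
  g_sigma_preimage coord (\bigcup_i (F i)).
Proof. exact: sigma_algebra_bigcup. Qed.

HB.instance Definition _ := @isMeasurable.Build (measure_tuple_display (R.-ocitv.-measurable).-sigma)
  'rV[R]_n (g_sigma_preimage coord) rV_set0 rV_setC rV_bigcup.

Lemma measurable_coord i : measurable_fun [set: 'rV[R]_n] (fun v : 'rV[R]_n => v ord0 i).
Proof.
move=> _ Y mY; rewrite setTI; apply: sub_sigma_algebra.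
rewrite (bigD1 i)//=; left; exists Y => //; by rewrite setTI.
Qed.

Lemma measurable_fun_rV d (T : measurableType d) (f : T -> 'rV[R]_n) :
  (forall i, measurable_fun [set: T] (fun x => f x ord0 i)) -> measurable_fun [set: T] f.
Proof.
move=> mf; apply: (@measurability _ _ _ _ _ _ (\big[setU/set0]_(i < n) preimage_set_system setT (coord i) measurable)) => //.
move=> _ [A + <-].
rewrite -bigcup_seq => -[i _] [B mB <-]; rewrite !setTI.
by have := mf i measurableT B mB; rewrite setTI.
Qed.

Lemma open_measurable_rV (U : set 'rV[R]_n) : open U -> measurable U.
Proof.
move=> oU.
pose box (k : 'rV[rat]_n * rat) : set 'rV[R]_n :=
  \bigcap_(i in [set: 'I_n])
    (coord i @^-1` [set` `]ratr (k.1 ord0 i) - ratr k.2, ratr (k.1 ord0 i) + ratr k.2[]).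
have mbox k : measurable (box k).
  rewrite /box; apply: fin_bigcap_measurable; first exact: finite_finset.
  move=> i _; rewrite -[X in measurable X]setTI.
  by apply: measurable_coord => //.
suff -> : U = \bigcup_(k in [set k | box k `<=` U]) box k.
  rewrite bigcup_mkcond; apply: countable_bigcupT_measurable => // k.
  by case: ifP => // _; exact: mbox.
apply/seteqP; split=> [x Ux|x [k kU] /kU//].
have /nbhs_ballP[e /= e0 eU] : nbhs x U by exact: open_nbhs_nbhs.
have [q /andP[q0 qe]] : exists q : rat, (0 < (ratr q : R)) && ((ratr q : R) < e / 2).
  have /rat_in_itvoo[q] : 0 < e / 2 by rewrite divr_gt0.
  by rewrite in_itv/= => ?; exists q.
have hr i : exists r : rat, `|(ratr r : R) - x ord0 i| < ratr q.
  have /rat_in_itvoo[r] : x ord0 i < x ord0 i + ratr q by rewrite ltrDl.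
  rewrite in_itv/= => /andP[r1 r2]; exists r.
  by rewrite gtr0_norm ?subr_gt0// ltrBlDl.
pose c : 'rV[rat]_n := \row_i sval (cid (hr i)).
have cP i : `|(ratr (c ord0 i) : R) - x ord0 i| < ratr q.
  by rewrite mxE; case: cid.
exists (c, q).
- move=> y /= yb; apply: eU; split => // i j; rewrite ord1.
  have := yb j I; rewrite /coord/= in_itv/= -ltr_distlC => yj.
  have := cP j; rewrite distrC => xj.
  rewrite /ball/= (le_lt_trans (ler_distD (ratr (c ord0 j)) _ _))//.
  by rewrite (splitr e) ltrD// ?(lt_trans xj)// ?(lt_trans _ qe).
- move=> i _ /=; rewrite /coord in_itv/= -ltr_distlC; exact: cP.
Qed.
End rV_measurable.

Section lebesgue_rV.
Context (R : realType).
Definition cons_rV n (p : R * 'rV[R]_n) : 'rV[R]_n.+1 := row_mx p.1%:M p.2.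

Lemma cons_rV0 n p : @cons_rV n p ord0 ord0 = p.1.
Proof.
have -> : (ord0 : 'I_n.+1) = lshift n (ord0 : 'I_1) by exact: val_inj.
by rewrite [LHS]row_mxEl mxE.
Qed.

Lemma cons_rVS n p i : @cons_rV n p ord0 (lift ord0 i) = p.2 ord0 i.
Proof.
have -> : lift (ord0 : 'I_n.+1) i = rshift 1 i by exact: val_inj.
by rewrite [LHS]row_mxEr.
Qed.

Lemma measurable_cons_rV n : measurable_fun setT (@cons_rV n).
Proof.
apply: measurable_fun_rV => i; case: (unliftP ord0 i) => [j|] ->.
  rewrite (_ : (fun _ => _) = (fun v : 'rV[R]_n => v ord0 j) \o snd).
    exact: (measurableT_comp (@measurable_coord R n j) measurable_snd).
  by apply/funext => p/=; rewrite cons_rVS.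
rewrite (_ : (fun _ => _) = fst); first exact: measurable_fst.
by apply/funext => p/=; rewrite cons_rV0.
Qed.

Section step.
Context n (mu : {sigma_finite_measure set 'rV[R]_n -> \bar R}).

Let P : {measure set (measurableTypeR R * 'rV[R]_n)%type -> \bar R} :=
  (@lebesgue_measure R \x mu)%E.
Definition lebesgue_cons : set 'rV[R]_n.+1 -> \bar R := pushforward P (@cons_rV n).

Let lc0 : lebesgue_cons set0 = 0%E.
Proof. by rewrite /lebesgue_cons /pushforward preimage_set0 measure0. Qed.
Let lc_ge0 A : (0 <= lebesgue_cons A)%E.
Proof. exact: (measure_ge0 P). Qed.
Let lc_sig : semi_sigma_additive lebesgue_cons.
Proof.
have := @measure_semi_sigma_additive _ _ _ (pushforward P (@cons_rV n)).
apply. exact: measurable_cons_rV.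
Qed.
HB.instance Definition _ := isMeasure.Build _ _ _ lebesgue_cons lc0 lc_ge0 lc_sig.
Let sf : sigma_finite setT lebesgue_cons.
Proof.
have /sigma_finiteP[F [TF ndF mF]] := sigma_finiteT (@lebesgue_measure R).
have /sigma_finiteP[G [TG ndG mG]] := sigma_finiteT mu.
pose p (v : 'rV[R]_n.+1) : R * 'rV[R]_n := (v ord0 ord0, \row_i v ord0 (lift ord0 i)).
have Kp u : p (cons_rV u) = u.
  by rewrite /p cons_rV0; case: u => a b; congr pair; apply/rowP => i; rewrite mxE cons_rVS.
have mp : measurable_fun setT p.
  apply/measurable_fun_pairP; split; first exact: measurable_coord.
  apply: measurable_fun_rV => i /=.
  under eq_fun do rewrite mxE.
  exact: measurable_coord.
exists (fun k => p @^-1` (F k `*` G k)).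
  apply/seteqP; split => // v _.
  have : setT (p v).1 by []; rewrite TF => -[i _ Fi].
  have : setT (p v).2 by []; rewrite TG => -[j _ Gj].
  exists (maxn i j) => //; split.
    by move: Fi; exact/subsetPset/ndF/leq_maxl.
  by move: Gj; exact/subsetPset/ndG/leq_maxr.
move=> k; have [mFk Fk] := mF k; have [mGk Gk] := mG k; split.
  by rewrite -[X in measurable X]setTI; apply: mp => //; exact: measurableX.
rewrite /lebesgue_cons /pushforward -comp_preimage.
rewrite (_ : p \o _ = id); last by apply/funext => u /=; rewrite Kp.
by rewrite /P/= preimage_id product_measure1E// lte_mul_pinfty// ge0_fin_numE.
Qed.
HB.instance Definition _ := Measure_isSigmaFinite.Build _ _ _ lebesgue_cons sf.
End step.

(* Lebesgue measure on R^n, as an iterated product measure; it is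
   characterized by lebesgue_rV_box. *)
Fixpoint lebesgue_rV n : {sigma_finite_measure set 'rV[R]_n -> \bar R} :=
  if n is m.+1 then lebesgue_cons (lebesgue_rV m) else \d_(0 : 'rV[R]_0).

Lemma lebesgue_rV_box n (A : 'I_n -> set R) : (forall i, measurable (A i)) ->
  lebesgue_rV n [set v : 'rV[R]_n | forall i, A i (v ord0 i)] =
  (\prod_(i < n) lebesgue_measure (A i))%E.
Proof.
elim: n A => [|n IH] A mA.
  by rewrite big_ord0 /= diracE mem_set// => -[].
have mB : measurable [set v : 'rV[R]_n | forall i, A (lift ord0 i) (v ord0 i)].
  rewrite (_ : mkset _ = \bigcap_(i in [set: 'I_n])
      ((fun v : 'rV[R]_n => v ord0 i) @^-1` A (lift ord0 i))).
    apply: fin_bigcap_measurable; first exact: finite_finset.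
    move=> i _; rewrite -[X in measurable X]setTI.
    exact: measurable_coord.
  by apply/seteqP; split => v /= h i // *; exact: h.
rewrite big_ord_recl -IH// -product_measure1E//.
rewrite /= /lebesgue_cons /pushforward; congr (_ _).
apply/seteqP; split => -[x v]/=.
  move=> h; split => /=; first by have := h ord0; rewrite cons_rV0.
  by move=> i; have := h (lift ord0 i); rewrite cons_rVS.
move=> [/= hx hv] i; case: (unliftP ord0 i) => [j|] ->; first by rewrite cons_rVS.
by rewrite cons_rV0.
exact: mA.
Qed.
End lebesgue_rV.

Section smooth.
Context (R : realType) (n : nat).
Implicit Types (U W : set 'rV[R]_n) (phi psi : 'rV[R]_n -> R).

Definition partial (i : 'I_n) phi : 'rV[R]_n -> R :=
  fun x => 'D_(delta_mx ord0 i) phi x.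

Definition partials (s : seq 'I_n) phi := foldr partial phi s.

(* phi is C^infinity on U, for U open: all iterated partial derivatives exist
   and are continuous at the points of U. *)
Definition smooth_on U phi := forall (s : seq 'I_n) x, U x ->
  {for x, continuous (partials s phi)} /\
  forall i, derivable (partials s phi) x (delta_mx ord0 i).

(* Elements of C_c^infinity(U), extended by zero to R^n. *)
Definition test_function U phi :=
  [/\ smooth_on setT phi, compact (closure [set x | phi x != 0]) &
      closure [set x | phi x != 0] `<=` U].

(* The boundary is smooth when it is locally given by a smooth defining
   function with nonvanishing gradient, W lying on one side of it. *)
Definition smooth_boundary W := forall p, (closure W `\` interior W) p ->
  exists U psi, [/\ open_nbhs p U, smooth_on U psi,
    (forall x, U x -> exists i, partial i psi x != 0) &
    W `&` U = [set x | psi x < 0] `&` U].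

End smooth.

Section dirichlet_laplacian.
Context (R : realType) (n : nat) (Omega : set 'rV[R]_n) (oOmega : open Omega).

(* Functions in L^2(Omega) are represented by functions on R^n, and identified
   when they agree almost everywhere on Omega. *)
Definition lebesgue_on : {measure set 'rV[R]_n -> \bar R} :=
  mrestr (lebesgue_rV R n) (open_measurable_rV oOmega).

Definition L2 : Type := LspaceType2 lebesgue_on.
HB.instance Definition _ := NormedModule.on L2.

Implicit Types u v f : L2.

Definition weak_partial (i : 'I_n) u v :=
  forall phi, test_function Omega phi ->
  \int[lebesgue_on]_x (u x * partial i phi x) = - \int[lebesgue_on]_x (v x * phi x).

(* Weak derivatives are unique in L^2(Omega), so that the existentially
   quantified functions below are the weak derivatives. *)
Definition sobolev_H2 u := forall i, exists2 v, weak_partial i u v &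
  forall j, exists w, weak_partial j v w.

(* The closure of C_c^infinity(Omega) for the norm of H^1(Omega). *)
Definition sobolev_H10 u := exists2 g : 'I_n -> L2, (forall i, weak_partial i u (g i)) &
  forall e : R, 0 < e -> exists2 phi, test_function Omega phi &
    ('N[lebesgue_on]_2[EFin \o (u \- phi)%R] ^+ 2 +
     \sum_(i < n) 'N[lebesgue_on]_2[EFin \o (g i \- partial i phi)%R] ^+ 2
       < (e ^+ 2)%:E)%E.

Definition laplacian u f := exists g h : 'I_n -> L2,
  (forall i, weak_partial i u (g i) /\ weak_partial i (g i) (h i)) /\
  f = \sum_(i < n) h i.

(* Unbounded operators are represented by their graph: this reads
   "u belongs to D(A) and A u = f". *)
Definition dirichlet_laplacian u f := [/\ sobolev_H10 u, sobolev_H2 u & laplacian u f].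

Context (omega : set 'rV[R]_n) (oomega : open omega).

Lemma Lfun_indicM v : (fun x => \1_omega x * v x) \in Lfun lebesgue_on 2%:E.
Proof.
have mv : measurable_fun setT (v : 'rV[R]_n -> R).
  exact: set_mem (sub_Lfun_mfun (Lspace_Lfun v)).
have mi : measurable_fun setT (fun x => \1_omega x * v x).
  apply: measurable_funM => //; apply: measurable_indic.
  exact: open_measurable_rV.
rewrite inE; apply/andP; split; rewrite inE//=.
apply: le_lt_trans (set_mem (sub_Lfun_finLfun (Lspace_Lfun v))).
rewrite unlock /= gt0_ler_poweR//.
- by rewrite in_itv/= leey integral_ge0.
- by rewrite in_itv/= leey integral_ge0.
apply: ge0_le_integral => //.
- by apply/measurable_EFinP/(measurableT_comp (measurable_powR _)); exact: measurableT_comp.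
- by apply/measurable_EFinP/(measurableT_comp (measurable_powR _)); exact: measurableT_comp.
move=> x _ /=; rewrite lee_fin ge0_ler_powR// normrM ler_piMl// indicE.
by case: (x \in _); rewrite ?normr1 ?normr0.
Qed.

Definition control_op v : L2 := Lspace_of (lee1n 2) (Lfun_indicM v).

Lemma control_opE v :
  \forall x \ae lebesgue_on, control_op v x = \1_omega x * v x.
Proof. by apply: filterS (Lspace_ofE (lee1n 2) (Lfun_indicM v)) => x /(_ I). Qed.

End dirichlet_laplacian.

Arguments dirichlet_laplacian {R n Omega} oOmega u f.

Section operators.
Context (R : realType) (V : normedModType R).
Implicit Types (A : V -> V -> Prop) (S : R -> V -> V).

Definition op_eigenvalue A (l : R) := exists2 x, x != 0 & A x (l *: x).

(* The eigenspace has dimension one. *)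
Definition op_simple_eigenvalue A (l : R) := exists x, [/\ x != 0, A x (l *: x) &
  forall y, A y (l *: y) -> exists c : R, y = c *: x].

Record C0_semigroup S : Prop := {
  C0_linear : forall t, 0 <= t -> linear (S t) ;
  C0_continuous : forall t, 0 <= t -> continuous (S t) ;
  C0_zero : forall x, S 0 x = x ;
  C0_add : forall s t x, 0 <= s -> 0 <= t -> S (s + t) x = S s (S t x) ;
  C0_strong : forall x, S t x @[t --> 0^'+] --> x
}.

Definition generator S (x y : V) := h^-1 *: (S h x - x) @[h --> 0^'+] --> y.

Definition generated_by S A := C0_semigroup S /\ forall x y, A x y <-> generator S x y.

End operators.

(* The Bochner integral over D of functions with values in a normed space. A
   simple function is given by a finite family of measurable sets, possibly
   overlapping, and of values. *)
Section bochner.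
Context d (T : measurableType d) (R : realType) (V : normedModType R).

Record simple_fun := SimpleFun {
  sf_size : nat ;
  sf_set : 'I_sf_size -> set T ;
  sf_val : 'I_sf_size -> V ;
  sf_measurable : forall k, measurable (sf_set k) }.

Definition sf_eval (s : simple_fun) (t : T) : V :=
  \sum_(k < sf_size s) (\1_(sf_set k) t : R) *: sf_val k.

Context (mu : {measure set T -> \bar R}) (D : set T).

Definition sf_integral (s : simple_fun) : V :=
  \sum_(k < sf_size s) fine (mu (sf_set k `&` D)) *: sf_val k.

Definition sf_ae_cvg (s : nat -> simple_fun) (f : T -> V) :=
  \forall t \ae mu, D t -> sf_eval (s m) t @[m --> \oo] --> f t.

Definition strongly_measurable (f : T -> V) := exists s, sf_ae_cvg s f.

Definition is_bochner_integral (f : T -> V) (v : V) :=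
  exists s : nat -> simple_fun, [/\
    forall m k, (mu (@sf_set (s m) k `&` D) < +oo)%E,
    sf_ae_cvg s f,
    (\int[mu]_(t in D) (`|f t - sf_eval (s m) t|)%:E)%E @[m --> \oo] --> 0%E &
    sf_integral (s m) @[m --> \oo] --> v].

End bochner.

Section control.
Context (R : realType) (V : normedModType R).
Context (S : R -> V -> V) (B : V -> V) (T : R).

(* L^2(0, T; V) *)
Definition L2_control (u : R -> V) :=
  strongly_measurable lebesgue_measure `]0, T[ u /\
  (\int[lebesgue_measure]_(t in `]0%R, T[) (`|u t| ^+ 2)%:E < +oo)%E.

Definition mild_solution (z0 : V) (u z : R -> V) := forall t, 0 <= t <= T ->
  exists2 w, is_bochner_integral lebesgue_measure `]0, t[
               (fun s => S (t - s) (B (u s))) w &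
    z t = S t z0 + w.

Definition approximately_controllable := forall (z0 z1 : V) (e : R), 0 < e ->
  exists2 u, L2_control u & exists2 z, mild_solution z0 u z & `|z T - z1| <= e.

End control.

(* Main.v *)
Require Import Defs.
From HB Require Import structures.
From mathcomp Require Import all_boot all_order all_algebra.
From mathcomp Require Import all_classical all_reals all_analysis.
From mathcomp Require Import measurable_realfun.
From mathcomp Require Import ring lra.
Set Implicit Arguments. Unset Strict Implicit. Unset Printing Implicit Defensive.
Import Order.TTheory GRing.Theory Num.Theory.
Import numFieldNormedType.Exports.
Local Open Scope classical_set_scope.
Local Open Scope ring_scope.

(* By duality it suffices that a vector phi orthogonal to the states reached from 0
   vanishes. The Dirichlet Laplacian A is symmetric and dissipative, so that S is a
   semigroup of positive symmetric contractions and S(t) phi lies in the domain of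
   every power of A, with |A^k S(t) phi| <= (k/t)^k |phi|. The orthogonality says
   that a_k := A^k S(t) phi vanishes on omega for all k and 0 < t < T, and it remains
   to prove unique continuation for such a sequence; no spectral decomposition is
   involved. Near a point around which all the a_k vanish, a radial test function
   psi(|y - x|^2) is, on the support of the a_k, an iterated Laplacian of
   eta_k(|y - x|^2) with eta_k of size K^k/(2k)!, whence
   int a_0 psi = int a_k eta_k -> 0. Differentiating these identities in the centre x
   gives int a_0 P psi = 0 for all polynomials P, hence a_0 = 0 on a ball whose radius
   depends only on the distance to the boundary. Connectedness of Omega and the
   injectivity of S(t) conclude. *)

(** * Semigroups generated by symmetric dissipative operators *)

(** The sizes balance as follows: smoothing by the semigroup costs one factor k per power of A, so
    the k-th power has size C^k k!, whereas inverting the radial Laplacian integrates twice and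
    gains 1/(2k)!. The pairing is thus bounded by a term of an exponential series, whatever the
    radius. Zeros therefore spread to a distance that does not depend on the ball they start from,
    and this makes the zero set closed in Omega. The radial equation 4 s eta'' + 2 n eta' = psi, s =
    |y - x|^2, degenerates at s = 0. It is solved inwards from the outer edge, which keeps eta_k
    compactly supported, and only for s >= e: on the remaining ball every a_k vanishes. About S only
    the graph of its generator is known. Dissipativity and symmetry are passed to S by cutting
    [0, t] into N short steps and adding up the errors; the smoothing bound comes from a telescoping
    sum of positive operators. *)

Section inner_product.
Context (R : realType) (V : normedModType R) (ip : V -> V -> R).

Record inner_product : Prop := {
  ipC : forall x y, ip x y = ip y x ;
  ipDl : forall x y z, ip (x + y) z = ip x z + ip y z ;
  ipZl : forall a x z, ip (a *: x) z = a * ip x z ;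
  ipxx : forall x, ip x x = `|x| ^+ 2 }.

Hypothesis ipP : inner_product.

Lemma ip0l x : ip 0 x = 0.
Proof. by rewrite -(scale0r 0) ipZl// mul0r. Qed.

Lemma ipNl x y : ip (- x) y = - ip x y.
Proof. by rewrite -scaleN1r ipZl// mulN1r. Qed.

Lemma ipBl x y z : ip (x - y) z = ip x z - ip y z.
Proof. by rewrite ipDl// ipNl. Qed.

Lemma ip0r x : ip x 0 = 0.
Proof. by rewrite ipC// ip0l. Qed.

Lemma ipDr x y z : ip z (x + y) = ip z x + ip z y.
Proof. by rewrite ipC// ipDl// !(ipC ipP z). Qed.

Lemma ipZr a x z : ip z (a *: x) = a * ip z x.
Proof. by rewrite ipC// ipZl// (ipC ipP z). Qed.

Lemma ipNr x y : ip y (- x) = - ip y x.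
Proof. by rewrite ipC// ipNl ipC. Qed.

Lemma ipBr x y z : ip z (x - y) = ip z x - ip z y.
Proof. by rewrite ipDr ipNr. Qed.

Lemma ip_suml n (F : 'I_n -> V) y : ip (\sum_(i < n) F i) y = \sum_(i < n) ip (F i) y.
Proof.
elim: n F => [|n IH] F; first by rewrite !big_ord0 ip0l.
by rewrite !big_ord_recr/= ipDl// IH.
Qed.

Lemma ip_eq0 x : (forall y, ip x y = 0) -> x = 0.
Proof. by move=> /(_ x); rewrite ipxx// => /eqP; rewrite sqrf_eq0 normr_eq0 => /eqP. Qed.

Lemma normrDsq (x y : V) : `|x + y| ^+ 2 = `|x| ^+ 2 + 2 * ip x y + `|y| ^+ 2.
Proof.
by rewrite -!(ipxx ipP) ipDl// !ipDr (ipC ipP y x); ring.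
Qed.

Lemma normrBsq (x y : V) : `|x - y| ^+ 2 = `|x| ^+ 2 - 2 * ip x y + `|y| ^+ 2.
Proof. by rewrite normrDsq ipNr normrN mulrN. Qed.

Lemma parallelogram (x y : V) : `|x + y| ^+ 2 + `|x - y| ^+ 2 = 2 * `|x| ^+ 2 + 2 * `|y| ^+ 2.
Proof. by rewrite normrDsq normrBsq; ring. Qed.

Lemma ip_le (x y : V) : ip x y <= `|x| * `|y|.
Proof.
have [->|x0] := eqVneq x 0; first by rewrite ip0l normr0 mul0r.
have [->|y0] := eqVneq y 0; first by rewrite ip0r normr0 mulr0.
have {}x0 : 0 < `|x| by rewrite normr_gt0.
have {}y0 : 0 < `|y| by rewrite normr_gt0.
(* Cauchy-Schwarz: this square expands to 2 |x| |y| (|x| |y| - ip x y). *)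
have : 0 <= `|(`|y| *: x - `|x| *: y)| ^+ 2 by rewrite exprn_ge0.
rewrite normrBsq ipZl// ipZr !normrZ !normr_id.
have xy0 : 0 < `|x| * `|y| by rewrite mulr_gt0.
by move=> h; rewrite -(ler_pM2l xy0); nra.
Qed.

Lemma ip_abs x y : `|ip x y| <= `|x| * `|y|.
Proof.
rewrite ler_norml ip_le andbT lerNl -ipNl.
by rewrite (le_trans (ip_le _ _))// normrN.
Qed.

Lemma cvg_ip {T : Type} (F : set_system T) {FF : Filter F} (f g : T -> V) x y :
  f @ F --> x -> g @ F --> y -> (fun t => ip (f t) (g t)) @ F --> ip x y.
Proof.
move=> fx gy.
have -> : (fun t => ip (f t) (g t)) =
    (fun t => ip (f t - x) (g t - y) + ip (f t - x) y + ip x (g t - y) + ip x y).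
  by apply/funext => t; rewrite !ipBl !ipBr; ring.
rewrite -[X in _ --> X]add0r; apply: cvgD; last exact: cvg_cst.
have fx0 : (fun t => `|f t - x|) @ F --> (0 : R).
  by rewrite -[0](@normr0 _ V) -(subrr x); apply: cvg_norm; apply: cvgB => //; exact: cvg_cst.
have gy0 : (fun t => `|g t - y|) @ F --> (0 : R).
  by rewrite -[0](@normr0 _ V) -(subrr y); apply: cvg_norm; apply: cvgB => //; exact: cvg_cst.
have sq (h : T -> R) (k : T -> R) : k @ F --> (0 : R) ->
   (forall t, `|h t| <= k t) -> h @ F --> (0 : R).
  move=> k0 hk; apply/norm_cvg0P; apply: (@squeeze_cvgr _ _ _ _ (fun=> 0) k) => //.
    by apply: nearW => t; rewrite normr_ge0 hk.
  exact: cvg_cst.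
rewrite -[X in _ --> X]addr0 -[X in _ --> X + _]addr0; apply: cvgD; first apply: cvgD.
- apply: (sq _ (fun t => `|f t - x| * `|g t - y|)); last by move=> t; exact: ip_abs.
  by rewrite -[X in _ --> X](mulr0 0); exact: cvgM.
- apply: (sq _ (fun t => `|f t - x| * `|y|)); last by move=> t; exact: ip_abs.
  by rewrite -[X in _ --> X](mul0r `|y|); apply: cvgM => //; exact: cvg_cst.
- apply: (sq _ (fun t => `|x| * `|g t - y|)); last by move=> t; exact: ip_abs.
  by rewrite -[X in _ --> X](mulr0 `|x|); apply: cvgM => //; exact: cvg_cst.
Qed.

End inner_product.

Lemma cauchy_seq_cvg (R : realType) (V : completeNormedModType R) (u : nat -> V) :
  (forall e : R, 0 < e -> exists N, forall n m, (N <= n)%N -> (N <= m)%N ->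
     `|u n - u m| <= e) -> cvgn u.
Proof.
move=> uc; apply: cauchy_cvg; apply: cauchy_exP => e e0.
have e20 : 0 < e / 2 by rewrite divr_gt0.
have [N uN] := uc _ e20.
exists (u N); exists N => // n /= Nn; rewrite -ball_normE /ball_/=.
apply: le_lt_trans (_ : e / 2 < e); last by lra.
exact: uN.
Qed.


(** * Density of a subspace with trivial orthogonal *)

Section projection.
Context (R : realType) (V : completeNormedModType R) (ip : V -> V -> R).
Hypothesis ipP : inner_product ip.

(** A minimising sequence for the distance from [y] to [W] is Cauchy by the parallelogram law, and
    the residual at its limit is orthogonal to [W], hence zero. [W] is not assumed closed: the limit
    is taken in [V]. *)
Lemma dense_of_orthogonal_trivial (W : set V) : W 0 ->
  (forall x y, W x -> W y -> W (x + y)) -> (forall a x, W x -> W (a *: x)) ->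
  (forall f, (forall w, W w -> ip w f = 0) -> f = 0) ->
  forall y (e : R), 0 < e -> exists2 w, W w & `|y - w| <= e.
Proof.
move=> W0 WD WZ Wo y.
pose E : set R := [set `|y - w| ^+ 2 | w in W].
have Einf : has_inf E.
  split; first by exists (`|y - 0| ^+ 2), 0.
  by exists 0 => _ [w _ <-]; rewrite exprn_ge0.
have dle w : W w -> inf E <= `|y - w| ^+ 2.
  by move=> Ww; apply: ge_inf; [case: Einf | exists w].
have wn n : {w : V | W w /\ `|y - w| ^+ 2 < inf E + n.+1%:R^-1}.
  apply: cid; have n0 : 0 < (n.+1%:R^-1 : R) by rewrite invr_gt0.
  by have [_ [w Ww <-] wl] := inf_adherent n0 Einf; exists w.
pose u n := sval (wn n).
have Wu n : W (u n) by rewrite /u; case: (wn n) => ? [].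
have ul n : `|y - u n| ^+ 2 < inf E + n.+1%:R^-1 by rewrite /u; case: (wn n) => ? [].
have small (e : R) : 0 < e -> exists N, forall n, (N <= n)%N -> n.+1%:R^-1 < e.
  move=> e0; have := near_infty_natSinv_lt (PosNum e0).
  by case=> N _ NP; exists N => n Nn; exact: (NP n).
have cu : cvgn u.
  apply: cauchy_seq_cvg => e e0.
  (* Midpoints lie in [W], so |u n - u m|^2 <= 2/(n+1) + 2/(m+1). *)
  have [|N NP] := small (e ^+ 2 / 4); first by rewrite divr_gt0// exprn_gt0.
  exists N => n m Nn Nm.
  rewrite -(@ler_pXn2r _ 2)// ?nnegrE// ?(ltW e0)//.
  have := parallelogram ipP (y - u n) (y - u m).
  rewrite (_ : y - u n - (y - u m) = - (u n - u m)); last by rewrite opprB addrC addrA subrK opprB.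
  rewrite normrN (_ : y - u n + (y - u m) = 2 *: (y - 2^-1 *: (u n + u m))); last first.
    rewrite scalerBr scalerA divff// scale1r scaler_nat opprD mulr2n.
    by rewrite addrACA.
  rewrite normrZ exprMn ger0_norm// => par.
  have := dle (2^-1 *: (u n + u m)) (WZ _ _ (WD _ _ (Wu n) (Wu m))).
  have := ul n; have := ul m; have := NP _ Nn; have := NP _ Nm.
  move: par; rewrite (_ : 2 ^+ 2 = 4); last by ring.
  move: (`|y - u n| ^+ 2) (`|y - u m| ^+ 2) (`|y - _| ^+ 2) (`|u n - u m| ^+ 2) (inf E) => b1 b2 b3 b4 b5.
  move: (n.+1%:R^-1) (m.+1%:R^-1) => b6 b7.
  lra.
have f0 : y - limn u = 0.
  apply: Wo => w Ww; rewrite (ipC ipP).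
  (* First variation: moving from [u n] along [t *: w] lowers the squared distance by less than
     1/(n+1). *)
  have key (t : R) : 0 <= t ^+ 2 * `|w| ^+ 2 - 2 * (t * ip (y - limn u) w).
    have lim2 : (fun n => `|y - u n - t *: w| ^+ 2 - `|y - u n| ^+ 2 + n.+1%:R^-1) @ \oo -->
       - 2 * (t * ip (y - limn u) w) + t ^+ 2 * `|w| ^+ 2.
      have -> : (fun n => `|y - u n - t *: w| ^+ 2 - `|y - u n| ^+ 2 + n.+1%:R^-1) =
         (fun n => - 2 * (t * ip (y - u n) w) + t ^+ 2 * `|w| ^+ 2 + n.+1%:R^-1).
        apply/funext => n; rewrite (normrBsq ipP) (ipZr ipP) normrZ exprMn -normrX ger0_norm ?sqr_ge0//.
        ring.
      rewrite -[X in _ --> X]addr0; apply: cvgD; last exact: cvg_harmonic.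
      apply: cvgD; last exact: cvg_cst.
      apply: cvgM; first exact: cvg_cst.
      apply: cvgM; first exact: cvg_cst.
      apply: (cvg_ip ipP); last exact: cvg_cst.
      by apply: cvgB; [exact: cvg_cst | exact: cu].
    have := cvgr_to_ge lim2 (_ : \forall n \near \oo, 0 <= _).
    rewrite addrC mulNr; apply; apply: nearW => n.
    have aux (a b c d : R) : a < c + d -> c <= b -> 0 <= b - a + d by lra.
    apply: aux (ul n) _; rewrite -addrA -opprD.
    exact: dle (WD _ _ (Wu n) (WZ _ _ Ww)).
  set a := ip _ _ in key *; set b := `|w| ^+ 2 in key.
  have b0 : 0 <= b by rewrite exprn_ge0.
  have [b1|b1] := eqVneq b 0.
    by have := key a; rewrite b1; nra.
  (* At its minimum the quadratic in t equals - a^2 / b. *)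
  have := key (a / b).
  rewrite (_ : _ - _ = - (a ^+ 2 / b)); last by field.
  rewrite oppr_ge0 pmulr_lle0 ?invr_gt0 ?lt0r ?b1// => h.
  by apply/eqP; rewrite -sqrf_eq0 eq_le h sqr_ge0.
have ycu : u @ \oo --> y by move/eqP: f0; rewrite subr_eq0 => /eqP ->.
move=> e e0; have /cvgrPdist_le /(_ _ e0)[N _ NP] := ycu.
by exists (u N) => //; exact: (NP N (leqnn N)).
Qed.

End projection.

Lemma cvg_le_dist (R : realType) (V : normedModType R) (I : Type) (F : set_system I)
  {FF : Filter F} (f : I -> V) (x : V) (a : I -> R) :
  (forall t, `|x - f t| <= a t) -> a @ F --> 0 -> f @ F --> x.
Proof.
move=> fa a0; apply/cvgrPdist_le => e e0; near=> t.
apply: le_trans (fa t) _; apply: le_trans (ler_norm _) _.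
by near: t; exact: cvgr0_norm_le.
Unshelve. all: by end_near. Qed.

(** * Bochner integration of uniform limits of simple functions *)

Section integral_facts.
Context d (T : measurableType d) (R : realType) (mu : {measure set T -> \bar R}).

(** Immediate from the definition of the integral as a supremum over simple functions. In this form
    it applies to norms |f t - s t| of vector-valued functions, whose measurability is not
    established. *)
Lemma ge0_le_integral_sup (D : set T) (f g : T -> \bar R) :
  (forall x, D x -> 0 <= f x)%E -> (forall x, D x -> f x <= g x)%E ->
  (\int[mu]_(x in D) f x <= \int[mu]_(x in D) g x)%E.
Proof.
move=> f0 fg; rewrite [leLHS]integral_mkcond [leRHS]integral_mkcond.
have f0' x : (0 <= (f \_ D) x)%E by apply: erestrict_ge0.
have g0' x : (0 <= (g \_ D) x)%E.
  by apply: erestrict_ge0 => t Dt; exact: le_trans (f0 _ Dt) (fg _ Dt).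
rewrite !ge0_integralTE//; apply: ge_ereal_sup => _ [h hf <-].
apply: ereal_sup_ubound; exists h => // x; apply: le_trans (hf x) _.
by apply: lee_restrict.
Qed.

Lemma bounded_integrable (D : set T) (f : T -> R) (c : R) : measurable D ->
  (mu D < +oo)%E -> measurable_fun D f -> (forall x, D x -> `|f x| <= c) ->
  mu.-integrable D (EFin \o f).
Proof.
move=> mD Doo mf fc; apply: measurable_bounded_integrable => //.
exists c; split; first exact: num_real.
by move=> M cM x /= Dx; apply: le_trans (fc _ Dx) (ltW cM).
Qed.

Lemma le_Rintegral_bound (D : set T) (f : T -> R) (c : R) : measurable D ->
  (mu D < +oo)%E -> measurable_fun D f -> (forall x, D x -> `|f x| <= c) ->
  `|\int[mu]_(x in D) f x| <= c * fine (mu D).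
Proof.
move=> mD Doo mf fc; have fi := bounded_integrable mD Doo mf fc.
apply: le_trans (le_normr_Rintegral mD fi) _.
rewrite -Rintegral_cst//; apply: le_Rintegral => //.
  exact: (integrable_abse fi).
by apply: (@bounded_integrable _ _ `|c|) => //.
Qed.

End integral_facts.

(** Uniform approximation yields a Bochner integral at once on a set of finite measure, and is
    stable under sums, bounded operators and indicators. This covers the integrands s -> S(t - s) B
    u(s) with [u] simple. *)
Definition regulated d (T : measurableType d) (R : realType) (V : normedModType R)
    (D : set T) (f : T -> V) := forall e : R, 0 < e ->
  exists s : simple_fun T V, forall t, D t -> `|f t - sf_eval s t| <= e.

Section regulated_closure.
Context d (T : measurableType d) (R : realType) (V : normedModType R) (D : set T).
Implicit Types (s : simple_fun T V) (f g : T -> V).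
Local Notation ssz s := (@sf_size d T R V s).
Local Notation sset s := (@sf_set d T R V s).
Local Notation sval_ s := (@sf_val d T R V s).

Lemma eq_regulated f g : (forall t, D t -> f t = g t) -> regulated D f -> regulated D g.
Proof. by move=> fg rf e /rf[s fs]; exists s => t Dt; rewrite -fg// fs. Qed.

Lemma regulated0 : regulated D (fun=> 0 : V).
Proof.
move=> e e0; exists (@SimpleFun _ _ _ _ 0 (fun=> set0) (fun=> 0) (fun=> measurable0)) => t _.
by rewrite /sf_eval big_ord0 subr0 normr0 ltW.
Qed.

(** The sets of a [simple_fun] may overlap, so a sum is a mere concatenation. *)
Definition sf_cat s s' : simple_fun T V := @SimpleFun _ _ _ _ (ssz s + ssz s')%N
  (fun k => match fintype.split k with inl i => sset s i | inr j => sset s' j end)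
  (fun k => match fintype.split k with inl i => sf_val i | inr j => sf_val j end)
  (fun k => match fintype.split k as x return measurable (match x with inl i => sset s i | inr j => sset s' j end) with
    | inl i => sf_measurable i | inr j => sf_measurable j end).

Lemma sf_catE s s' t : sf_eval (sf_cat s s') t = sf_eval s t + sf_eval s' t.
Proof.
rewrite /sf_eval /= big_split_ord /=; congr (_ + _); apply: eq_bigr => i _.
  by rewrite (unsplitK (inl i)).
by rewrite (unsplitK (inr i)).
Qed.

Lemma regulatedD f g : regulated D f -> regulated D g -> regulated D (fun t => f t + g t).
Proof.
move=> rf rg e e0; have e20 : 0 < e / 2 by rewrite divr_gt0.
have [s fs] := rf _ e20; have [s' gs] := rg _ e20.
exists (sf_cat s s') => t Dt; rewrite sf_catE opprD addrACA (le_trans (ler_normD _ _))//.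
by rewrite [e]splitr lerD ?fs ?gs.
Qed.

Lemma regulated_sum (n : nat) (F : 'I_n -> T -> V) : (forall k, regulated D (F k)) ->
  regulated D (fun t => \sum_(k < n) F k t).
Proof.
elim: n F => [|n IH] F rF.
  by apply: eq_regulated regulated0 => t _; rewrite big_ord0.
apply: (@eq_regulated (fun t => \sum_(k < n) F (widen_ord (leqnSn n) k) t + F ord_max t)).
  by move=> t _; rewrite big_ord_recr.
by apply: regulatedD => //; exact: IH.
Qed.

Definition sf_comp (L : V -> V) s : simple_fun T V := @SimpleFun _ _ _ _ (ssz s)
  (sset s) (fun k => L (sf_val k)) (@sf_measurable _ _ _ _ s).

Lemma sf_compE (L : V -> V) s t : linear L -> sf_eval (sf_comp L s) t = L (sf_eval s t).
Proof.
move=> linL.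
pose L' : {linear V -> V} := HB.pack L (GRing.isLinear.Build _ _ _ _ _ linL).
rewrite -[L]/(L' : V -> V) /sf_eval raddf_sum; apply: eq_bigr => k _.
exact: (esym (linearZ_LR L' _ _)).
Qed.

Lemma sf_integral_comp (mu : {measure set T -> \bar R}) (L : V -> V) s : linear L ->
  sf_integral mu D (sf_comp L s) = L (sf_integral mu D s).
Proof.
move=> linL.
pose L' : {linear V -> V} := HB.pack L (GRing.isLinear.Build _ _ _ _ _ linL).
rewrite -[L]/(L' : V -> V) /sf_integral raddf_sum; apply: eq_bigr => k _.
exact: (esym (linearZ_LR L' _ _)).
Qed.

Lemma regulated_comp (L : V -> V) (c : R) f : linear L -> (forall x, `|L x| <= c * `|x|) ->
  regulated D f -> regulated D (L \o f).
Proof.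
move=> linL Lc rf e e0.
have c0 : 0 < `|c| + 1 by rewrite ltr_wpDl.
have [|s fs] := rf (e / (`|c| + 1)); first by rewrite divr_gt0.
exists (sf_comp L s) => t Dt; rewrite sf_compE//=.
pose L' : {linear V -> V} := HB.pack L (GRing.isLinear.Build _ _ _ _ _ linL).
rewrite -(raddfB L') /= (le_trans (Lc _))//.
have -> : e = (`|c| + 1) * (e / (`|c| + 1)) by field; rewrite gt_eqF.
apply: (@le_trans _ _ ((`|c| + 1) * `|f t - sf_eval s t|)).
  by rewrite ler_wpM2r// (le_trans (ler_norm c))// lerDl.
by rewrite ler_pM2l// fs.
Qed.

Lemma regulated_indic (A : set T) f : measurable A -> regulated D f ->
  regulated D (fun t => (\1_A t : R) *: f t).
Proof.
move=> mA rf e /rf[s fs].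
exists (@SimpleFun _ _ _ _ (ssz s) (fun k => A `&` sset s k) (@sval_ s)
  (fun k => measurableI _ _ mA (@sf_measurable _ _ _ _ s k))) => t Dt.
rewrite /sf_eval /=.
under eq_bigr do rewrite indicI/= -scalerA.
rewrite -scaler_sumr -scalerBr normrZ (le_trans _ (fs _ Dt))// ler_piMl//.
by rewrite indicE; case: (t \in A); rewrite ?normr1 ?normr0.
Qed.

End regulated_closure.

Section regulated.
Context d (T : measurableType d) (R : realType) (mu : {measure set T -> \bar R}).
Context (D : set T) (mD : measurable D) (Doo : (mu D < +oo)%E).
Context (V : completeNormedModType R) (ip : V -> V -> R).
Hypothesis ipP : inner_product ip.
Implicit Types (s : simple_fun T V) (f : T -> V).

Lemma measurable_ip_sf_eval s y : measurable_fun setT (fun t => ip (sf_eval s t) y).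
Proof.
rewrite (_ : (fun t => _) =
    (fun t => \sum_(k < sf_size s) (\1_(@sf_set _ _ _ _ s k) t : R) * ip (sf_val k) y)); last first.
  apply/funext => t; rewrite /sf_eval (ip_suml ipP).
  by apply: eq_bigr => k _; rewrite (ipZl ipP).
apply: measurable_sum => k; apply: measurable_funM => //.
by apply: measurable_indic; exact: sf_measurable.
Qed.

(** Vector integrals are handled throughout by their pairings with fixed vectors, which are scalar
    integrals. *)
Lemma ip_sf_integral s y :
  ip (sf_integral mu D s) y = \int[mu]_(t in D) ip (sf_eval s t) y.
Proof.
have int k : mu.-integrable D (fun t => ((\1_(@sf_set _ _ _ _ s k) t : R) * ip (sf_val k) y)%:E).
  apply: (@bounded_integrable _ _ _ _ _ _ `|ip (sf_val k) y|) => //.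
    apply: measurable_funM => //; apply: measurable_indic; exact: sf_measurable.
  move=> t _; rewrite normrM ler_piMl// indicE.
  by case: (t \in _); rewrite ?normr1 ?normr0.
have indi k : (\int[mu]_(t in D) (\1_(@sf_set _ _ _ _ s k) t)%:E)%E = mu (@sf_set _ _ _ _ s k `&` D).
  by rewrite integral_indic//; exact: sf_measurable.
rewrite /sf_integral (ip_suml ipP).
transitivity (\sum_(k < sf_size s) \int[mu]_(t in D) ((\1_(@sf_set _ _ _ _ s k) t : R) * ip (sf_val k) y)).
  apply: eq_bigr => k _; rewrite (ipZl ipP) RintegralZr//.
    by rewrite /Rintegral indi.
  apply: (@bounded_integrable _ _ _ _ _ _ 1) => //.
    by apply: measurable_indic; exact: sf_measurable.
  by move=> t _; rewrite indicE; case: (t \in _); rewrite ?normr1 ?normr0.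
rewrite /Rintegral sum_fine; last by move=> k _; exact: integrable_fin_num.
rewrite -integral_sum//; congr fine; apply: eq_integral => t _.
rewrite /sf_eval (ip_suml ipP) -sumEFin; apply: eq_bigr => k _.
by rewrite (ipZl ipP).
Qed.

Let approx f (rf : regulated D f) n :
  {s : simple_fun T V | forall t, D t -> `|f t - sf_eval s t| <= n.+1%:R^-1}.
Proof. by apply: cid; apply: rf; rewrite invr_gt0. Qed.

Lemma measurable_ip_regulated f y : regulated D f ->
  measurable_fun D (fun t => ip (f t) y).
Proof.
move=> rf; pose u n := sval (approx rf n).
apply: (@measurable_fun_cvg _ _ _ _ (fun n t => ip (sf_eval (u n) t) y)).
  by move=> n; apply: measurable_funTS; exact: measurable_ip_sf_eval.
move=> t Dt; apply: (cvg_ip ipP); last exact: cvg_cst.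
apply: (@cvg_le_dist _ _ _ _ _ _ _ (fun n => n.+1%:R^-1)) (@cvg_harmonic R).
by move=> n; rewrite /u; case: (approx rf n) => /= s; exact.
Qed.

Lemma regulated_bounded f : regulated D f -> exists c : R, forall t, D t -> `|f t| <= c.
Proof.
move=> /(_ 1 ltr01)[s fs].
exists (1 + \sum_(k < sf_size s) `|sf_val k : V|) => t Dt.
rewrite -[f t](subrK (sf_eval s t)) (le_trans (ler_normD _ _))// lerD ?fs//.
apply: le_trans (ler_norm_sum _ _ _) _; apply: ler_sum => k _.
by rewrite normrZ ler_piMl// indicE; case: (t \in _); rewrite ?normr1 ?normr0.
Qed.

Lemma sf_regulated s : regulated D (sf_eval s).
Proof. by move=> e e0; exists s => t _; rewrite subrr normr0 ltW. Qed.

Lemma integrable_ip_regulated f y : regulated D f ->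
  mu.-integrable D (EFin \o (fun t => ip (f t) y)).
Proof.
move=> rf; have [c fc] := regulated_bounded rf.
apply: (@bounded_integrable _ _ _ _ _ _ (c * `|y|)) => //.
  exact: measurable_ip_regulated.
move=> t Dt; apply: le_trans (ip_abs ipP _ _) _.
by rewrite ler_wpM2r// fc.
Qed.

Lemma Rintegral_ip_le f g y (e : R) : regulated D f -> regulated D g ->
  (forall t, D t -> `|f t - g t| <= e) ->
  `|\int[mu]_(t in D) ip (f t) y - \int[mu]_(t in D) ip (g t) y| <= e * `|y| * fine (mu D).
Proof.
move=> rf rg fg; rewrite -RintegralB//; try exact: integrable_ip_regulated.
apply: le_Rintegral_bound => //.
  by apply: measurable_funB; exact: measurable_ip_regulated.
move=> t Dt; rewrite -(ipBl ipP) (le_trans (ip_abs ipP _ _))//.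
by rewrite ler_wpM2r// fg.
Qed.

(** Pairing the difference [w] with itself makes |w|^2 a scalar integral bounded by e |w| mu(D). *)
Lemma sf_integral_dist s s' (e : R) :
  (forall t, D t -> `|sf_eval s t - sf_eval s' t| <= e) ->
  `|sf_integral mu D s - sf_integral mu D s'| <= e * fine (mu D).
Proof.
move=> ss; set w := _ - _.
have [->|w0] := eqVneq w 0.
  rewrite normr0.
  (* [e] may be negative when [D] is empty, but then the measure is 0. *)
  have [[t Dt]|D0] := pselect (D !=set0).
    by rewrite mulr_ge0 ?fine_ge0// (le_trans _ (ss _ Dt)).
  rewrite (_ : D = set0) ?measure0 ?mulr0//.
  by apply/eqP; apply: contrapT => /negP/set0P.
rewrite -(ler_pM2r (_ : 0 < `|w|)) ?normr_gt0// -expr2 -(ipxx ipP) {1}/w (ipBl ipP) !ip_sf_integral.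
apply: le_trans (ler_norm _) _; apply: le_trans.
  by apply: Rintegral_ip_le ss; exact: sf_regulated.
by rewrite mulrAC.
Qed.

(** The integrals of uniform approximants are Cauchy. The second clause says that bounded operators
    pass under the integral; it serves with [L = id] and with [L = S r]. *)
Lemma regulated_integral f : regulated D f -> exists v, is_bochner_integral mu D f v /\
  forall (L : V -> V) (c : R), linear L -> (forall x, `|L x| <= c * `|x|) ->
    forall y, ip (L v) y = \int[mu]_(t in D) ip (L (f t)) y.
Proof.
move=> rf; pose u n := sval (approx rf n).
have uP n t : D t -> `|f t - sf_eval (u n) t| <= n.+1%:R^-1.
  by rewrite /u; case: (approx rf n) => /= s; exact.
pose m := fine (mu D).
have m0 : 0 <= m by rewrite fine_ge0.
have h0 := @cvg_harmonic R.
have cu : cvgn (fun n => sf_integral mu D (u n)).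
  apply: cauchy_seq_cvg => e e0.
  have e0' : 0 < e / (2 * (m + 1)) by rewrite divr_gt0// mulr_gt0// ltr_wpDl.
  have [N _ NP] := cvgr0_norm_le _ h0 _ e0'.
  exists N => n k Nn Nk.
  have -> : e = (e / (2 * (m + 1)) + e / (2 * (m + 1))) * (m + 1).
    by field; rewrite gt_eqF// ltr_wpDl.
  apply: (@le_trans _ _ ((e / (2 * (m + 1)) + e / (2 * (m + 1))) * m)); last first.
    by rewrite ler_wpM2l ?lerDl// addr_ge0// ltW.
  apply: sf_integral_dist => t Dt.
  rewrite -[sf_eval (u n) t](subrK (f t)) -addrA (le_trans (ler_normD _ _))//.
  apply: lerD; last by apply: le_trans (uP _ _ Dt) _; apply: le_trans (ler_norm _) (NP _ Nk).
  by rewrite distrC; apply: le_trans (uP _ _ Dt) _; apply: le_trans (ler_norm _) (NP _ Nn).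
exists (limn (fun n => sf_integral mu D (u n))); split.
  exists u; split => //.
  - move=> n k; apply: le_lt_trans Doo; apply: le_measure; rewrite ?inE//.
      by apply: measurableI => //; exact: sf_measurable.
  - apply: aeW => t Dt.
    apply: (@cvg_le_dist _ _ _ _ _ _ _ (fun n => n.+1%:R^-1)) h0.
    by move=> n; exact: uP.
  - apply: (@squeeze_cvge _ _ _ _ (fun=> 0%E) _ (fun n => (n.+1%:R^-1 * m)%:E)).
    + apply: nearW => n; rewrite integral_ge0//=.
      have -> : ((n.+1%:R^-1 * m)%:E = \int[mu]_(t in D) (n.+1%:R^-1)%:E)%E.
        by rewrite integral_cst// EFinM /m fineK// ge0_fin_numE.
      by apply: ge0_le_integral_sup => // t Dt; rewrite lee_fin uP.
    + exact: cvg_cst.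
    + apply: cvg_EFin; first exact: nearW.
      by rewrite -[X in _ --> X](mul0r m); apply: cvgM => //; exact: cvg_cst.
move=> L c linL Lc y; set v := limn _.
pose L' : {linear V -> V} := HB.pack L (GRing.isLinear.Build _ _ _ _ _ linL).
have l1 : (fun n => ip (sf_integral mu D (sf_comp L (u n))) y) @ \oo --> ip (L v) y.
  under eq_fun do rewrite sf_integral_comp//.
  apply: (cvg_ip ipP); last exact: cvg_cst.
  apply: (@cvg_le_dist _ _ _ _ _ _ _ (fun n => c * `|v - sf_integral mu D (u n)|)).
    by move=> n; rewrite -[L]/(L' : V -> V) -raddfB; exact: Lc.
  rewrite -[X in _ --> X](mulr0 c); apply: cvgM; first exact: cvg_cst.
  rewrite -[X in _ --> X](@normr0 _ V) -(subrr v); apply: cvg_norm.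
  by apply: cvgB; [exact: cvg_cst | exact: cu].
have l2 : (fun n => ip (sf_integral mu D (sf_comp L (u n))) y) @ \oo -->
    \int[mu]_(t in D) ip (L (f t)) y.
  apply: (@cvg_le_dist _ _ _ _ _ _ _ (fun n => n.+1%:R^-1 * (`|c| * `|y| * m))).
    move=> n; rewrite ip_sf_integral.
    have -> : n.+1%:R^-1 * (`|c| * `|y| * m) = `|c| * n.+1%:R^-1 * `|y| * m by ring.
    apply: Rintegral_ip_le.
    - exact: regulated_comp linL Lc rf.
    - exact: sf_regulated.
    - move=> t Dt; rewrite sf_compE// -[L]/(L' : V -> V) -raddfB.
      apply: le_trans (Lc _) _.
      apply: (@le_trans _ _ (`|c| * `|f t - sf_eval (u n) t|)).
        by rewrite ler_wpM2r// ler_norm.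
      by rewrite ler_wpM2l// uP.
  by rewrite -[X in _ --> X](mul0r (`|c| * `|y| * m)); apply: cvgM => //; exact: cvg_cst.
exact: (cvg_unique _ l1 l2).
Qed.

End regulated.

(** * Antiderivatives of continuous functions on the line *)

Section antiderivative.
Context (R : realType).
Implicit Types (f G : R -> R).
Local Notation mu := (@lebesgue_measure R).

Lemma MVT_everywhere f G : (forall x : R, is_derive x 1 G (f x)) ->
  forall a b, a <= b -> exists2 c, c \in `[a, b] & G b - G a = f c * (b - a).
Proof.
move=> dG a b ab; apply: MVT_segment => //.
by apply: derivable_within_continuous => x _; exact: ex_derive.
Qed.

Lemma is_derive_continuous f G : (forall x : R, is_derive x 1 G (f x)) -> continuous G.
Proof.
move=> dG x; apply: differentiable_continuous; apply/derivable1_diffP; exact: ex_derive.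
Qed.

Lemma is_derive_comp_shift f G (c x : R) : (forall x : R, is_derive x 1 G (f x)) ->
  is_derive x 1 (fun t => G (c + t)) (f (c + x)).
Proof.
move=> dG.
have h : is_derive x 1 (fun t : R => c + t) 1.
  by rewrite -[X in is_derive _ _ _ X]add0r; apply: is_deriveD.
have := @is_derive1_comp _ G (fun t => c + t) x (f (c + x)) 1 (dG _) h.
by rewrite mulr1.
Qed.

(** The integral from [a] is differentiable only to the right of [a], so no fixed base point serves
    the whole line. The base point moves with [x], and subtracting the value at 0 removes the
    dependence on it. *)
Lemma antiderivative_exists f : continuous f ->
  exists G, forall x : R, is_derive x 1 G (f x).
Proof.
move=> cf.
pose F a x := \int[mu]_(t in `[a, x]) f t.
have Fd (a x : R) : a < x -> is_derive x (1 : R) (F a) (f x).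
  move=> ax.
  have x1 : x < x + 1 by rewrite ltrDl.
  have int : mu.-integrable `[a, x + 1] (EFin \o f).
    apply: continuous_compact_integrable; first exact: segment_compact.
    exact: continuous_subspaceT.
  have [h1 h2] := continuous_FTC1_closed x1 int ax (cf x).
  by apply: DeriveDef => //; rewrite -derive1E.
have ind (a b x : R) : a < 0 -> b < 0 -> a < x -> b < x -> F a x - F a 0 = F b x - F b 0.
  move=> a0 b0 ax bx.
  have der (y : R) : Num.max a b < y -> is_derive y (1 : R) (F a - F b) 0.
    rewrite gt_max => /andP[ay by_].
    by rewrite -(subrr (f y)); apply: is_deriveB; exact: Fd.
  have cst u v : Num.max a b < u -> u <= v -> (F a - F b) v - (F a - F b) u = 0.
    move=> mu_ uv.
    have [|||c _ ->] := @MVT_segment R (F a - F b) (fun=> 0) u v.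
    - by [].
    - by move=> y; rewrite in_itv/= => /andP[uy _]; apply: der; exact: lt_trans uy.
    - apply: derivable_within_continuous => y; rewrite in_itv/= => /andP[uy _].
      by apply: @ex_derive; apply: der; exact: lt_le_trans uy.
    - by rewrite mul0r.
  have := cst; have [x0|x0] := leP 0 x.
    by move=> /(_ 0 x); rewrite gt_max a0 b0 => /(_ isT x0); rewrite !fctE/=; lra.
  by move=> /(_ x 0); rewrite gt_max ax bx => /(_ isT (ltW x0)); rewrite !fctE/=; lra.
exists (fun x => F (- (`|x| + 1)) x - F (- (`|x| + 1)) 0) => x.
(* A single base point that is valid for all y with |x - y| < 1. *)
pose a := - (`|x| + 2).
have absx := ler_norm (- x); rewrite normrN in absx.
have n0 := normr_ge0 x.
have da : is_derive x (1 : R) (fun y => F a y - F a 0) (f x).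
  rewrite -[f x]subr0; apply: is_deriveB; apply: Fd; rewrite /a; lra.
apply: near_eq_is_derive da.
near=> y.
have yx : `|x - y| < 1 by near: y; exact: cvgr_dist_lt.
apply: ind; rewrite ?/a.
- by rewrite oppr_lt0; lra.
- by rewrite oppr_lt0 ltr_wpDl.
- by move: yx; rewrite ltr_norml => /andP[]; lra.
- have := ler_norm (- y); rewrite normrN; lra.
Unshelve. all: by end_near. Qed.

Lemma Rintegral_itv_antiderivative f G (a b c : R) : continuous f ->
  (forall x : R, is_derive x 1 G (f x)) -> a <= b ->
  \int[mu]_(t in `]a, b[) f (c + t) = G (c + b) - G (c + a).
Proof.
move=> cf dG; rewrite le_eqVlt => /predU1P[->|ab].
  by rewrite set_itvoo0 Rintegral_set0 subrr.
have cfc : continuous (fun t => f (c + t)).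
  by move=> x; apply: continuous_comp; [apply: cvgD; [exact: cvg_cst | exact: cvg_id] | exact: cf].
have dGc (x : R) : is_derive x 1 (fun t => G (c + t)) (f (c + x)) by exact: is_derive_comp_shift.
have int : mu.-integrable `[a, b] (EFin \o (fun t => f (c + t))).
  apply: continuous_compact_integrable; first exact: segment_compact.
  exact: continuous_subspaceT.
rewrite Rintegral_itv_bndo_bndc; last first.
  by apply: integrableS int => //; exact: subset_itv_oo_cc.
rewrite Rintegral_itv_obnd_cbnd; last first.
  by apply: integrableS int => //; exact: subset_itv_oc_cc.
rewrite /Rintegral (@continuous_FTC2 _ _ (fun t => G (c + t)))//.
- exact: continuous_subspaceT.
- split.
  + by move=> x _; exact: ex_derive.
  + by apply: cvg_at_right_filter; exact: (is_derive_continuous dGc).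
  + by apply: cvg_at_left_filter; exact: (is_derive_continuous dGc).
- by move=> x _; rewrite derive1E; exact: derive_val.
Qed.

End antiderivative.

(** * C0-semigroups: local boundedness and continuity of orbits *)

Section semigroup.
Context (R : realType) (V : completeNormedModType R) (S : R -> V -> V).
Hypothesis S_C0 : C0_semigroup S.

Lemma C0_strong0 x (e : R) : 0 < e ->
  exists2 d : R, 0 < d & forall t, 0 <= t < d -> `|S t x - x| <= e.
Proof.
move=> e0; have /cvgrPdist_le /(_ _ e0) := @C0_strong _ _ _ S_C0 x.
rewrite near_withinE => -[d /= d0 dP].
exists d => // t /andP[]; rewrite le_eqVlt => /predU1P[<- _|t0 td].
  by rewrite (C0_zero S_C0) subrr normr0 ltW.
by rewrite distrC; apply: dP => //=; rewrite sub0r normrN gtr0_norm.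
Qed.

Lemma C0_0 t : 0 <= t -> S t 0 = 0.
Proof.
move=> t0.
by have := C0_linear S_C0 t0 (-1) 0 0; rewrite scaler0 addr0 scaleN1r addNr.
Qed.

Lemma C0_D t x y : 0 <= t -> S t (x + y) = S t x + S t y.
Proof. by move=> t0; have := C0_linear S_C0 t0 1 x y; rewrite !scale1r. Qed.

Lemma C0_Z t a x : 0 <= t -> S t (a *: x) = a *: S t x.
Proof. by move=> t0; have := C0_linear S_C0 t0 a x 0; rewrite !addr0 C0_0// addr0. Qed.

Lemma C0_B t x y : 0 <= t -> S t (x - y) = S t x - S t y.
Proof. by move=> t0; rewrite C0_D// -scaleN1r C0_Z// scaleN1r. Qed.

(** Otherwise some t_n -> 0 has S(t_n) of operator norm above n + 1, while strong continuity keeps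
    every sequence S(t_n) x bounded, against Banach-Steinhaus. *)
Lemma C0_bounded_near : exists2 d : R, 0 < d &
  exists2 M : R, 1 <= M & forall t x, 0 <= t <= d -> `|S t x| <= M * `|x|.
Proof.
apply: contrapT => nb.
have tn n : {t : R | 0 <= t <= n.+1%:R^-1 /\ exists x, n.+1%:R * `|x| < `|S t x|}.
  apply: cid; apply: contrapT => h; apply: nb.
  exists n.+1%:R^-1; first by rewrite invr_gt0.
  exists n.+1%:R; first by rewrite ler1n.
  move=> t x tn; rewrite leNgt; apply/negP => xh; apply: h.
  by exists t; split => //; exists x.
pose t_ n := sval (tn n).
have t0 n : 0 <= t_ n by rewrite /t_; case: (tn n) => /= ? [/andP[]].
have tle n : t_ n <= n.+1%:R^-1 by rewrite /t_; case: (tn n) => /= ? [/andP[]].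
have tbig n : exists x, n.+1%:R * `|x| < `|S (t_ n) x| by rewrite /t_; case: (tn n) => /= ? [].
have small (e : R) : 0 < e -> exists N, forall n, (N <= n)%N -> n.+1%:R^-1 < e.
  move=> e0; have := near_infty_natSinv_lt (PosNum e0).
  by case=> N _ NP; exists N => n Nn; exact: (NP n).
have ub : uniform_bounded (range (fun n => S (t_ n))).
  apply: Banach_Steinhauss.
  - move=> _ [n _ <-]; split; last exact: C0_linear.
    pose L' : {linear V -> V} := HB.pack (S (t_ n)) (GRing.isLinear.Build _ _ _ _ _ (C0_linear S_C0 (t0 n))).
    have : continuous L' by exact: C0_continuous.
    move=> /linear_bounded_continuous /linear_boundedP/pinfty_ex_gt0[c c0 cP] r.
    exists (c * r) => x xr; apply: le_trans (cP x) _.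
    by rewrite ler_wpM2l// ltW.
  - move=> x; have [d d0 dP] := C0_strong0 x ltr01.
    have [N NP] := small _ d0.
    (* From [N] on the terms are within 1 of [x]; the sum covers the earlier ones. *)
    exists (`|x| + 1 + \sum_(n < N) `|S (t_ n) x|) => _ [n _ <-].
    have [nN|Nn] := ltnP n N.
      rewrite (bigD1 (Ordinal nN))//= addrCA lerDl addr_ge0//.
      by rewrite sumr_ge0.
    rewrite -[S (t_ n) x](subrK x) (le_trans (ler_normD _ _))// addrC.
    apply: le_trans (_ : `|x| + 1 <= _); last by rewrite lerDl sumr_ge0.
    rewrite lerD2l; apply: dP; rewrite t0/=.
    exact: le_lt_trans (tle n) (NP _ Nn).
have [M MP] := ub 1.
pose n := Num.truncn `|M|.
have [x xn] := tbig n.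
have x0 : 0 < `|x|.
  rewrite lt0r normr_ge0 andbT normr_eq0; apply/eqP => x0.
  by move: xn; rewrite x0 C0_0// normr0 mulr0 ltxx.
have := MP (S (t_ n)) (ex_intro2 _ _ n I erefl) (`|x|^-1 *: x).
rewrite normrZ ger0_norm ?invr_ge0// mulVf ?gt_eqF// => /(_ (lexx _)).
rewrite C0_Z// normrZ ger0_norm ?invr_ge0// ler_pdivrMl// mulrC => h.
have := lt_le_trans xn h; rewrite ltr_pM2r// ltNge => /negP; apply.
apply: le_trans (ler_norm _) _; apply/ltW/truncnS_gt.
Qed.

(* Each [S t] is a product of operators [S r] with [r] in the interval near 0 where the norms are bounded. *)
Lemma C0_bounded_on (T : R) : exists2 M : R, 1 <= M &
  forall t x, 0 <= t <= T -> `|S t x| <= M * `|x|.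
Proof.
have [d d0 [M M1 MP]] := C0_bounded_near.
have key n : forall t x, 0 <= t <= n%:R * d -> `|S t x| <= M ^+ n * `|x|.
  elim: n => [|n IH] t x.
    by rewrite mul0r -eq_le => /eqP <-; rewrite (C0_zero S_C0) expr0 mul1r.
  move=> /andP[t0 tn]; have [td|dt] := leP t d.
    apply: le_trans (MP _ _ _) _; first by rewrite t0.
    by rewrite ler_wpM2r// exprS ler_peMr ?(le_trans ler01)// exprn_ege1.
  have td0 : 0 <= t - d by rewrite subr_ge0 ltW.
  rewrite -{1}(subrK d t) (C0_add S_C0 _ td0 (ltW d0)).
  apply: le_trans (IH _ _ _) _.
    by rewrite td0/= lerBlDr (le_trans tn)// -addn1 natrD mulrDl mul1r.
  rewrite exprSr -mulrA ler_wpM2l ?exprn_ge0 ?(le_trans ler01)//.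
  by apply: MP; rewrite (ltW d0) lexx.
exists (M ^+ (Num.truncn (T / d)).+1); first by rewrite exprn_ege1.
move=> t x /andP[t0 tT]; apply: key; rewrite t0/=.
by rewrite -ler_pdivrMr// ltW// (le_lt_trans _ (truncnS_gt _))// ler_pM2r ?invr_gt0.
Qed.

(** For s <= t, S(t) x - S(s) x = S(s) (S(t - s) x - x): right continuity at 0 and the bound on
    [0, T] suffice on both sides. *)
Lemma orbit_uniform_continuous (T : R) x (e : R) : 0 < e -> exists2 d : R, 0 < d &
  forall s t, 0 <= s <= T -> 0 <= t <= T -> `|s - t| < d -> `|S s x - S t x| <= e.
Proof.
move=> e0; have [M M1 MP] := C0_bounded_on T.
have M0 : 0 < M := lt_le_trans ltr01 M1.
have [|d d0 dP] := @C0_strong0 x (e / M); first by rewrite divr_gt0.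
exists d => //.
have key s t : 0 <= s <= T -> s <= t -> `|s - t| < d -> `|S t x - S s x| <= e.
  move=> /andP[s0 sT] st std.
  have ts0 : 0 <= t - s by rewrite subr_ge0.
  have -> : S t x = S s (S (t - s) x) by rewrite -(C0_add S_C0)// addrC subrK.
  rewrite -C0_B// (le_trans (MP _ _ _)) ?s0//.
  rewrite mulrC -ler_pdivlMr// dP// ts0/=.
  by rewrite -(ger0_norm ts0) distrC.
move=> s t sT tT; have [st|ts] := leP s t => std.
  by rewrite distrC; exact: key.
by apply: key => //; [exact: ltW | rewrite distrC].
Qed.

(** [S] is unspecified at negative times; clamping gives a function continuous on the whole line, as
    [antiderivative_exists] requires. *)
Lemma orbit_continuous x : continuous (fun t : R => S (Num.max 0 t) x).
Proof.
move=> t; apply/cvgrPdist_le => e e0.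
have [d d0 dP] := @orbit_uniform_continuous (`|t| + 1) x e e0.
near=> s.
have st : `|t - s| < Num.min d 1.
  by near: s; apply: cvgr_dist_lt => //; rewrite lt_min d0/=.
move: st; rewrite lt_min => /andP[sd s1].
have t1 := ler_norm t.
have s2 : s <= `|t| + 1.
  by have := ler_norm (- (t - s)); rewrite normrN; lra.
apply: dP.
- by rewrite le_max lexx ge_max/= addr_ge0//= (le_trans t1)// lerDl.
- by rewrite le_max lexx ge_max/= addr_ge0.
- apply: le_lt_trans sd.
  by case: (leP 0 t) => ?; case: (leP 0 s) => ?; rewrite ?subr0 ?sub0r ?subrr ?normr0// ler_norml; 
    have := ler_norm (t - s); have := ler_norm (- (t - s)); rewrite normrN; lra.
Unshelve. all: by end_near. Qed.

End semigroup.

Section uniformly_continuous_regulated.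
Context (R : realType) (V : normedModType R).

Lemma uniformly_continuous_regulated (f : R -> V) (a b : R) :
  (forall e : R, 0 < e -> exists2 d : R, 0 < d & forall s t,
     a < s < b -> a < t < b -> `|s - t| < d -> `|f s - f t| <= e) ->
  regulated (T := measurableTypeR R) `]a, b[ f.
Proof.
move=> uc e e0; have [d d0 dP] := uc e e0.
have [ba|ab] := leP b a.
  exists (@SimpleFun _ _ _ _ 0 (fun=> set0) (fun=> 0) (fun=> measurable0)) => t /=.
  by rewrite in_itv/= => /andP[at_ tb]; have := lt_trans at_ tb; rewrite ltNge ba.
pose N := (Num.truncn ((b - a) / d)).+1.
have N0 : 0 < (N%:R : R) by rewrite ltr0n.
pose w := (b - a) / N%:R.
have w0 : 0 < w by rewrite divr_gt0// subr_gt0.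
have wd : w < d.
  by rewrite ltr_pdivrMr// mulrC -ltr_pdivrMr// truncnS_gt.
pose I (k : 'I_N) : set (measurableTypeR R) := `[a + k%:R * w, a + k.+1%:R * w[%classic.
(* Midpoints of the cells lie inside the open interval, where the modulus of continuity is
   available. *)
pose v (k : 'I_N) : V := f (a + (k%:R + 2^-1) * w).
have mI k : measurable (I k) by exact: measurable_itv.
exists (@SimpleFun _ _ _ _ N I v mI) => t /=; rewrite in_itv/= => /andP[at_ tb].
have IE (k : 'I_N) : (I k t) <-> (Num.truncn ((t - a) / w) = k).
  rewrite /I/= in_itv/=.
  have tw : 0 <= (t - a) / w by rewrite divr_ge0 ?subr_ge0 ?ltW.
  split.
    move=> /andP[h1 h2]; apply/eqP; rewrite truncn_eq//.
    by rewrite ler_pdivlMr// ltr_pdivrMr// lerBrDl ltrBlDl h1.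
  move=> /eqP; rewrite truncn_eq//.
  by rewrite ler_pdivlMr// ltr_pdivrMr// lerBrDl ltrBlDl.
have kN : (Num.truncn ((t - a) / w) < N)%N.
  rewrite ltnNge; apply/negP => h.
  have : N%:R * w <= t - a.
    rewrite -ler_pdivlMr//; apply: le_trans (_ : (Num.truncn ((t - a) / w))%:R <= _).
      by rewrite ler_nat.
    by rewrite truncn_le divr_ge0 ?subr_ge0 ?ltW.
  by rewrite /w mulrC divfK ?gt_eqF//; lra.
pose k : 'I_N := Ordinal kN.
have Ik : I k t by apply/IE.
rewrite /sf_eval/= (bigD1 k)//= big1 ?addr0; last first.
  move=> j jk; rewrite indicE memNset ?scale0r//.
  move=> /IE tj; move/eqP: jk; apply; apply: val_inj => /=.
  by rewrite -tj.
rewrite indicE mem_set// scale1r; move: Ik; rewrite /I/= in_itv/= => /andP[h1 h2].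
have kw : (k.+1%:R : R) * w <= b - a.
  have -> : b - a = N%:R * w by rewrite /w mulrC divfK// gt_eqF.
  by rewrite ler_pM2r// ler_nat.
move: h2 kw; rewrite -addn1 natrD => h2 kw.
have k0 : 0 <= (k%:R : R) * w by rewrite mulr_ge0// ltW.
apply: dP.
- by rewrite at_ tb.
- rewrite mulrDl; apply/andP; split; lra.
- rewrite /= mulrDl ltr_norml; apply/andP; split; lra.
Qed.

End uniformly_continuous_regulated.

(** Restricting to e <= 1 lets errors of higher order be absorbed into one constant times e. *)
Lemma ler_addgt0_mul (R : realFieldType) (a b C : R) :
  (forall e : R, 0 < e <= 1 -> a <= b + C * e) -> a <= b.
Proof.
move=> h; apply/ler_addgt0Pr => e e0.
have C0 : 0 < `|C| + 1 by rewrite ltr_wpDl.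
pose e' := Num.min 1 (e / (`|C| + 1)).
have e'0 : 0 < e' by rewrite lt_min ltr01 divr_gt0.
have e'1 : e' <= 1 by rewrite ge_min lexx.
apply: le_trans (h e' _) _; first by rewrite e'0.
rewrite lerD2l; apply: le_trans (_ : (`|C| + 1) * e' <= _).
  by rewrite ler_wpM2r ?(ltW e'0)// (le_trans (ler_norm C))// lerDl.
by rewrite mulrC -ler_pdivlMr// ge_min lexx orbT.
Qed.

(** * The generator: invariance and density of its domain *)

Section generator.
Context (R : realType) (V : completeNormedModType R) (S : R -> V -> V).
Hypothesis S_C0 : C0_semigroup S.

Lemma generatorP x y : generator S x y <-> forall e : R, 0 < e ->
  exists2 d : R, 0 < d & forall h : R, 0 < h < d -> `|S h x - x - h *: y| <= e * h.
Proof.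
have hE (h : R) : 0 < h -> `|S h x - x - h *: y| = h * `|y - h^-1 *: (S h x - x)|.
  move=> h0; rewrite -[X in _ = X * _](gtr0_norm h0) -normrZ scalerBr scalerA divff ?gt_eqF//.
  by rewrite scale1r distrC.
split.
  move=> /cvgrPdist_le gen e /gen; rewrite near_withinE => -[d /= d0 dP].
  exists d => // h /andP[h0 hd]; rewrite hE// mulrC ler_pM2r//.
  have h1 : `|0 - h : R| < d by rewrite sub0r normrN gtr0_norm.
  exact: dP h1 h0.
move=> h; apply/cvgrPdist_le => e /h[d d0 dP].
rewrite near_withinE; exists d => //= r rd r0; have {}rd : `|0 - r : R| < d := rd.
rewrite sub0r normrN in rd.
rewrite gtr0_norm// in rd.
by rewrite -(ler_pM2l r0) -hE// mulrC dP// r0.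
Qed.

Lemma generator_unique x y z : generator S x y -> generator S x z -> y = z.
Proof. by move=> xy xz; apply: cvg_unique xy xz. Qed.

Lemma generator_cst_mul a x y : generator S x y -> generator S (a *: x) (a *: y).
Proof.
move=> /generatorP xy; apply/generatorP => e e0.
have a0 : 0 < `|a| + 1 by rewrite ltr_wpDl.
have [|d d0 dP] := xy (e / (`|a| + 1)); first by rewrite divr_gt0.
exists d => // h /[dup] hd /dP {}dP; have /andP[h0 _] := hd.
rewrite (C0_Z S_C0) ?(ltW h0)// scalerA mulrC -scalerA -!scalerBr normrZ.
apply: le_trans (_ : (`|a| + 1) * (e / (`|a| + 1) * h) <= _).
  by apply: ler_pM => //; rewrite lerDl.
by rewrite le_eqVlt; apply/orP; left; apply/eqP; field; rewrite gt_eqF.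
Qed.

Lemma generator_semigroup t x y : 0 <= t -> generator S x y -> generator S (S t x) (S t y).
Proof.
move=> t0 /generatorP xy; apply/generatorP => e e0.
have [M M1 MP] := C0_bounded_on S_C0 t.
have M0 : 0 < M := lt_le_trans ltr01 M1.
have [|d d0 dP] := xy (e / M); first by rewrite divr_gt0.
exists d => // h /[dup] hd /dP {}dP; have /andP[h0 _] := hd.
have -> : S h (S t x) = S t (S h x).
  by rewrite -!(C0_add S_C0)// ?(ltW h0)// addrC.
rewrite -(C0_Z S_C0)// -!(C0_B S_C0)// (le_trans (MP _ _ _)) ?t0//=.
by rewrite mulrC -ler_pdivlMr// mulrAC.
Qed.

Context (ip : V -> V -> R).
Hypothesis ipP : inner_product ip.

Lemma norm_le_ip w (e : R) : 0 <= e -> ip w w <= e * `|w| -> `|w| <= e.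
Proof.
move=> e0; have [->|w0] := eqVneq w 0; first by rewrite normr0.
by rewrite (ipxx ipP) expr2 ler_pM2r// normr_gt0.
Qed.

(* The averages [h^-1 int_0^h S(s) x ds] lie in the domain of the generator and tend to [x]. *)
Lemma generator_domain_dense x (e : R) : 0 < e ->
  exists v f, generator S v f /\ `|x - v| <= e.
Proof.
move=> e0.
have [d d0 dP] := C0_strong0 S_C0 x e0.
pose h := d / 2.
have h0 : 0 < h by rewrite divr_gt0.
have hd : h < d by rewrite /h; lra.
have reg : regulated (T := measurableTypeR R) `]0, h[ (fun s => S s x).
  apply: uniformly_continuous_regulated => r r0.
  have [k k0 kP] := orbit_uniform_continuous S_C0 h x r0.
  exists k => // s t /andP[s0 sh] /andP[t0 th]; apply: kP.
    by rewrite !ltW.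
  by rewrite !ltW.
have Doo : ((@lebesgue_measure R) `]0%R, h[%classic < +oo)%E.
  by rewrite lebesgue_measure_itv/= lte_fin h0 -EFinB ltry.
have [v0 [_ v0P]] := @regulated_integral _ _ _ (@lebesgue_measure R) _
  (measurable_itv `]0, h[) Doo V ip ipP _ reg.
pose phi y (s : R) := ip (S (Num.max 0 s) x) y.
have phic y : continuous (phi y).
  by move=> s; apply: (cvg_ip ipP); [exact: (orbit_continuous S_C0) | exact: cvg_cst].
have GP y : {G : R -> R | forall s : R, is_derive s (1 : R) G (phi y s)}.
  by apply: cid; exact: antiderivative_exists.
pose G y := sval (GP y).
have dG y (s : R) : is_derive s (1 : R) (G y) (phi y s) by rewrite /G; case: (GP y).
have phiE y (s : R) : 0 <= s -> phi y s = ip (S s x) y by move=> s0; rewrite /phi max_r.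
(* With [G y] an antiderivative of s -> <S(s) x, y>, pairings with S(r) v0 are increments of
   [G y]. *)
have v0E (r : R) y : 0 <= r -> ip (S r v0) y = G y (r + h) - G y r.
  move=> r0.
  have [M _ MP] := C0_bounded_on S_C0 r.
  rewrite (v0P _ M (C0_linear S_C0 r0)); last by move=> z; apply: MP; rewrite r0 lexx.
  rewrite -[X in _ - G y X](addr0 r).
  rewrite -(@Rintegral_itv_antiderivative _ (phi y) _ 0 h r (phic y) (dG y) (ltW h0)).
  apply: eq_Rintegral => s; rewrite inE/= in_itv/= => /andP[s0 _].
  by rewrite phiE ?addr_ge0 ?(ltW s0)// (C0_add S_C0)// ltW.
have v0E0 y : ip v0 y = G y h - G y 0.
  by rewrite -{1}(C0_zero S_C0 v0) v0E// add0r.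
exists (h^-1 *: v0), (h^-1 *: (S h x - x)); split.
  apply: generator_cst_mul; apply/generatorP => r r0.
  have r20 : 0 < r / 2 by rewrite divr_gt0.
  (* All times below are at most q + h <= h + 1. *)
  have [k k0 kP] := orbit_uniform_continuous S_C0 (h + 1) x r20.
  exists (Num.min k 1); first by rewrite lt_min k0/=.
  move=> q /andP[q0]; rewrite lt_min => /andP[qk q1].
  have hq : h <= q + h by rewrite lerDr ltW.
  set w := _ - _ - q *: _.
  (* S(q) v0 - v0 is the integral over [h, q + h] minus that over [0, q]. Paired with the error [w]
     itself, each is q times a value of the orbit near h or near 0. *)
  have [c1 c1q e2] := MVT_everywhere (dG w) hq.
  have [c0 c0q e1] := MVT_everywhere (dG w) (ltW q0).
  move: c0q c1q; rewrite !in_itv/= => /andP[c00 c0q] /andP[c10 c1q].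
  have c1_0 : 0 <= c1 := le_trans (ltW h0) c10.
  rewrite phiE// in e1; rewrite phiE// in e2.
  apply: norm_le_ip; first by rewrite mulr_ge0 ?ltW.
  have -> : ip w w = q * (ip (S c1 x - S h x) w - ip (S c0 x - S 0 x) w).
    rewrite {1}/w !(ipBl ipP) (ipZl ipP) !(ipBl ipP) v0E ?(ltW q0)// v0E0 -/w (C0_zero S_C0).
    move: e1 e2; rewrite subr0 addrK => e1 e2.
    have -> : G w (q + h) = ip (S c1 x) w * q + G w h by rewrite -e2 subrK.
    have -> : G w q = ip (S c0 x) w * q + G w 0 by rewrite -e1 subrK.
    by ring.
  have b1 : ip (S c1 x - S h x) w <= r / 2 * `|w|.
    rewrite (le_trans (ip_le ipP _ _))// ler_wpM2r//; apply: kP.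
    - by rewrite c1_0/= (le_trans c1q)// addrC lerD2l ltW.
    - by rewrite (ltW h0)/= lerDl.
    - by rewrite ger0_norm ?subr_ge0// (le_lt_trans _ qk)// lerBlDr.
  have b0 : - ip (S c0 x - S 0 x) w <= r / 2 * `|w|.
    rewrite -(ipNl ipP) (le_trans (ip_le ipP _ _))// ler_wpM2r// normrN; apply: kP.
    - by rewrite c00/= (le_trans c0q)// (le_trans (ltW q1))// lerDr ltW.
    - by rewrite lexx addr_ge0// ltW.
    - by rewrite subr0 ger0_norm// (le_lt_trans _ qk).
  rewrite [r * q]mulrC -mulrA ler_pM2l//.
  by rewrite [leRHS](_ : _ = r / 2 * `|w| + r / 2 * `|w|) ?lerD//; field.
rewrite distrC; set w := _ - _; apply: norm_le_ip; first exact: ltW.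
have [c] := MVT_everywhere (dG w) (ltW h0).
rewrite in_itv/= => /andP[c0 ch]; rewrite phiE// => ec.
have -> : ip w w = ip (S c x - x) w.
  rewrite {1}/w (ipBl ipP) (ipZl ipP) v0E0 ec subr0 (ipBl ipP).
  by rewrite mulrC -mulrA divff ?gt_eqF// mulr1.
rewrite (le_trans (ip_le ipP _ _))// ler_wpM2r//.
by apply: dP; rewrite c0/= (le_lt_trans ch).
Qed.

End generator.

Lemma generatorB (R : realType) (V : completeNormedModType R) (S : R -> V -> V) u u' g g' :
  C0_semigroup S -> generator S u g -> generator S u' g' -> generator S (u - u') (g - g').
Proof.
move=> S_C0 /generatorP ug /generatorP ug'; apply/generatorP => e e0.
have e20 : 0 < e / 2 by rewrite divr_gt0.
have [d d0 dP] := ug _ e20; have [d' d'0 d'P] := ug' _ e20.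
exists (Num.min d d'); first by rewrite lt_min d0.
move=> h /andP[h0]; rewrite lt_min => /andP[hd hd'].
rewrite (C0_B S_C0) ?(ltW h0)//.
have -> : S h u - S h u' - (u - u') - h *: (g - g') =
    (S h u - u - h *: g) - (S h u' - u' - h *: g').
  by rewrite scalerBr !opprB !addrA [LHS](ACl (1*4*6*5*3*2)).
rewrite (le_trans (ler_normB _ _))// [e]splitr mulrDl lerD// ?dP ?d'P ?h0//.
Qed.

(** * Contraction, symmetry and smoothing *)

Section selfadjoint_semigroup.
Context (R : realType) (V : completeNormedModType R) (S : R -> V -> V).
Hypothesis S_C0 : C0_semigroup S.
Context (ip : V -> V -> R).
Hypothesis ipP : inner_product ip.

Lemma C0_comm (s t : R) x : 0 <= s -> 0 <= t -> S s (S t x) = S t (S s x).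
Proof. by move=> s0 t0; rewrite -!(C0_add S_C0)// addrC. Qed.

(** Polarisation: if |y| = |x| then 4 <L x, y> <= c |x + y|^2 <= 4 c |x|^2; take for [y] the vector
    [L x] rescaled to the norm of [x]. *)
Lemma psd_norm_le (L : V -> V) (c : R) : linear L ->
  (forall x y, ip (L x) y = ip x (L y)) -> (forall x, 0 <= ip (L x) x <= c * `|x| ^+ 2) ->
  forall x, `|L x| <= c * `|x|.
Proof.
move=> linL symL psd x.
pose L' : {linear V -> V} := HB.pack L (GRing.isLinear.Build _ _ _ _ _ linL).
have LD y z : L (y + z) = L y + L z by exact: (raddfD L').
have LB y z : L (y - z) = L y - L z by exact: (raddfB L').
have [Lx0|Lx0] := eqVneq (L x) 0.
  rewrite Lx0 normr0; have [->|x0] := eqVneq x 0; first by rewrite normr0 mulr0.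
  have /andP[_] := psd x; rewrite Lx0 (ip0l ipP) expr2 mulrA pmulr_lge0//.
  by rewrite normr_gt0.
have x0 : x != 0.
  by apply: contra_neq Lx0 => ->; exact: (raddf0 L').
have {}Lx0 : 0 < `|L x| by rewrite normr_gt0.
have {}x0 : 0 < `|x| by rewrite normr_gt0.
have [y yn bxy] : exists2 y, `|y| = `|x| & ip (L x) y = `|x| * `|L x|.
  exists ((`|x| / `|L x|) *: L x).
    by rewrite normrZ ger0_norm ?divr_ge0// mulrAC -mulrA divff ?gt_eqF// mulr1.
  by rewrite (ipZr ipP) (ipxx ipP) expr2 mulrA divfK// gt_eqF.
have /andP[_ h1] := psd (x + y).
have /andP[h2 _] := psd (x - y).
have c0 : 0 <= c.
  by have /andP[h3 h4] := psd x; have := le_trans h3 h4; rewrite pmulr_lge0// exprn_gt0.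
have xy : c * `|x + y| ^+ 2 <= 4 * (c * `|x| ^+ 2).
  rewrite [leRHS]mulrCA ler_wpM2l//.
  have := parallelogram ipP x y; rewrite yn => par.
  have : 0 <= `|x - y| ^+ 2 by rewrite exprn_ge0.
  by move: par; set a := `|x + y| ^+ 2; set b := `|x - y| ^+ 2; lra.
have b4 : ip (L (x + y)) (x + y) - ip (L (x - y)) (x - y) = 4 * ip (L x) y.
  rewrite LD LB !(ipDl ipP, ipDr ipP, ipNl ipP, ipNr ipP).
  by rewrite (symL y x) (ipC ipP y (L x)); ring.
rewrite -(ler_pM2l x0) -bxy mulrCA -expr2; lra.
Qed.

Hypothesis sym : forall x f y g, generator S x f -> generator S y g -> ip f y = ip x g.
Hypothesis dis : forall x f, generator S x f -> ip f x <= 0.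

Let stepN (t d : R) : 0 < t -> 0 < d -> exists N : nat, (0 < N)%N /\ 0 < t / N%:R < d.
Proof.
move=> t0 d0; exists (Num.truncn (t / d)).+1; split => //.
by rewrite divr_gt0//= ltr_pdivrMr// mulrC -ltr_pdivrMr// truncnS_gt.
Qed.

(** Cut [0, t] into N steps of length h. In |S(h) u|^2 = |u|^2 + 2 h <g, u> + O(e h), with g the
    generator at u, the middle term is nonpositive; the errors add up to O(t e). *)
Let contraction_dom (t : R) x f : generator S x f -> 0 <= t -> `|S t x| <= `|x|.
Proof.
move=> xf; rewrite le_eqVlt => /predU1P[<-|t0]; first by rewrite (C0_zero S_C0).
have [M M1 MP] := C0_bounded_on S_C0 t.
have M0 : 0 < M := lt_le_trans ltr01 M1.
(* 2 M^2 |x| comes from the cross term with the remainder, M^2 (|f| + 1)^2 from the square of the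
   increment. *)
pose C := M ^+ 2 * (2 * `|x| + (`|f| + 1) ^+ 2).
rewrite -(@ler_pXn2r _ 2) ?nnegrE//; apply: (@ler_addgt0_mul _ _ _ (t * C)) => e /andP[e0 e1].
have /generatorP /(_ _ e0)[d d0 dP] := xf.
(* h < e turns the h^2 of the squared increment into h e. *)
have [|N [N0 /andP[h0 hd]]] := @stepN t (Num.min d e) t0; first by rewrite lt_min d0.
set h := t / N%:R in h0 hd.
move: hd; rewrite lt_min => /andP[hd he].
have Nh : N%:R * h = t by rewrite /h mulrC divfK// pnatr_eq0 -lt0n.
have key i : (i <= N)%N -> `|S (i%:R * h) x| ^+ 2 <= `|x| ^+ 2 + i%:R * h * C * e.
  elim: i => [|i IH] iN; first by rewrite !mul0r addr0 (C0_zero S_C0).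
  have ih0 : 0 <= i%:R * h by rewrite mulr_ge0// ltW.
  have iht : 0 <= i%:R * h <= t.
    by rewrite ih0 -Nh ler_pM2r// ler_nat ltnW.
  set u := S (i%:R * h) x in IH.
  have -> : S (i.+1%:R * h) x = S h u.
    by rewrite -(C0_add S_C0)// ?(ltW h0)// -addn1 natrD mulrDl mul1r addrC.
  pose g := S (i%:R * h) f.
  have ug : generator S u g by exact: generator_semigroup.
  have ux : `|u| <= M * `|x| by exact: MP.
  have gf : `|g| <= M * `|f| by exact: MP.
  pose rho := S h u - u - h *: g.
  have rhoh : `|rho| <= M * (e * h).
    have -> : rho = S (i%:R * h) (S h x - x - h *: f).
      by rewrite /rho !(C0_B S_C0)// (C0_Z S_C0)// (C0_comm _ (ltW h0)).
    by rewrite (le_trans (MP _ _ iht))// ler_pM2l// dP// h0.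
  pose delta := h *: g + rho.
  have -> : S h u = u + delta by rewrite /delta /rho [h *: g + _]addrC subrK addrC subrK.
  have dn : `|delta| <= h * M * (`|f| + 1).
    rewrite (le_trans (ler_normD _ _))// mulrDr lerD//.
      by rewrite normrZ gtr0_norm// -mulrA ler_pM2l.
    rewrite mulr1 (le_trans rhoh)// mulrC ler_pM2r// ler_piMl// ltW//.
  have ipd : ip u delta <= M * `|x| * (M * (e * h)).
    rewrite (ipDr ipP) (ipZr ipP) -[leRHS]add0r lerD//.
      by rewrite pmulr_rle0// (ipC ipP) dis.
    rewrite (le_trans (ip_le ipP _ _))// ler_pM//.
  rewrite (normrDsq ipP).
  have dn2 : `|delta| ^+ 2 <= h * e * (M ^+ 2 * (`|f| + 1) ^+ 2).
    apply: le_trans (_ : (h * M * (`|f| + 1)) ^+ 2 <= _).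
      by rewrite ler_pXn2r// nnegrE ?mulr_ge0 ?addr_ge0// ltW.
    have -> : (h * M * (`|f| + 1)) ^+ 2 = h * h * (M ^+ 2 * (`|f| + 1) ^+ 2) by ring.
    by rewrite ler_wpM2r ?mulr_ge0 ?exprn_ge0 ?addr_ge0 ?(ltW M0)// ler_pM2l// ltW.
  have := IH (ltnW iN).
  rewrite -(addn1 i) natrD /C; move: ipd dn2.
  set a := `|delta| ^+ 2; set b := ip u delta; set c := `|u| ^+ 2; set k := `|x| ^+ 2.
  set F := (`|f| + 1) ^+ 2; set X := `|x|.
  move=> h1 h2 h3; apply: le_trans (_ : k + i%:R * h * (M ^+ 2 * (2 * X + F)) * e +
     2 * (M * X * (M * (e * h))) + h * e * (M ^+ 2 * F) <= _).
    by rewrite lerD// lerD// ler_pM2l.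
  by rewrite le_eqVlt; apply/orP; left; apply/eqP; ring.
have := key N (leqnn N); rewrite Nh; exact.
Qed.

Lemma semigroup_contraction (t : R) x : 0 <= t -> `|S t x| <= `|x|.
Proof.
move=> t0; have [M M1 MP] := C0_bounded_on S_C0 t.
apply: (@ler_addgt0_mul _ _ _ (M + 1)) => e /andP[e0 _].
have [v [f [vf xv]]] := generator_domain_dense S_C0 ipP x e0.
have -> : S t x = S t (x - v) + S t v by rewrite (C0_B S_C0)// subrK.
rewrite (le_trans (ler_normD _ _))//.
have h1 := contraction_dom vf t0.
have h2 : `|v| <= `|x| + e.
  by rewrite -[v](subKr x) (le_trans (ler_normB _ _))// lerD2l.
have h3 : `|S t (x - v)| <= M * e.
  rewrite (le_trans (MP _ _ _)) ?t0 ?lexx// ler_wpM2l// (le_trans ler01)//.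
lra.
Qed.

(** <S(i h) x, S((N - i) h) y> runs from <x, S(t) y> to <S(t) x, y>. Moving one step across changes
    it by at most e h (|x| + |y|), since symmetry of the generator cancels the first-order terms. *)
Let symmetric_dom (t : R) x f y g : generator S x f -> generator S y g -> 0 <= t ->
  ip (S t x) y = ip x (S t y).
Proof.
move=> xf yg; rewrite le_eqVlt => /predU1P[<-|t0]; first by rewrite !(C0_zero S_C0).
apply/eqP; rewrite -subr_eq0 -normr_le0.
apply: (@ler_addgt0_mul _ _ _ (t * (`|x| + `|y|))) => e /andP[e0 e1]; rewrite add0r.
have /generatorP /(_ _ e0)[d1 d10 d1P] := xf.
have /generatorP /(_ _ e0)[d2 d20 d2P] := yg.
have [|N [N0 /andP[h0 hd]]] := @stepN t (Num.min d1 d2) t0; first by rewrite lt_min d10.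
set h := t / N%:R in h0 hd.
move: hd; rewrite lt_min => /andP[hd1 hd2].
have Nh : N%:R * h = t by rewrite /h mulrC divfK// pnatr_eq0 -lt0n.
have key i : (i <= N)%N ->
    `|ip (S (i%:R * h) x) (S ((N - i)%:R * h) y) - ip x (S t y)| <= i%:R * h * (`|x| + `|y|) * e.
  elim: i => [|i IH] iN; first by rewrite !mul0r subn0 (C0_zero S_C0) Nh subrr normr0.
  have ih0 : 0 <= i%:R * h by rewrite mulr_ge0// ltW.
  have jh0 : 0 <= (N - i.+1)%:R * h by rewrite mulr_ge0// ltW.
  have hge0 := ltW h0.
  set u := S (i%:R * h) x in IH; set z := S ((N - i.+1)%:R * h) y.
  have zE : S ((N - i)%:R * h) y = S h z.
    rewrite -(C0_add S_C0)//; congr (S _ y).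
    by rewrite -(subnSK iN) -(addn1 (N - _)) natrD mulrDl mul1r addrC.
  have -> : S (i.+1%:R * h) x = S h u.
    by rewrite -(C0_add S_C0)// -addn1 natrD mulrDl mul1r addrC.
  have ug : generator S u (S (i%:R * h) f) by exact: generator_semigroup.
  have zg : generator S z (S ((N - i.+1)%:R * h) g) by exact: generator_semigroup.
  pose rhou := S h u - u - h *: S (i%:R * h) f.
  pose rhoz := S h z - z - h *: S ((N - i.+1)%:R * h) g.
  have rhouh : `|rhou| <= e * h.
    have -> : rhou = S (i%:R * h) (S h x - x - h *: f).
      by rewrite /rhou !(C0_B S_C0)// (C0_Z S_C0)// (C0_comm _ hge0).
    by rewrite (le_trans (semigroup_contraction _ _))// d1P// h0.
  have rhozh : `|rhoz| <= e * h.
    have -> : rhoz = S ((N - i.+1)%:R * h) (S h y - y - h *: g).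
      by rewrite /rhoz !(C0_B S_C0)// (C0_Z S_C0)// (C0_comm _ hge0).
    by rewrite (le_trans (semigroup_contraction _ _))// d2P// h0.
  have ux : `|u| <= `|x| by exact: semigroup_contraction.
  have zy : `|z| <= `|y| by exact: semigroup_contraction.
  have dE : ip (S h u) z - ip u (S h z) = ip rhou z - ip u rhoz.
    rewrite !(ipBl ipP) !(ipBr ipP) (ipZl ipP) (ipZr ipP) (sym ug zg).
    by ring.
  have {}IH := IH (ltnW iN); rewrite zE in IH.
  rewrite -[ip (S h u) z](subrK (ip u (S h z))) dE -addrA (le_trans (ler_normD _ _))//.
  have -> : i.+1%:R * h * (`|x| + `|y|) * e = (`|y| * (e * h) + `|x| * (e * h)) + i%:R * h * (`|x| + `|y|) * e.
    by rewrite -addn1 natrD; ring.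
  rewrite lerD// (le_trans (ler_normB _ _))// lerD//.
    by rewrite (le_trans (ip_abs ipP _ _))// mulrC ler_pM.
  by rewrite (le_trans (ip_abs ipP _ _))// ler_pM.
have := key N (leqnn N).
by rewrite Nh subnn mul0r (C0_zero S_C0).
Qed.

Lemma semigroup_symmetric (t : R) x y : 0 <= t -> ip (S t x) y = ip x (S t y).
Proof.
move=> t0; apply/eqP; rewrite -subr_eq0 -normr_le0.
apply: (@ler_addgt0_mul _ _ _ (2 * `|x| + 2 * `|y| + 2)) => e /andP[e0 e1]; rewrite add0r.
have [v [f [vf xv]]] := generator_domain_dense S_C0 ipP x e0.
have [w [g [wg yw]]] := generator_domain_dense S_C0 ipP y e0.
have -> : ip (S t x) y - ip x (S t y) =
   (ip (S t (x - v)) y + ip (S t v) (y - w)) - (ip (x - v) (S t y) + ip v (S t (y - w))).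
  rewrite !(C0_B S_C0)// !(ipBl ipP) !(ipBr ipP) (symmetric_dom vf wg t0); ring.
have nv : `|v| <= `|x| + 1.
  by rewrite -[v](subKr x) (le_trans (ler_normB _ _))// lerD2l (le_trans xv).
have b1 : `|ip (S t (x - v)) y| <= e * `|y|.
  by rewrite (le_trans (ip_abs ipP _ _))// ler_pM// (le_trans (semigroup_contraction _ _)).
have b2 : `|ip (S t v) (y - w)| <= (`|x| + 1) * e.
  by rewrite (le_trans (ip_abs ipP _ _))// ler_pM// (le_trans (semigroup_contraction _ _)).
have b3 : `|ip (x - v) (S t y)| <= e * `|y|.
  by rewrite (le_trans (ip_abs ipP _ _))// ler_pM// semigroup_contraction.
have b4 : `|ip v (S t (y - w))| <= (`|x| + 1) * e.
  by rewrite (le_trans (ip_abs ipP _ _))// ler_pM// (le_trans (semigroup_contraction _ _)).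
rewrite (le_trans (ler_normB _ _))//.
apply: le_trans (lerD (ler_normD _ _) (ler_normD _ _)) _.
lra.
Qed.


Lemma semigroup_ge0 (s : R) x : 0 <= s -> ip (S s x) x = `|S (s / 2) x| ^+ 2.
Proof.
move=> s0; have s20 : 0 <= s / 2 by rewrite divr_ge0.
by rewrite -(ipxx ipP) -semigroup_symmetric// -(C0_add S_C0)// -splitr (ipC ipP).
Qed.

(* [T = S h] is a positive symmetric contraction, so that [T^N (1 - T)] is
   positive and nonincreasing in [N]; these operators sum up to at most 1. *)
Lemma semigroup_difference_norm (h : R) (N : nat) x : 0 <= h ->
  `|S (N%:R * h) (x - S h x)| <= N.+1%:R^-1 * `|x|.
Proof.
move=> h0; apply: (@psd_norm_le (fun x => S (N%:R * h) (x - S h x))).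
- move=> a u v; rewrite -(C0_Z S_C0) ?mulr_ge0// -(C0_D S_C0) ?mulr_ge0//; congr (S _ _).
  by rewrite (C0_D S_C0)// (C0_Z S_C0)// opprD addrACA scalerBr.
- move=> u v; rewrite semigroup_symmetric ?mulr_ge0// (C0_B S_C0) ?mulr_ge0//.
  rewrite !(ipBl ipP) !(ipBr ipP) semigroup_symmetric//.
  by rewrite C0_comm ?mulr_ge0.
move=> y.
pose D (i : nat) := ip (S (i%:R * h) (y - S h y)) y.
have ih0 (i : nat) : 0 <= i%:R * h by rewrite mulr_ge0.
have DE i : D i = ip (S (i%:R * h) y) y - ip (S (i.+1%:R * h) y) y.
  rewrite /D (C0_B S_C0)// (ipBl ipP) -(C0_add S_C0)//.
  by rewrite -(addn1 i) natrD mulrDl mul1r.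
(* Half of the time i h is moved across the pairing, which leaves a quadratic form in S(i h / 2) y
   and reduces both inequalities below to i = 0. *)
have shift (i j : nat) : ip (S ((i + j)%:R * h) y) y = ip (S (j%:R * h) (S (i%:R * h / 2) y)) (S (i%:R * h / 2) y).
  have i20 : 0 <= i%:R * h / 2 by rewrite divr_ge0.
  rewrite -semigroup_symmetric// -!(C0_add S_C0)//; last by rewrite addr_ge0.
  by congr (ip (S _ _) _); rewrite natrD; field.
have D0 i : 0 <= D i.
  rewrite DE -{1}(addn0 i) -(addn1 i) !shift mul0r mul1r (C0_zero S_C0) subr_ge0 (ipxx ipP).
  set z := S _ y.
  by rewrite (le_trans (ip_le ipP _ _))// expr2 ler_pM// semigroup_contraction.
(* The second difference is |z - S(h) z|^2 with z = S(i h / 2) y. *)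
have Ddec i : D i.+1 <= D i.
  rewrite !DE -subr_ge0 -{1}(addn0 i) -(addn2 i) -(addn1 i) !shift mul0r mul1r (C0_zero S_C0).
  set z := S _ y.
  have -> : S (2 * h) z = S h (S h z) by rewrite -(C0_add S_C0)// mulrDl mul1r.
  rewrite (semigroup_symmetric (S h z) z h0).
  have : 0 <= ip (z - S h z) (z - S h z) by rewrite (ipxx ipP) exprn_ge0.
  rewrite (ipBl ipP) !(ipBr ipP) (ipC ipP z (S h z)).
  by congr (_ <= _); ring.
have DNi i : (i <= N)%N -> D N <= D i.
  move=> iN; rewrite -(subnKC iN); elim: (N - i)%N => [|k IH]; first by rewrite addn0.
  by rewrite addnS (le_trans (Ddec _)).
have sumD : \sum_(i < N.+1) D i = ip y y - ip (S (N.+1%:R * h) y) y.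
  elim: (N.+1) => [|k IH]; first by rewrite big_ord0 mul0r (C0_zero S_C0) subrr.
  by rewrite big_ord_recr/= IH DE addrA subrK.
apply/andP; split; first exact: D0.
rewrite ler_pdivlMl ?ltr0n// -(ipxx ipP) -/(D N).
apply: le_trans (_ : ip y y - ip (S (N.+1%:R * h) y) y <= _); last first.
  by rewrite gerBl semigroup_ge0// exprn_ge0.
rewrite -sumD mulr_natl -[X in _ *+ X]card_ord -sumr_const.
by apply: ler_sum => i _; apply: DNi; rewrite -ltnS.
Qed.

(** With N the integer part of t / h, the factor 1/(N + 1) of [semigroup_difference_norm] is at most
    h / t. This is |A S(t)| <= 1/t in difference form, available on all of [V]. *)
Lemma semigroup_increment_norm (t h : R) x : 0 < t -> 0 < h ->
  `|S t (S h x - x)| <= h / t * `|x|.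
Proof.
move=> t0 h0; pose N := Num.truncn (t / h).
have th0 : 0 <= t / h by rewrite divr_ge0 ?ltW.
have /andP[Nt tN] := truncn_itv th0.
rewrite -/N ler_pdivlMr// in Nt; rewrite -/N ltr_pdivrMr// in tN.
have Nh0 : 0 <= N%:R * h by rewrite mulr_ge0// ltW.
have tNh : 0 <= t - N%:R * h by rewrite subr_ge0.
rewrite -{1}(subrK (N%:R * h) t) (C0_add S_C0)//.
rewrite (le_trans (semigroup_contraction _ _))//.
rewrite -[S h x - x]opprB -scaleN1r (C0_Z S_C0)// normrZ normrN1 mul1r.
rewrite (le_trans (semigroup_difference_norm _ _ (ltW h0)))// ler_wpM2r//.
by rewrite invf_ple ?posrE ?divr_gt0// invf_div ler_pdivrMr// ltW.
Qed.

Lemma semigroup_generator_norm (t : R) x f : 0 < t -> generator S x f ->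
  `|S t f| <= t^-1 * `|x|.
Proof.
move=> t0 /generatorP xf; apply: (@ler_addgt0_mul _ _ _ 1) => e /andP[e0 _].
have [d d0 dP] := xf _ e0.
pose h := d / 2; have h0 : 0 < h by rewrite divr_gt0.
have hd : 0 < h < d by rewrite h0 /h; lra.
have t0' := ltW t0.
rewrite -(ler_pM2l h0) -{1}(gtr0_norm h0) -normrZ -(C0_Z S_C0)//.
have -> : h *: f = (S h x - x) - (S h x - x - h *: f) by rewrite subKr.
rewrite (C0_B S_C0)// (le_trans (ler_normB _ _))// mulrDr lerD//.
  by rewrite mulrA semigroup_increment_norm.
by rewrite (le_trans (semigroup_contraction _ _))// mul1r mulrC dP.
Qed.

(** Take v_n -> x in the domain, with images f_n. Then S(t) f_n is Cauchy by
    [semigroup_generator_norm]. Its limit is the derivative because the increments of S(t) (x - v_n)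
    are at most (h / t) |x - v_n|, small relative to h for all h at once. *)
Lemma semigroup_in_domain (t : R) x : 0 < t -> exists2 y, generator S (S t x) y &
  `|y| <= t^-1 * `|x|.
Proof.
move=> t0; have t0' := ltW t0.
have vf n : {vf : V * V | generator S vf.1 vf.2 /\ `|x - vf.1| <= n.+1%:R^-1}.
  apply: cid; have n0 : 0 < (n.+1%:R^-1 : R) by rewrite invr_gt0.
  by have [v [f [? ?]]] := generator_domain_dense S_C0 ipP x n0; exists (v, f).
pose v n := (sval (vf n)).1; pose f n := (sval (vf n)).2.
have gvf n : generator S (v n) (f n) by rewrite /v /f; case: (vf n) => ? [].
have xv n : `|x - v n| <= n.+1%:R^-1 by rewrite /v; case: (vf n) => ? [].
have h0 := @cvg_harmonic R.
have small (e : R) : 0 < e -> exists N, forall n, (N <= n)%N -> n.+1%:R^-1 < e.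
  move=> e0; have := near_infty_natSinv_lt (PosNum e0).
  by case=> N _ NP; exists N => n Nn; exact: (NP n).
have vv n m : `|v n - v m| <= n.+1%:R^-1 + m.+1%:R^-1.
  have -> : v n - v m = (x - v m) - (x - v n) by rewrite opprB [RHS]addrC addrA subrK.
  by rewrite (le_trans (ler_normB _ _))// addrC lerD.
have cw : cvgn (fun n => S t (f n)).
  apply: cauchy_seq_cvg => e e0.
  have [|N NP] := small (t * e / 2); first by rewrite divr_gt0// mulr_gt0.
  exists N => n m Nn Nm; rewrite -(C0_B S_C0)//.
  rewrite (le_trans (semigroup_generator_norm t0 (generatorB S_C0 (gvf n) (gvf m))))//.
  rewrite ler_pdivrMl// (le_trans (vv n m))// [leRHS]splitr lerD// ltW// ?NP//.
set w := limn (fun n => S t (f n)) in cw *.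
have key (e : R) : 0 < e -> exists2 d : R, 0 < d & forall h, 0 < h < d ->
    `|S t (S h x - x) - h *: w| <= e * h.
  move=> e0; have e30 : 0 < e / 3 by rewrite divr_gt0.
  have /cvgrPdist_le /(_ _ e30) [N1 _ N1P] := cw.
  have [|N2 N2P] := small (t * e / 3); first by rewrite divr_gt0// mulr_gt0.
  pose n := maxn N1 N2.
  have /generatorP /(_ _ e30)[d d0 dP] := gvf n.
  exists d => // h /[dup] hd /andP[h_gt0 _]; have hge0 := ltW h_gt0.
  have -> : S t (S h x - x) - h *: w =
     (S t (S h (x - v n) - (x - v n)) + S t (S h (v n) - v n - h *: f n)) - h *: (w - S t (f n)).
    rewrite -(C0_D S_C0)//.
    have -> : S h (x - v n) - (x - v n) + (S h (v n) - v n - h *: f n) = S h x - x - h *: f n.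
      by rewrite (C0_B S_C0)// !opprB !addrA [LHS](ACl (1*4*7*((2*5)*(3*6))))/= addNr subrr !addr0.
    by rewrite !(C0_B S_C0)// (C0_Z S_C0)// scalerBr opprB addrA subrK.
  have b1 : `|S t (S h (x - v n) - (x - v n))| <= e / 3 * h.
    rewrite (le_trans (semigroup_increment_norm _ t0 h_gt0))//.
    have -> : h / t * `|x - v n| = `|x - v n| / t * h by rewrite -!mulrA mulrC -!mulrA mulrCA.
    rewrite ler_pM2r// ler_pdivrMr// (le_trans (xv n))//.
    by rewrite mulrAC [e * t]mulrC ltW// N2P// leq_maxr.
  have b2 : `|S t (S h (v n) - v n - h *: f n)| <= e / 3 * h.
    by rewrite (le_trans (semigroup_contraction _ _))// dP.
  have b3 : `|h *: (w - S t (f n))| <= e / 3 * h.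
    by rewrite normrZ gtr0_norm// mulrC ler_pM2r// N1P//= leq_maxl.
  rewrite (le_trans (ler_normB _ _))//.
  have := ler_normD (S t (S h (x - v n) - (x - v n))) (S t (S h (v n) - v n - h *: f n)).
  lra.
exists w.
  apply/generatorP => e /key[d d0 dP]; exists d => // h /[dup] hd /dP.
  have /andP[/ltW h0' _] := hd.
  by rewrite (C0_B S_C0)// (C0_comm x h0').
apply: (@ler_addgt0_mul _ _ _ 1) => e /andP[e0 _].
have [d d0 dP] := key _ e0.
pose h := d / 2; have h_gt0 : 0 < h by rewrite divr_gt0.
have hd : 0 < h < d by rewrite h_gt0 /h; lra.
rewrite -(ler_pM2l h_gt0) -{1}(gtr0_norm h_gt0) -normrZ.
rewrite -[h *: w](subKr (S t (S h x - x))) (le_trans (ler_normB _ _))// mulrDr lerD//.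
  by rewrite mulrA semigroup_increment_norm.
by rewrite mul1r mulrC dP.
Qed.

End selfadjoint_semigroup.

(** * Backward uniqueness and powers of the generator *)

Section iterated_generator.
Context (R : realType) (V : completeNormedModType R) (S : R -> V -> V).
Hypothesis S_C0 : C0_semigroup S.
Context (ip : V -> V -> R).
Hypothesis ipP : inner_product ip.
Hypothesis sym : forall x f y g, generator S x f -> generator S y g -> ip f y = ip x g.
Hypothesis dis : forall x f, generator S x f -> ip f x <= 0.

(** Since <S(s) x, x> = |S(s/2) x|^2, vanishing descends from t to all t / 2^n, and strong
    continuity at 0 concludes. *)
Lemma semigroup_injective (t : R) x : 0 < t -> S t x = 0 -> x = 0.
Proof.
move=> t0 Sx.
have half n : S (t / 2 ^+ n) x = 0.
  elim: n => [|n IH]; first by rewrite expr0 divr1.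
  apply/eqP; rewrite -normr_eq0 -sqrf_eq0; apply/eqP.
  have -> : t / 2 ^+ n.+1 = t / 2 ^+ n / 2 by rewrite exprS; field.
  by rewrite -(semigroup_ge0 S_C0 ipP sym dis)// ?IH ?(ip0l ipP)// divr_ge0 ?exprn_ge0 ?(ltW t0).
apply/eqP; rewrite -normr_le0; apply: (@ler_addgt0_mul _ _ _ 1) => e /andP[e0 _].
rewrite add0r mul1r.
have [d d0 dP] := C0_strong0 S_C0 x e0.
have [n nP] : exists n, t / 2 ^+ n < d.
  exists (Num.truncn (t / d)).
  rewrite ltr_pdivrMr ?exprn_gt0// mulrC -ltr_pdivrMr//.
  apply: lt_le_trans (truncnS_gt _) _.
  by rewrite -natrX ler_nat ltn_expl.
have := dP (t / 2 ^+ n); rewrite half sub0r normrN; apply.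
by rewrite nP divr_ge0 ?exprn_ge0 ?(ltW t0).
Qed.

(** The time t is cut into N + 1 equal slices; each application of the generator spends one slice
    and costs a factor (N + 1)/t. Spending all of them with N + 1 = k gives the bound. *)
Lemma iterated_generator (t : R) x : 0 < t -> exists a : nat -> V, [/\ a 0%N = S t x,
  forall k, generator S (a k) (a k.+1) & forall k, `|a k| <= `|x| * (t^-1 * k%:R) ^+ k].
Proof.
move=> t0.
(* [G] is 0 off the domain, which makes the recursion total; [key] shows that the iterates stay in
   the domain. *)
pose G x := if pselect (exists y, generator S x y) is left p then sval (cid p) else 0.
have GP u y : generator S u y -> G u = y.
  move=> uy; rewrite /G; case: pselect => [p|]; last by case; exists y.
  by case: cid => z uz /=; exact: generator_unique uz uy.
pose a := fix a k := if k is k'.+1 then G (a k') else S t x.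
have key N k : (k <= N.+1)%N -> exists xi, `|xi| <= (t^-1 * N.+1%:R) ^+ k * `|x| /\
    a k = S ((N.+1 - k)%:R * (t / N.+1%:R)) xi.
  elim: k => [_|k IH kN].
    exists x; split; first by rewrite expr0 mul1r.
    by rewrite subn0 mulrC divfK// pnatr_eq0.
  have [xi [xin ak]] := IH (ltnW kN).
  have h0 : 0 < t / N.+1%:R by rewrite divr_gt0// ltr0n.
  have [y yg yn] := semigroup_in_domain S_C0 ipP sym dis xi h0.
  have j0 : 0 <= (N.+1 - k.+1)%:R * (t / N.+1%:R) by rewrite mulr_ge0// ltW.
  exists y; split.
    apply: le_trans yn _; rewrite invf_div [_ / t]mulrC exprS -(mulrA (_ * _)).
    by rewrite ler_wpM2l// mulr_ge0// invr_ge0 ltW.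
  rewrite /=; apply: GP; rewrite ak.
  have -> : (N.+1 - k)%:R * (t / N.+1%:R) = (N.+1 - k.+1)%:R * (t / N.+1%:R) + t / N.+1%:R.
    by rewrite -(subnSK kN) -(addn1 (N.+1 - _)) natrD mulrDl mul1r.
  rewrite (C0_add S_C0) ?(ltW h0)//.
  exact: generator_semigroup.
exists a; split => // k.
(* One of the k + 1 slices is left over, which puts [a k] in the domain. *)
- have [xi [_ ak]] := key k k (leqnSn k).
  rewrite /=; rewrite ak subSnn mul1r.
  have h0 : 0 < t / k.+1%:R by rewrite divr_gt0// ltr0n.
  have [y yg _] := semigroup_in_domain S_C0 ipP sym dis xi h0.
  by rewrite (GP _ _ yg).
- case: k => [|k]; first by rewrite expr0 mulr1 /= (semigroup_contraction S_C0 ipP dis)// ltW.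
  have [xi [xin ->]] := key k k.+1 (leqnn _).
  by rewrite subnn mul0r (C0_zero S_C0) mulrC.
Qed.

(** The right derivative of s -> <S(s) a_k, b> is <S(s) a_(k+1), b>. The induction keeps a whole
    interval of s so that differentiation can be repeated. *)
Lemma generator_orthogonal (b : V) (d : R) (a : nat -> V) : 0 < d ->
  (forall k, generator S (a k) (a k.+1)) ->
  (forall s, 0 <= s < d -> ip (S s (a 0%N)) b = 0) -> forall k, ip (a k) b = 0.
Proof.
move=> d0 ag a0.
suff key k : forall s, 0 <= s < d -> ip (S s (a k)) b = 0.
  by move=> k; rewrite -(C0_zero S_C0 (a k)) key// lexx.
elim: k => [//|k IH] s /[dup] sd0 /andP[s0 sd].
apply/eqP; rewrite -normr_le0; apply: (@ler_addgt0_mul _ _ _ `|b|) => e /andP[e0 _].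
rewrite add0r.
have /generatorP /(_ _ e0)[r r0 rP] := generator_semigroup S_C0 s0 (ag k).
pose h := Num.min r (d - s) / 2.
have m0 : 0 < Num.min r (d - s) by rewrite lt_min r0 subr_gt0.
have h0 : 0 < h by rewrite divr_gt0.
have hm : h < Num.min r (d - s) by rewrite /h; lra.
move: hm; rewrite lt_min => /andP[hr hs].
have {}rP : `|S h (S s (a k)) - S s (a k) - h *: S s (a k.+1)| <= e * h by rewrite rP ?h0.
rewrite -(ler_pM2l h0) -{1}(gtr0_norm h0) -normrM.
have -> : h * ip (S s (a k.+1)) b = - ip (S h (S s (a k)) - S s (a k) - h *: S s (a k.+1)) b.
  rewrite !(ipBl ipP) (ipZl ipP) IH// -(C0_add S_C0) ?(ltW h0)// IH; first ring.
  by rewrite addr_ge0 ?(ltW h0)//= -ltrBrDr.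
rewrite normrN (le_trans (ip_abs ipP _ _))//.
have -> : h * (`|b| * e) = e * h * `|b| by ring.
by rewrite ler_wpM2r.
Qed.

End iterated_generator.

(** * Duality: controllability from unique continuation *)

Section controllability.
Context (R : realType) (V : completeNormedModType R) (S : R -> V -> V).
Hypothesis S_C0 : C0_semigroup S.
Context (ip : V -> V -> R).
Hypothesis ipP : inner_product ip.
Context (B : V -> V) (linB : linear B) (T : R) (T0 : 0 < T).
Local Notation mu := (@lebesgue_measure R).
Local Notation sfun := (simple_fun (measurableTypeR R) V).

Let input (u : sfun) (t s : R) : V := S (t - s) (B (sf_eval u s)).

Let itv_lty (t : R) : 0 <= t -> (mu `]0%R, t[%classic < +oo)%E.
Proof.
move=> t0; rewrite lebesgue_measure_itv/=; case: ifPn => // _.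
by rewrite -EFinB ltry.
Qed.

(** Linearity splits the integrand into finitely many indicators times orbits s -> S(t - s) B v_k,
    which are uniformly continuous. *)
Let input_regulated u (t : R) : 0 <= t ->
  regulated (T := measurableTypeR R) `]0, t[ (input u t).
Proof.
move=> t0.
pose B' : {linear V -> V} := HB.pack B (GRing.isLinear.Build _ _ _ _ _ linB).
apply: (@eq_regulated _ _ _ _ _ (fun s => \sum_(k < sf_size u)
    (\1_(@sf_set _ _ _ _ u k) s : R) *: S (t - s) (B (sf_val k)))).
  move=> s /=; rewrite in_itv/= => /andP[s0 st].
  have ts0 : 0 <= t - s by rewrite subr_ge0 ltW.
  pose S' : {linear V -> V} := HB.pack (S (t - s))
    (GRing.isLinear.Build _ _ _ _ _ (C0_linear S_C0 ts0)).
  rewrite /input -[B]/(B' : V -> V) -[S (t - s)]/(S' : V -> V) /sf_eval !raddf_sum.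
  by apply: eq_bigr => k _; rewrite -(linearZ_LR S') -(linearZ_LR B').
apply: regulated_sum => k; apply: regulated_indic; first exact: sf_measurable.
apply: uniformly_continuous_regulated => e e0.
have [d d0 dP] := orbit_uniform_continuous S_C0 t (B (sf_val k)) e0.
exists d => // s r /andP[s0 st] /andP[r0 rt] sr; apply: dP.
- by rewrite subr_ge0 (ltW st) lerBlDr lerDl ltW.
- by rewrite subr_ge0 (ltW rt) lerBlDr lerDl ltW.
- by rewrite opprB addrC addrA subrK distrC.
Qed.

Let input_integrable w z :
  mu.-integrable `]0, T[ (EFin \o (fun t => ip (input w T t) z)).
Proof.
exact: (@integrable_ip_regulated _ _ _ mu _ (measurable_itv `]0, T[)
  (itv_lty (ltW T0)) V ip ipP _ z (input_regulated w (ltW T0))).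
Qed.

(** The states reached from 0 by simple controls. Describing them by pairings lets closure under
    sums and multiples follow from scalar integrals. *)
Let reach : set V := [set w | exists u : sfun, forall y,
  ip w y = \int[mu]_(s in `]0, T[) ip (input u T s) y].

Let reach_integral u : exists2 w, reach w &
  forall y, ip w y = \int[mu]_(s in `]0, T[) ip (input u T s) y.
Proof.
have [w [_ wP]] := @regulated_integral _ _ _ mu _ (measurable_itv `]0, T[)
  (itv_lty (ltW T0)) V ip ipP _ (input_regulated u (ltW T0)).
have wE y : ip w y = \int[mu]_(s in `]0, T[) ip (input u T s) y.
  by apply: (wP id 1) => // x; rewrite mul1r.
by exists w => //; exists u.
Qed.

Let reach0 : reach 0.
Proof.
pose B' : {linear V -> V} := HB.pack B (GRing.isLinear.Build _ _ _ _ _ linB).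
exists (@SimpleFun _ _ _ _ 0 (fun=> set0) (fun=> 0) (fun=> measurable0)) => y.
rewrite (ip0l ipP) (@eq_Rintegral _ _ _ _ _ (fun=> 0)).
  by rewrite Rintegral_cst ?mul0r//; exact: measurable_itv.
move=> s; rewrite inE/= in_itv/= => /andP[s0 sT].
rewrite /input /sf_eval big_ord0 -[B]/(B' : V -> V) raddf0 (C0_0 S_C0) ?(ip0l ipP)//.
by rewrite subr_ge0 ltW.
Qed.

Let reachD x y : reach x -> reach y -> reach (x + y).
Proof.
move=> [u xu] [v yv]; exists (sf_cat u v) => z.
pose B' : {linear V -> V} := HB.pack B (GRing.isLinear.Build _ _ _ _ _ linB).
rewrite (ipDl ipP) xu yv -RintegralD//.
apply: eq_Rintegral => s; rewrite inE/= in_itv/= => /andP[s0 sT].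
rewrite -(ipDl ipP) /input sf_catE -[B]/(B' : V -> V) raddfD (C0_D S_C0)//.
by rewrite subr_ge0 ltW.
Qed.

Let reachZ a x : reach x -> reach (a *: x).
Proof.
move=> [u xu]; exists (sf_comp ( *:%R a) u) => z.
pose B' : {linear V -> V} := HB.pack B (GRing.isLinear.Build _ _ _ _ _ linB).
rewrite (ipZl ipP) xu -RintegralZl//.
apply: eq_Rintegral => s; rewrite inE/= in_itv/= => /andP[s0 sT].
rewrite -(ipZl ipP) /input sf_compE; last first.
  by move=> b v w; rewrite scalerDr !scalerA mulrC.
rewrite -[B]/(B' : V -> V) linearZ_LR (C0_Z S_C0)//.
by rewrite subr_ge0 ltW.
Qed.

(** The control equal to [v] on ]a, b[ and to 0 elsewhere shows that psi integrates to 0 over ]a,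
    b[. An antiderivative of psi is then constant on ]0, T[, so psi vanishes there. *)
Let reach_orthogonal f : (forall w, reach w -> ip w f = 0) ->
  forall (t : R) v, 0 < t < T -> ip (S t (B v)) f = 0.
Proof.
move=> Wf t v /andP[t0 tT].
pose psi (s : R) := ip (S (Num.max 0 (T - s)) (B v)) f.
have psic : continuous psi.
  move=> s; apply: (cvg_ip ipP); last exact: cvg_cst.
  apply: (@continuous_comp _ _ _ (fun s : R => T - s) (fun t : R => S (Num.max 0 t) (B v))).
    by apply: cvgB; [exact: cvg_cst | exact: cvg_id].
  exact: (orbit_continuous S_C0).
have [G dG] := antiderivative_exists psic.
have Gcst (a b : R) : 0 < a -> a <= b -> b < T -> G b = G a.
  move=> a0 ab bT; apply/eqP; rewrite -subr_eq0; apply/eqP.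
  pose A : set (measurableTypeR R) := `]a, b[%classic.
  have mA : measurable A by exact: measurable_itv.
  pose u : sfun := @SimpleFun _ _ _ _ 1 (fun=> A) (fun=> v) (fun=> mA).
  have [w Ww wP] := reach_integral u.
  have <- : \int[mu]_(s in `]a, b[) psi (0 + s) = G b - G a.
    by rewrite (@Rintegral_itv_antiderivative _ psi G a b 0 psic dG ab) !add0r.
  transitivity (ip w f); last exact: Wf.
  rewrite wP.
  have -> : `]a, b[%classic = `]0, T[%classic `&` `]a, b[%classic :> set R.
    rewrite setIC; apply/esym/setIidPl => s /=; rewrite !in_itv/= => /andP[as_ sb].
    by rewrite (lt_trans a0 as_) (lt_trans sb bT).
  rewrite Rintegral_mkcondr; apply: eq_Rintegral => s; rewrite inE/= in_itv/= => /andP[s0 sT].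
  have Ts0 : 0 <= T - s by rewrite subr_ge0 ltW.
  pose B' : {linear V -> V} := HB.pack B (GRing.isLinear.Build _ _ _ _ _ linB).
  rewrite /input /sf_eval big_ord1 indicE [sf_set _]/=; case: (boolP (s \in A)) => sA.
    by rewrite patchT// scale1r add0r /psi max_r.
  rewrite patchC ?inE; last by move/negP: sA; rewrite inE.
  by rewrite scale0r -[B]/(B' : V -> V) raddf0 (C0_0 S_C0)// (ip0l ipP).
have Tt0 : 0 < T - t by rewrite subr_gt0.
have : is_derive (T - t) (1 : R) G 0.
  apply: (@near_eq_is_derive _ _ _ (fun=> G (T - t))).
  near=> s.
  have s0 : 0 < s by near: s; exact: lt_nbhsr.
  have sT : s < T by near: s; apply: lt_nbhsl; rewrite gtrBl.
  have [st|ts] := leP s (T - t).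
    by apply: Gcst => //; rewrite gtrBl.
  by apply/esym; apply: Gcst => //; exact: ltW.
move=> d0; have := dG (T - t).
have <- : psi (T - t) = ip (S t (B v)) f.
  by rewrite /psi subKr max_r// ltW.
by move=> d1; rewrite -(@derive_val _ _ _ _ _ _ _ d1) (@derive_val _ _ _ _ _ _ _ d0).
Unshelve. all: by end_near. Qed.

Lemma approximately_controllable_of_orthogonal :
  (forall f, (forall (t : R) v, 0 < t < T -> ip (S t (B v)) f = 0) -> f = 0) ->
  approximately_controllable S B T.
Proof.
move=> H z0 z1 e e0.
have [w [u wu] wle] := dense_of_orthogonal_trivial ipP reach0 reachD reachZ
  (fun f Wf => H f (reach_orthogonal Wf)) (z1 - S T z0) e0.
have mild (t : R) : {v : V | 0 <= t -> is_bochner_integral mu `]0, t[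
     (fun s => S (t - s) (B (sf_eval u s))) v /\
   forall y, ip v y = \int[mu]_(s in `]0, t[) ip (input u t s) y}.
  apply: cid; have [t0|t0] := leP 0 t; last by exists 0.
  have [v [vB vP]] := @regulated_integral _ _ _ mu _ (measurable_itv `]0, t[)
    (itv_lty t0) V ip ipP _ (input_regulated u t0).
  by exists v => _; split => // y; apply: (vP id 1) => // x; rewrite mul1r.
pose m t := sval (mild t).
have mP t : 0 <= t -> is_bochner_integral mu `]0, t[
     (fun s => S (t - s) (B (sf_eval u s))) (m t) by rewrite /m; case: (mild t) => /= v h /h[].
have mE y : ip (m T) y = ip w y.
  by rewrite wu /m; case: (mild T) => /= v /(_ (ltW T0))[].
exists (sf_eval u); first split.
- by exists (fun=> u); apply: aeW => s _; exact: cvg_cst.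
- have [c cP] := regulated_bounded (@sf_regulated _ (measurableTypeR R) _ `]0, T[ _ u).
  apply: le_lt_trans (_ : _ <= \int[mu]_(t in `]0%R, T[) ((c ^+ 2)%:E))%E _.
    apply: ge0_le_integral_sup => t tT; first by rewrite lee_fin exprn_ge0.
    by rewrite lee_fin ler_pXn2r ?nnegrE ?(le_trans _ (cP _ tT))// cP.
  rewrite integral_cst; last exact: measurable_itv.
  by apply: lte_mul_pinfty => //; [rewrite lee_fin sqr_ge0 | exact: itv_lty (ltW T0)].
exists (fun t => S t z0 + m t).
  by move=> t /andP[t0 _]; exists (m t) => //; exact: mP.
have -> : m T = w.
  apply/eqP; rewrite -subr_eq0; apply/eqP; apply: (ip_eq0 ipP) => y.
  by rewrite (ipBl ipP) mE subrr.
by rewrite distrC opprD addrA.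
Qed.

(* [a k] is the [k]-th power of the generator applied to [S t phi], where [phi] is
   orthogonal to the reachable set. *)
Theorem approximately_controllable_of_unique_continuation :
  (forall x f y g, generator S x f -> generator S y g -> ip f y = ip x g) ->
  (forall x f, generator S x f -> ip f x <= 0) ->
  (forall a : nat -> V, (forall k, generator S (a k) (a k.+1)) ->
     (exists M c, forall k, `|a k| <= M * (c * k%:R) ^+ k) ->
     (forall k v, ip (a k) (B v) = 0) -> a 0%N = 0) ->
  approximately_controllable S B T.
Proof.
move=> sym dis uc; apply: approximately_controllable_of_orthogonal => f fP.
(* At the midpoint, all times T/2 + s with 0 <= s < T/2 stay inside ]0, T[, where [fP] applies. *)
have t0 : 0 < T / 2 by rewrite divr_gt0.
have [a [a0 ag an]] := iterated_generator S_C0 ipP sym dis f t0.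
apply: (semigroup_injective S_C0 ipP sym dis t0).
rewrite -a0; apply: uc => //; first by exists `|f|, (T / 2)^-1.
move=> k v; apply: (generator_orthogonal S_C0 ipP t0 ag) => s /andP[s0 sT].
rewrite a0 -(C0_add S_C0)// ?(ltW t0)// (semigroup_symmetric S_C0 ipP sym dis).
  rewrite (ipC ipP) fP//; apply/andP; split; first by rewrite ltr_wpDl.
  lra.
by rewrite addr_ge0// ltW.
Qed.

End controllability.

(** * The space L^2 and the Dirichlet Laplacian *)

Section square_integrable.
Context d (T : measurableType d) (R : realType) (mu : {measure set T -> \bar R}).
Local Notation L2m := (LspaceType mu (lee1n 2)).
Implicit Types (f g h : L2m) (u v : T -> R).

Lemma L2_measurable f : measurable_fun setT (f : T -> R).
Proof. exact: set_mem (sub_Lfun_mfun (Lspace_Lfun f)). Qed.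

Lemma Lnorm2E u : (('N[mu]_2%:E[EFin \o u]) `^ 2 = \int[mu]_x ((u x) ^+ 2)%:E)%E.
Proof.
rewrite powR_Lnorm//; apply: eq_integral => x _ /=.
by rewrite powR_mulrn// real_normK// num_real.
Qed.

Lemma L2_normE f : (`|f| ^+ 2)%:E = (\int[mu]_x ((f x) ^+ 2)%:E)%E.
Proof. by rewrite -Lnorm2E -Lspace_normrE poweR_EFin powR_mulrn. Qed.

Lemma Lfun2P u : measurable_fun setT u -> (\int[mu]_x ((u x) ^+ 2)%:E < +oo)%E ->
  u \in Lfun mu 2%:E.
Proof.
move=> mfu fin; rewrite inE; apply/andP; split; rewrite inE//=.
rewrite /finite_norm (@lty_poweRy _ _ 2)// Lnorm2E//.
Qed.

Lemma L2_ex u : measurable_fun setT u -> (\int[mu]_x ((u x) ^+ 2)%:E < +oo)%E ->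
  exists f, \forall x \ae mu, f x = u x.
Proof.
move=> mfu fin; exists (Lspace_of (lee1n 2) (Lfun2P mfu fin)).
by apply: filterS (Lspace_ofE (lee1n 2) (Lfun2P mfu fin)) => x /(_ I).
Qed.

Lemma integrable_mul f g : mu.-integrable setT (EFin \o (fun x => f x * g x)).
Proof.
apply/Lfun1_integrable.
exact: (Lfun2_mul_Lfun1 (Lspace_Lfun f) (Lspace_Lfun g)).
Qed.

Lemma ae_eq_Rintegral u v : measurable_fun setT u -> measurable_fun setT v ->
  (\forall x \ae mu, u x = v x) -> \int[mu]_x u x = \int[mu]_x v x.
Proof.
move=> mfu mfv uv; congr fine; apply: ae_eq_integral => //.
- exact/measurable_EFinP.
- exact/measurable_EFinP.
- by apply: filterS uv => x -> _.
Qed.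

Definition L2_ip f g : R := \int[mu]_x (f x * g x).

Lemma L2_ipP : inner_product L2_ip.
Proof.
have mf f := L2_measurable f.
split.
- by move=> f g; apply: eq_Rintegral => x _; rewrite mulrC.
- move=> f g h; rewrite /L2_ip -RintegralD//; try exact: integrable_mul.
  apply: ae_eq_Rintegral.
  + exact: measurable_funM.
  + by apply: measurable_funD; exact: measurable_funM.
  + by apply: filterS (Lspace_addE f g) => x ->; rewrite mulrDl.
- move=> a f h; rewrite /L2_ip -RintegralZl//; last exact: integrable_mul.
  apply: ae_eq_Rintegral.
  + exact: measurable_funM.
  + by apply: measurable_funM => //; exact: measurable_funM.
  + by apply: filterS (Lspace_scaleE a f) => x ->; rewrite mulrA.
- by move=> f; apply: EFin_inj; rewrite L2_normE fineK// -L2_normE.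
Qed.

(** Monotone convergence: the sum has integral at most [C]. *)
Lemma ae_finite_sum (h : nat -> T -> R) (c : nat -> R) (C : R) :
  (forall k, measurable_fun setT (h k)) -> (forall k x, 0 <= h k x) ->
  (forall k, (\int[mu]_x (h k x)%:E <= (c k)%:E)%E) ->
  (forall n, \sum_(k < n) c k <= C) ->
  \forall x \ae mu, (\sum_(k <oo) (h k x)%:E < +oo)%E.
Proof.
move=> mh h0 hc cC.
pose H x := (\sum_(k <oo) (h k x)%:E)%E.
have mH : measurable_fun setT H.
  apply: ge0_emeasurable_sum => [k x _ _|k _]; first by rewrite lee_fin.
  exact/measurable_EFinP.
have iH : (\int[mu]_x H x <= C%:E)%E.
  rewrite integral_nneseries//=; last 2 first.
  - by move=> k; exact/measurable_EFinP.
  - by move=> k x _; rewrite lee_fin.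
  apply: lime_le.
    by apply: is_cvg_nneseries => k _ _; apply: integral_ge0 => x _; rewrite lee_fin.
  apply: nearW => n; apply: (@le_trans _ _ (\sum_(0 <= k < n) (c k)%:E)%E).
    by apply: lee_sum => k _.
  by rewrite sumEFin lee_fin big_mkord.
have H0 x : (0 <= H x)%E by apply: nneseries_ge0 => k _ _; rewrite lee_fin.
have intH : mu.-integrable setT H.
  apply/integrableP; split => //.
  under eq_integral do rewrite gee0_abs//.
  by apply: le_lt_trans iH _; rewrite ltry.
apply: filterS (integrable_ae measurableT intH) => x /(_ I).
by rewrite ge0_fin_numE.
Qed.

End square_integrable.

(** * Completeness of L^2 *)

Section completeness.
Context d (T : measurableType d) (R : realType) (mu : {measure set T -> \bar R}).
Local Notation L2m := (LspaceType mu (lee1n 2)).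
Implicit Types (f g h : L2m).

Lemma L2_normBE f g : (`|f - g| ^+ 2)%:E = (\int[mu]_x ((f x - g x) ^+ 2)%:E)%E.
Proof.
rewrite L2_normE; apply: ge0_ae_eq_integral => //.
- apply/measurable_EFinP; apply: measurable_funX; exact: L2_measurable.
- by apply/measurable_EFinP; apply: measurable_funX; apply: measurable_funB; exact: L2_measurable.
- by move=> x _; rewrite lee_fin sqr_ge0.
- by move=> x _; rewrite lee_fin sqr_ge0.
have h1 := Lspace_addE f (- g).
have h2 := Lspace_scaleE (-1) g.
apply: filterS2 h1 h2 => x -> h2 _; congr (_ ^+ 2)%:E.
by rewrite scaleN1r in h2; rewrite h2 mulN1r.
Qed.

Lemma limn_einf_le (u : nat -> \bar R) (b : \bar R) :
  (forall n, (u n <= b)%E) -> (limn_einf u <= b)%E.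
Proof.
move=> ub; rewrite limn_einf_lim; apply: lime_le; first exact: is_cvg_einfs.
by apply: nearW => n; apply: le_trans (ub n); apply: ereal_inf_lbound; exists n => //=.
Qed.

(* Riesz-Fischer: along a rapidly Cauchy sequence, [\sum_k 4^k (u_(k+1) - u_k)^2]
   is integrable, hence finite almost everywhere, and there [u_k x] is Cauchy. *)
Lemma L2_complete_rapid (u : nat -> L2m) :
  (forall n m, (n <= m)%N -> `|u n - u m| <= 2 * 4^-1 ^+ n) ->
  exists f, forall n, `|f - u n| <= 2 * 4^-1 ^+ n.
Proof.
move=> uc.
have mf n : measurable_fun setT (u n : T -> R) by exact: L2_measurable.
(* Despite the weight 4^k the integrals are at most 4 * 4^-k, with sum at most 16/3. *)
pose h k x : R := 4 ^+ k * (u k.+1 x - u k x) ^+ 2.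
have mh k : measurable_fun setT (h k).
  by apply: measurable_funM => //; apply: measurable_funX; apply: measurable_funB.
have h0 k x : 0 <= h k x by apply: mulr_ge0; [exact: exprn_ge0 | exact: sqr_ge0].
have q0 : 0 <= (4^-1 : R) by [].
have ih k : (\int[mu]_x (h k x)%:E <= (4 * 4^-1 ^+ k)%:E)%E.
  under eq_integral do rewrite EFinM.
  have m2 : measurable_fun setT (fun x => ((u k.+1 x - u k x) ^+ 2)%:E).
    by apply/measurable_EFinP; apply: measurable_funX; apply: measurable_funB.
  rewrite ge0_integralZl//; last by move=> *; rewrite lee_fin ?sqr_ge0.
  rewrite -L2_normBE -EFinM lee_fin.
  have := uc k k.+1 (leqnSn k); rewrite distrC => le1.
  apply: (@le_trans _ _ (4 ^+ k * (2 * 4^-1 ^+ k) ^+ 2)).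
    by rewrite ler_wpM2l ?exprn_ge0// ler_pXn2r// nnegrE// mulr_ge0// exprn_ge0.
  have e1 : 4 ^+ k * 4^-1 ^+ k = 1 :> R by rewrite -exprMn divff ?expr1n.
  have -> : 4 ^+ k * (2 * 4^-1 ^+ k) ^+ 2 = 4 * 4^-1 ^+ k * (4 ^+ k * 4^-1 ^+ k) :> R by ring.
  by rewrite e1 mulr1.
have sumc n : \sum_(k < n) (4 * 4^-1 ^+ k) <= (16 / 3 : R).
  have -> : \sum_(k < n) (4 * 4^-1 ^+ k) = 16 / 3 * (1 - 4^-1 ^+ n) :> R.
    elim: n => [|n IH]; first by rewrite big_ord0 expr0 subrr mulr0.
    by rewrite big_ord_recr/= IH exprS; field.
  by rewrite ler_piMr// gerBl exprn_ge0.
have aeE := ae_finite_sum mh h0 ih sumc.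
pose E : set T := [set x | (\sum_(k <oo) (h k x)%:E < +oo)%E].
have mE : measurable E.
  rewrite -[E]setTI; apply: emeasurable_fun_infty_o => //.
  apply: ge0_emeasurable_sum => [k x _ _|k _]; first by rewrite lee_fin.
  exact/measurable_EFinP.
(* Cutting off outside [E] gives a sequence that converges at every point. *)
pose g n x : R := \1_E x * u n x.
have mg n : measurable_fun setT (g n).
  by apply: measurable_funM => //; exact: measurable_indic.
have gu n : \forall x \ae mu, g n x = u n x.
  by apply: filterS aeE => x Ex; rewrite /g indicE mem_set// mul1r.
have cg x : cvgn (g^~ x).
  have [Ex|nEx] := pselect (E x); last first.
    rewrite (_ : g^~ x = fun=> 0); first exact: is_cvg_cst.
    by apply/funext => n; rewrite /g indicE memNset// mul0r.
  rewrite (_ : g^~ x = u^~ x); last first.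
    by apply/funext => n; rewrite /g indicE mem_set// mul1r.
  have H0 : (0 <= \sum_(k <oo) (h k x)%:E)%E by apply: nneseries_ge0 => k _ _; rewrite lee_fin.
  pose M := fine (\sum_(k <oo) (h k x)%:E).
  have ME : M%:E = (\sum_(k <oo) (h k x)%:E)%E by rewrite fineK// ge0_fin_numE.
  have hM k : h k x <= M.
    rewrite -lee_fin ME; apply: le_trans (nneseries_lim_ge k.+1 _); last first.
      by move=> n _ _; rewrite lee_fin.
    by rewrite big_nat_recr//= leeDr// sume_ge0// => i _; rewrite lee_fin.
  have M0 : 0 <= M by rewrite -lee_fin ME.
  have tb k : `|u k.+1 x - u k x| <= Num.sqrt M * 2^-1 ^+ k.
    rewrite -(@ler_pXn2r _ 2)// ?nnegrE// ?mulr_ge0 ?sqrtr_ge0 ?exprn_ge0 ?invr_ge0//.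
    rewrite real_normK ?num_real// exprMn sqr_sqrtr// -exprM mulnC exprM.
    rewrite -(@ler_pM2l _ (4 ^+ k)) ?exprn_gt0// (le_trans (hM k))//.
    rewrite mulrCA -exprMn (_ : 4 * _ = 1) ?expr1n ?mulr1//; by field.
  have ct : cvgn (series (telescope (u^~ x))).
    apply: normed_cvg.
    apply: (@series_le_cvg _ _ (geometric (Num.sqrt M) 2^-1)).
    - by move=> n /=; exact: normr_ge0.
    - by move=> n /=; rewrite mulr_ge0 ?sqrtr_ge0 ?exprn_ge0.
    - by move=> n /=; exact: tb.
    - by apply: is_cvg_geometric_series; rewrite ger0_norm ?invr_ge0// invf_lt1// ltr1n.
  rewrite (_ : u^~ x = fun n => u 0%N x + series (telescope (u^~ x)) n); last first.
    by apply/funext => n; rewrite -eq_sum_telescope.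
  by apply: is_cvgD => //; exact: is_cvg_cst.
pose f x := limn (g^~ x).
have mlim : measurable_fun setT f.
  by apply: (@measurable_fun_cvg _ _ _ _ g) => // x _; exact: cg.
have key n : (\int[mu]_x ((f x - u n x) ^+ 2)%:E <= ((2 * 4^-1 ^+ n) ^+ 2)%:E)%E.
  have -> : (\int[mu]_x ((f x - u n x) ^+ 2)%:E = \int[mu]_x ((f x - g n x) ^+ 2)%:E)%E.
    apply: ge0_ae_eq_integral => //.
    - by apply/measurable_EFinP; apply: measurable_funX; apply: measurable_funB.
    - by apply/measurable_EFinP; apply: measurable_funX; apply: measurable_funB.
    - by move=> x _; rewrite lee_fin sqr_ge0.
    - by move=> x _; rewrite lee_fin sqr_ge0.
    - by apply: filterS (gu n) => x -> _.
  pose F m x := ((g (m + n)%N x - g n x) ^+ 2)%:E.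
  have FE x : limn_einf (F^~ x) = ((f x - g n x) ^+ 2)%:E.
    have cB : (fun m => g (m + n)%N x - g n x) @ \oo --> f x - g n x.
      by apply: cvgB; [rewrite (cvg_shiftn n (g^~ x)); exact: cg | exact: cvg_cst].
    have cB2 := cvgM cB cB.
    apply: (cvg_limn_einf_sup _).1; apply: cvg_EFin; first exact: nearW.
    rewrite expr2 (_ : _ \o _ = (fun m => (g (m + n)%N x - g n x) * (g (m + n)%N x - g n x)))//; exact: cB2.
  under eq_integral do rewrite -FE.
  (* Fatou in m carries the bound on |u n - u (m + n)| over to the limit. *)
  apply: le_trans (fatou mu measurableT _ _) _.
  - by move=> m; apply/measurable_EFinP; apply: measurable_funX; apply: measurable_funB.
  - by move=> m x _; rewrite lee_fin sqr_ge0.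
  apply: limn_einf_le => m.
  have -> : (\int[mu]_x F m x = (`|u n - u (m + n)%N| ^+ 2)%:E)%E.
    rewrite distrC L2_normBE; apply: ge0_ae_eq_integral => //.
    - by apply/measurable_EFinP; apply: measurable_funX; apply: measurable_funB.
    - by apply/measurable_EFinP; apply: measurable_funX; apply: measurable_funB.
    - by move=> x _; rewrite lee_fin sqr_ge0.
    - by move=> x _; rewrite lee_fin sqr_ge0.
    - by apply: filterS2 (gu n) (gu (m + n)%N) => x h1 h2 _; rewrite /F h1 h2.
  by rewrite lee_fin ler_pXn2r ?nnegrE ?mulr_ge0 ?exprn_ge0// uc// leq_addl.
have fin n : (\int[mu]_x ((f x - u n x) ^+ 2)%:E < +oo)%E.
  by apply: le_lt_trans (key n) _; rewrite ltry.
have mB n : measurable_fun setT (fun x => f x - u n x) by exact: measurable_funB.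
(* Square integrability is known for the difference with [u 0], so the limit is built as [u 0] plus
   the class of that difference. *)
have [v vE] := L2_ex (mB 0%N) (fin 0%N).
exists (u 0%N + v) => n.
rewrite -(@ler_pXn2r _ 2)// ?nnegrE ?mulr_ge0 ?exprn_ge0// -lee_fin.
apply: le_trans (key n); rewrite le_eqVlt; apply/orP; left; apply/eqP.
rewrite L2_normBE; apply: ge0_ae_eq_integral => //.
- apply/measurable_EFinP; apply: measurable_funX; apply: measurable_funB => //.
  exact: L2_measurable.
- by apply/measurable_EFinP; apply: measurable_funX; apply: measurable_funB.
- by move=> x _; rewrite lee_fin sqr_ge0.
- by move=> x _; rewrite lee_fin sqr_ge0.
- by apply: filterS2 vE (Lspace_addE (u 0%N) v) => x h1 h2 _; rewrite h2 h1 [u 0%N x + _]addrC subrK.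
Qed.

(** Centres of balls of radius 4^-n belonging to the filter form a rapidly Cauchy sequence, because
    any two of these balls meet. *)
Lemma L2_cauchy_cvg (F : set_system L2m) : ProperFilter F -> cauchy F -> cvg F.
Proof.
move=> FF /cauchyP Fc.
have q0 n : 0 < (4^-1 : R) ^+ n by rewrite exprn_gt0// invr_gt0.
have xn n : {x : L2m | F (ball x (4^-1 ^+ n))} by apply: cid; exact: Fc.
pose u n := sval (xn n).
have Fu n : F (ball (u n) (4^-1 ^+ n)) by rewrite /u; case: (xn n).
have uc n m : (n <= m)%N -> `|u n - u m| <= 2 * 4^-1 ^+ n.
  move=> nm; have [z [zn zm]] := filter_ex (filterI (Fu n) (Fu m)).
  move: zn zm; rewrite -!ball_normE /ball_/= => zn zm.
  have -> : u n - u m = (u n - z) - (u m - z) by rewrite opprB addrA subrK.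
  have -> : 2 * 4^-1 ^+ n = 4^-1 ^+ n + 4^-1 ^+ n :> R by ring.
  rewrite (le_trans (ler_normB _ _))// lerD// ltW//.
  apply: (lt_le_trans zm); rewrite -(subnK nm) exprD ler_piMl ?exprn_ge0 ?invr_ge0//.
  by rewrite exprn_ile1// ?invr_ge0// invf_le1// ler1n.
have [l lP] := L2_complete_rapid uc.
apply/cvg_ex; exists l; apply/cvgrPdist_le => e e0.
have [n nP] : exists n, 3 * 4^-1 ^+ n <= e.
  exists (Num.truncn (3 / e)); rewrite exprVn ler_pdivrMr ?exprn_gt0//.
  rewrite mulrC -ler_pdivrMr//; apply: le_trans (ltW (truncnS_gt _)) _.
  by rewrite -natrX ler_nat ltn_expl.
near=> z.
have zn : ball (u n) (4^-1 ^+ n) z by near: z; exact: Fu.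
move: zn; rewrite -ball_normE /ball_/= => zn.
rewrite -(subrK (u n) l) -addrA (le_trans (ler_normD _ _))//.
apply: le_trans nP; have := lP n; have := q0 n; lra.
Unshelve. all: by end_near. Qed.
End completeness.

HB.instance Definition _ (R : realType) (n : nat) (Omega : set 'rV[R]_n) (oOmega : open Omega) :=
  Uniform_isComplete.Build (L2 oOmega) (@L2_cauchy_cvg _ _ R (lebesgue_on oOmega)).

(** * Test functions and the Dirichlet Laplacian *)

Section rV_facts.
Context (R : realType) (n : nat).
Implicit Types (phi : 'rV[R]_n -> R).

Lemma continuous_measurable_rV phi : continuous phi -> measurable_fun setT phi.
Proof.
move=> cphi; apply: (measurability (@RGenOpens.G R)); first exact: RGenOpens.measurableE.
move=> _ [_ [a [b ->]] <-]; rewrite setTI.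
apply: open_measurable_rV; apply: open_comp => //.
Qed.

Lemma partial_eq0 (i : 'I_n) phi x : (\forall y \near x, phi y = 0) -> partial i phi x = 0.
Proof.
move=> phi0; rewrite /partial (@near_eq_derive _ _ _ _ (cst 0)) ?derive_cst//.
Qed.

Lemma test_function_partial (U : set 'rV[R]_n) (i : 'I_n) phi :
  test_function U phi -> test_function U (partial i phi).
Proof.
move=> [sphi cphi phiU].
have sub : closure [set x | partial i phi x != 0] `<=` closure [set x | phi x != 0].
  have -> : closure [set x | phi x != 0] = closure (closure [set x | phi x != 0]).
    by apply/closure_id; exact: closed_closure.
  apply: closure_subset => x /= px; apply: contrapT => ncl.
  move/negP: px; apply; apply/eqP; apply: partial_eq0.
  have : open (~` closure [set x | phi x != 0]) by apply: closed_openC; exact: closed_closure.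
  rewrite openE => /(_ x ncl); apply: filterS => y /= ny.
  apply/eqP; apply: contrapT => yn; apply: ny; apply: subset_closure => /=.
  exact/negP.
split.
- move=> s x _; have := sphi (rcons s i) x I.
  by rewrite /partials -cats1 foldr_cat/=.
- by apply: subclosed_compact cphi sub; exact: closed_closure.
- exact: subset_trans sub phiU.
Qed.

Lemma test_function_continuous (U : set 'rV[R]_n) phi :
  test_function U phi -> continuous phi.
Proof. by move=> [sphi _ _] x; have [] := sphi [::] x I. Qed.

End rV_facts.

Section dirichlet.
Context (R : realType) (n : nat) (Omega : set 'rV[R]_n) (oOmega : open Omega).
Local Notation mu := (lebesgue_on oOmega).
Local Notation H := (L2 oOmega).
Local Notation ip := (@L2_ip _ _ R (lebesgue_on oOmega)).
Implicit Types (u v f : H) (phi : 'rV[R]_n -> R).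

Lemma L2_ip_ae f v (phi : 'rV[R]_n -> R) : measurable_fun setT phi ->
  (\forall x \ae mu, v x = phi x) -> \int[mu]_x (f x * phi x) = ip f v.
Proof.
move=> mphi vphi; apply: ae_eq_Rintegral.
- by apply: measurable_funM => //; exact: L2_measurable.
- by apply: measurable_funM; exact: L2_measurable.
- by apply: filterS vphi => x ->.
Qed.

Lemma test_function_measurable (U : set 'rV[R]_n) phi :
  test_function U phi -> measurable_fun setT phi.
Proof. by move=> /test_function_continuous; exact: continuous_measurable_rV. Qed.

Lemma poweR2 (x : \bar R) : (0 <= x -> x `^ 2 = x * x)%E.
Proof.
case: x => [r|_|//]; last by rewrite poweRyr// mulyy.
by rewrite lee_fin => r0; rewrite poweR_EFin powR_mulrn// expr2 EFinM.
Qed.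

(** Test functions are plain functions, elements of [H] are classes. The square-integrable error is
    made into a class [D] first; [w - D] then represents the test function. *)
Lemma H10_approx v : sobolev_H10 v -> exists2 g : 'I_n -> H, (forall i, weak_partial i v (g i)) &
  forall e : R, 0 < e -> exists phi (Phi : H) (G : 'I_n -> H), [/\ test_function Omega phi,
    \forall x \ae mu, Phi x = phi x, (forall i, \forall x \ae mu, G i x = partial i phi x),
    `|v - Phi| <= e & forall i, `|g i - G i| <= e].
Proof.
move=> [g vg gap]; exists g => // e e0; have [phi tphi lte] := gap e e0.
have near_L2 (w : H) (psi : 'rV[R]_n -> R) : measurable_fun setT psi ->
    ('N[mu]_2[EFin \o (w \- psi)%R] ^+ 2 < (e ^+ 2)%:E)%E ->
    exists2 W : H, (\forall x \ae mu, W x = psi x) & `|w - W| <= e.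
  move=> mpsi; rewrite expe2 => lt2.
  have mw := L2_measurable w.
  have mB : measurable_fun setT (fun x => w x - psi x) by exact: measurable_funB.
  have int2 : (\int[mu]_x ((w x - psi x) ^+ 2)%:E < (e ^+ 2)%:E)%E.
    by rewrite -(Lnorm2E mu (fun x => w x - psi x)) poweR2 ?Lnorm_ge0.
  have [D DE] := L2_ex mB (lt_trans int2 (ltry _)).
  exists (w - D).
    have h1 := Lspace_addE w (- D); have h2 := Lspace_scaleE (-1) D.
    rewrite scaleN1r in h2.
    by apply: filterS3 DE h1 h2 => x -> -> ->; rewrite mulN1r opprB addrC subrK.
  rewrite subKr -(@ler_pXn2r _ 2)// ?nnegrE ?(ltW e0)// -lee_fin.
  apply: ltW; apply: le_lt_trans int2; rewrite le_eqVlt; apply/orP; left; apply/eqP.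
  rewrite L2_normE; apply: ge0_ae_eq_integral => //.
  - by apply/measurable_EFinP; apply: measurable_funX; exact: L2_measurable.
  - by apply/measurable_EFinP; exact: measurable_funX.
  - by move=> x _; rewrite lee_fin sqr_ge0.
  - by move=> x _; rewrite lee_fin sqr_ge0.
  - by apply: filterS DE => x -> _.
have N2ge0 (psi : 'rV[R]_n -> R) : (0 <= 'N[mu]_2[EFin \o psi] ^+ 2)%E.
  by rewrite expe_ge0// Lnorm_ge0.
have [Phi PhiE vPhi] : exists2 W : H, (\forall x \ae mu, W x = phi x) & `|v - W| <= e.
  apply: near_L2; first exact: test_function_measurable tphi.
  by apply: le_lt_trans lte; rewrite leeDl// sume_ge0.
have Gi i : {W : H | (\forall x \ae mu, W x = partial i phi x) /\ `|g i - W| <= e}.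
  apply: cid.
  have [||W ? ?] := near_L2 (g i) (partial i phi); last by exists W.
    exact: test_function_measurable (test_function_partial i tphi).
  apply: le_lt_trans lte; rewrite (bigD1 i)//= addeCA leeDl//; apply: adde_ge0; first exact: N2ge0.
  by apply: sume_ge0 => *; exact: N2ge0.
exists phi, Phi, (fun i => sval (Gi i)); split => //.
- by move=> i; case: (Gi i) => ? [].
- by move=> i; case: (Gi i) => ? [].
Qed.

Lemma weak_partial_ip i u g phi (Phi : H) (G : H) : weak_partial i u g ->
  test_function Omega phi -> (\forall x \ae mu, Phi x = phi x) ->
  (\forall x \ae mu, G x = partial i phi x) -> ip u G = - ip g Phi.
Proof.
move=> wu tphi PhiE GE.
rewrite -(L2_ip_ae u (test_function_measurable (test_function_partial i tphi)) GE).
by rewrite wu// (L2_ip_ae g (test_function_measurable tphi) PhiE).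
Qed.

(** [sobolev_H10] and [laplacian] each bring their own weak derivatives of [u]. Two of them agree
    against derivatives of test functions, and [k i] is a limit of these. *)
Lemma weak_partial_ip_H10 i u g g' v (k : 'I_n -> H) :
  weak_partial i u g -> weak_partial i u g' ->
  (forall e : R, 0 < e -> exists phi (Phi : H) (G : 'I_n -> H), [/\ test_function Omega phi,
    \forall x \ae mu, Phi x = phi x, (forall i, \forall x \ae mu, G i x = partial i phi x),
    `|v - Phi| <= e & forall i, `|k i - G i| <= e]) ->
  ip g (k i) = ip g' (k i).
Proof.
move=> ug ug' ap; have ipP := L2_ipP mu.
apply/eqP; rewrite -subr_eq0 -normr_le0; apply: (@ler_addgt0_mul _ _ _ `|g - g'|) => e /andP[e0 _].
rewrite add0r; have [phi [Phi [G [tphi PhiE GE _ kG]]]] := ap e e0.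
have tphi' := test_function_partial i tphi.
have mt := test_function_measurable (test_function_partial i tphi').
have same : ip g (G i) = ip g' (G i).
  rewrite -!(L2_ip_ae _ (test_function_measurable tphi') (GE i)).
  have := ug _ tphi'; rewrite (ug' _ tphi') => /oppr_inj; exact/esym.
have -> : ip g (k i) - ip g' (k i) = ip (g - g') (k i - G i).
  by rewrite (ipBl ipP) !(ipBr ipP) same; ring.
by rewrite (le_trans (ip_abs ipP _ _))// ler_wpM2l.
Qed.

(** For a test function in place of [v] this is the definition of weak derivatives; both sides are
    continuous along the H^1 approximation of [v], so no boundary term arises. *)
Lemma green f u v (g h : 'I_n -> H) (k : 'I_n -> H) :
  (forall i, weak_partial i u (g i) /\ weak_partial i (g i) (h i)) -> f = \sum_(i < n) h i ->
  (forall e : R, 0 < e -> exists phi (Phi : H) (G : 'I_n -> H), [/\ test_function Omega phi,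
    \forall x \ae mu, Phi x = phi x, (forall i, \forall x \ae mu, G i x = partial i phi x),
    `|v - Phi| <= e & forall i, `|k i - G i| <= e]) ->
  ip f v = - \sum_(i < n) ip (g i) (k i).
Proof.
move=> ugh fE ap; have ipP := L2_ipP mu.
apply/eqP; rewrite -subr_eq0 opprK -normr_le0.
apply: (@ler_addgt0_mul _ _ _ (`|f| + \sum_(i < n) `|g i|)) => e /andP[e0 _].
rewrite add0r; have [phi [Phi [G [tphi PhiE GE vPhi kG]]]] := ap e e0.
have E : ip f Phi = - \sum_(i < n) ip (g i) (G i).
  rewrite fE (ip_suml ipP) -sumrN; apply: eq_bigr => i _.
  by rewrite (weak_partial_ip (ugh i).2 tphi PhiE (GE i)) opprK.
have -> : ip f v + \sum_(i < n) ip (g i) (k i) =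
    ip f (v - Phi) + \sum_(i < n) ip (g i) (k i - G i).
  rewrite (ipBr ipP) E opprK -addrA; congr (_ + _).
  by rewrite -big_split/=; apply: eq_bigr => i _; rewrite (ipBr ipP) addrC subrK.
rewrite (le_trans (ler_normD _ _))// mulrDl lerD//.
  by rewrite (le_trans (ip_abs ipP _ _))// ler_wpM2l.
rewrite (le_trans (ler_norm_sum _ _ _))// mulr_suml; apply: ler_sum => i _.
by rewrite (le_trans (ip_abs ipP _ _))// ler_wpM2l.
Qed.

Lemma dirichlet_laplacian_symmetric u f v k :
  dirichlet_laplacian oOmega u f -> dirichlet_laplacian oOmega v k -> ip f v = ip u k.
Proof.
have ipP := L2_ipP mu.
move=> [/H10_approx[gu ugu apu] _ [g [h [ugh fE]]]].
move=> [/H10_approx[gv vgv apv] _ [g' [h' [vgh kE]]]].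
rewrite (green ugh fE apv) (ipC ipP u k) (green vgh kE apu); congr (- _).
apply: eq_bigr => i _.
rewrite (weak_partial_ip_H10 (ugh i).1 (ugu i) apv) (ipC ipP).
by rewrite (weak_partial_ip_H10 (vgv i) (vgh i).1 apu).
Qed.

Lemma dirichlet_laplacian_dissipative u f : dirichlet_laplacian oOmega u f -> ip f u <= 0.
Proof.
have ipP := L2_ipP mu.
move=> [/H10_approx[gu ugu apu] _ [g [h [ugh fE]]]].
rewrite (green ugh fE apu) oppr_le0 sumr_ge0// => i _.
by rewrite (weak_partial_ip_H10 (ugh i).1 (ugu i) apu) (ipxx ipP) exprn_ge0.
Qed.

Lemma lebesgue_on_lty : bounded_set Omega -> (mu setT < +oo)%E.
Proof.
move=> /pinfty_ex_gt0[M M0 MO].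
pose A (i : 'I_n) : set R := `[(- M), M]%classic.
have mA i : measurable (A i) by exact: measurable_itv.
have mB : measurable [set v : 'rV[R]_n | forall i, A i (v ord0 i)].
  rewrite (_ : mkset _ = \bigcap_(i in [set: 'I_n]) ((fun v : 'rV[R]_n => v ord0 i) @^-1` A i)).
    apply: fin_bigcap_measurable; first exact: finite_finset.
    by move=> i _; rewrite -[X in measurable X]setTI; exact: measurable_coord.
  by apply/seteqP; split => v /= h i // *; exact: h.
rewrite /lebesgue_on/= /mrestr setTI; apply: (@le_lt_trans _ _
   (lebesgue_rV R n [set v | forall i, A i (v ord0 i)])).
  apply: le_measure; rewrite ?inE//; first exact: open_measurable_rV.
  move=> v Ov i; rewrite /A/= in_itv/= -ler_norml.
  apply: le_trans (MO v Ov).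
  have /mapP[j Hj ->] : `|v ord0 i| \in [seq `|v x.1 x.2| | x : 'I_1 * 'I_n].
    by apply/mapP; exists (ord0, i) => //=; rewrite mem_enum.
  by rewrite [leRHS]/Num.norm/= mx_normrE; apply/bigmax_geP; right => /=; exists j.
rewrite lebesgue_rV_box//.
suff /andP[] : (0 <= \prod_(i < n) lebesgue_measure (A i) < +oo)%E by [].
elim/big_ind : _ => [|x y /andP[x0 xoo] /andP[y0 yoo]|i _].
- by rewrite lee01 ltry.
- by rewrite mule_ge0//= lte_mul_pinfty// ge0_fin_numE.
- by rewrite measure_ge0/= /A lebesgue_measure_itv/=; case: ifPn => // _; rewrite -EFinD ltry.
Qed.

Lemma L2_sumE m (F : 'I_m -> H) :
  \forall x \ae mu, (\sum_(i < m) F i : H) x = \sum_(i < m) F i x.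
Proof.
elim: m F => [|m IH] F.
  by rewrite big_ord0; apply: filterS (Lspace_zeroE mu (lee1n 2)) => x ->; rewrite big_ord0.
rewrite big_ord_recr/=.
have := IH (fun i => F (widen_ord (leqnSn m) i)).
apply: filterS2 (Lspace_addE (\sum_(i < m) F (widen_ord (leqnSn m) i)) (F ord_max)) => x -> ->.
by rewrite big_ord_recr.
Qed.

Lemma bounded_L2 (c : R) phi : (mu setT < +oo)%E -> measurable_fun setT phi ->
  (forall x, `|phi x| <= c) ->
  exists2 Phi : H, (\forall x \ae mu, Phi x = phi x) & `|Phi| <= c * Num.sqrt (fine (mu setT)).
Proof.
move=> fin mphi phic.
have c0 : 0 <= c := le_trans (normr_ge0 _) (phic 0).
have le2 : (\int[mu]_x ((phi x) ^+ 2)%:E <= (c ^+ 2 * fine (mu setT))%:E)%E.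
  have -> : ((c ^+ 2 * fine (mu setT))%:E = \int[mu]_x (c ^+ 2)%:E)%E.
    by rewrite integral_cst// EFinM fineK// ge0_fin_numE.
  apply: ge0_le_integral_sup => x _; first by rewrite lee_fin sqr_ge0.
  by rewrite lee_fin -real_normK ?num_real// ler_pXn2r// nnegrE.
have [Phi PhiE] := L2_ex mphi (le_lt_trans le2 (ltry _)).
exists Phi => //.
rewrite -(@ler_pXn2r _ 2)// ?nnegrE ?mulr_ge0 ?sqrtr_ge0// exprMn sqr_sqrtr ?fine_ge0//.
rewrite -lee_fin; apply: le_trans le2; rewrite le_eqVlt; apply/orP; left; apply/eqP.
rewrite L2_normE; apply: ge0_ae_eq_integral => //.
- by apply/measurable_EFinP; apply: measurable_funX; exact: L2_measurable.
- by apply/measurable_EFinP; exact: measurable_funX.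
- by move=> x _; rewrite lee_fin sqr_ge0.
- by move=> x _; rewrite lee_fin sqr_ge0.
- by apply: filterS PhiE => x -> _.
Qed.

Lemma test_function_bounded (U : set 'rV[R]_n) phi : test_function U phi ->
  exists c : R, forall x, `|phi x| <= c.
Proof.
move=> tphi; have cphi := test_function_continuous tphi; have [_ cpt _] := tphi.
have : compact (phi @` closure [set x | phi x != 0]).
  by apply: continuous_compact => //; exact: continuous_subspaceT.
move=> /compact_bounded /pinfty_ex_gt0[c c0 cP]; exists c => x.
have [->|x0] := eqVneq (phi x) 0; first by rewrite normr0 ltW.
by apply: cP; exists x => //; exact: subset_closure.
Qed.

Definition laplace phi : 'rV[R]_n -> R := fun x => \sum_(i < n) partial i (partial i phi) x.

Lemma laplacian_test u f phi : (mu setT < +oo)%E -> laplacian u f ->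
  test_function Omega phi -> \int[mu]_x (f x * phi x) = \int[mu]_x (u x * laplace phi x).
Proof.
move=> fin [g [h [ugh ->]]] tphi; have ipP := L2_ipP mu.
have ex (psi : 'rV[R]_n -> R) : test_function Omega psi -> exists Psi : H, \forall x \ae mu, Psi x = psi x.
  move=> tpsi; have [c cP] := test_function_bounded tpsi.
  have [Psi ? _] := bounded_L2 fin (test_function_measurable tpsi) cP.
  by exists Psi.
have t1 i := test_function_partial i tphi.
have t2 i := test_function_partial i (t1 i).
have [Phi PhiE] := ex _ tphi.
have Phi1 i : {G : H | \forall x \ae mu, G x = partial i phi x} by apply: cid; exact: ex.
have Phi2 i : {G : H | \forall x \ae mu, G x = partial i (partial i phi) x} by apply: cid; exact: ex.
rewrite (L2_ip_ae _ (test_function_measurable tphi) PhiE) (ip_suml ipP).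
pose L : H := \sum_(i < n) sval (Phi2 i).
have LE : \forall x \ae mu, L x = laplace phi x.
  have PE : \forall x \ae mu, forall i, sval (Phi2 i) x = partial i (partial i phi) x.
    by apply: filter_forall => i; case: (Phi2 i).
  by apply: filterS2 (L2_sumE (fun i => sval (Phi2 i))) PE => x -> xE; apply: eq_bigr => i _.
rewrite (L2_ip_ae u _ LE); last first.
  apply: measurable_sum => i; exact: test_function_measurable (t2 i).
rewrite (ipC ipP) /L (ip_suml ipP); apply: eq_bigr => i _.
case: (Phi2 i) => G2 G2E /=; case: (Phi1 i) => G1 G1E.
rewrite -[LHS]opprK -(weak_partial_ip (ugh i).2 tphi PhiE G1E).
by rewrite -(weak_partial_ip (ugh i).1 (t1 i) G1E G2E) (ipC ipP).
Qed.

Context (omega : set 'rV[R]_n) (oomega : open omega).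

Lemma control_op_linear : linear (control_op oomega : H -> H).
Proof.
move=> a u v; apply: Lspace_eqP.
have E1 := control_opE oomega (a *: u + v).
have E2 := Lspace_addE (a *: u) v.
have E3 := Lspace_scaleE a u.
have E4 := Lspace_addE (a *: control_op oomega u) (control_op oomega v).
have E5 := Lspace_scaleE a (control_op oomega u).
have E6 := control_opE oomega u.
have E7 := control_opE oomega v.
apply: filterS2 (filterI (filterI E1 E2) (filterI E3 E4)) (filterI (filterI E5 E6) E7).
move=> x [[e1 e2] [e3 e4]] [[e5 e6] e7] _.
by rewrite e4 e5 e6 e7 e1 e2 e3 mulrDr mulrCA.
Qed.

(** Taking [v = u] makes the integral of 1_omega u^2 vanish. *)
Lemma orthogonal_control_op u : (forall v, ip u (control_op oomega v) = 0) ->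
  \forall x \ae mu, omega x -> u x = 0.
Proof.
move=> /(_ u).
have mo : measurable_fun setT (fun x => \1_omega x * u x).
  apply: measurable_funM; last exact: L2_measurable.
  by apply: measurable_indic; exact: open_measurable_rV.
rewrite -(L2_ip_ae u mo (control_opE oomega u)) => int0.
have mg : measurable_fun setT (fun x => (u x * (\1_omega x * u x))%:E).
  by apply/measurable_EFinP; apply: measurable_funM => //; exact: L2_measurable.
have ge0 x : 0 <= u x * (\1_omega x * u x).
  by rewrite mulrCA -expr2 mulr_ge0 ?sqr_ge0.
have int0' : (\int[mu]_x (`|(u x * (\1_omega x * u x))%:E|))%E = 0%E.
  under eq_integral do rewrite gee0_abs ?lee_fin//.
  (* [fine] also sends infinity to 0, so the integral has to be shown finite. *)
  rewrite -[LHS]fineK; first by congr EFin.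
  have [W WE] : exists W : H, \forall x \ae mu, W x = \1_omega x * u x.
    by exists (control_op oomega u); exact: control_opE.
  have -> : (\int[mu]_x (u x * (\1_omega x * u x))%:E = \int[mu]_x (u x * W x)%:E)%E.
    apply: ae_eq_integral => //.
      by apply/measurable_EFinP; apply: measurable_funM; exact: L2_measurable.
    by apply: filterS WE => x -> _.
  exact: (integrable_fin_num measurableT (integrable_mul u W)).
have /ae_eq_integral_abs := int0'; move=> /(_ measurableT mg).
apply: filterS => x /(_ I)/= [] + ox.
rewrite indicE mem_set// mul1r => /eqP; rewrite mulf_eq0 orbb => /eqP; exact.
Qed.

End dirichlet.

(** * Unique continuation *)

Section smooth_functions.
Context (R : realType).
Implicit Types (f g h : R -> R).

Fixpoint Cn (n : nat) f : Prop :=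
  if n is m.+1 then (forall x : R, derivable f x 1) /\ Cn m (derive1 f) else True.

Definition smooth f := forall n, Cn n f.

Lemma CnSP n f : Cn n.+1 f <->
  exists2 g, (forall x : R, is_derive x 1 f (g x)) & Cn n g.
Proof.
split=> [[df cf]|[g fg cg]].
  by exists (derive1 f) => // x; rewrite derive1E; exact: derivableP.
split; first by move=> x; exact: ex_derive.
have -> : (derive1 f) = g by apply/funext => x; rewrite derive1E; exact: derive_val.
exact: cg.
Qed.

Lemma CnW n f : Cn n.+1 f -> Cn n f.
Proof. by elim: n f => [//|n IH] f /= [df cf]; split => //; exact: IH. Qed.

Lemma smoothP f : smooth f <-> exists2 g, (forall x : R, is_derive x 1 f (g x)) & smooth g.
Proof.
split=> [sf|[g fg sg]].
  exists (derive1 f); first by move=> x; rewrite derive1E; apply/derivableP; have [] := sf 1%N.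
  by move=> n; have [] := sf n.+1.
by case=> // n; apply/CnSP; exists g.
Qed.

Lemma smooth_derive1 f : smooth f -> smooth (derive1 f).
Proof. by move=> sf n; have [] := sf n.+1. Qed.

Lemma smooth_is_derive f (x : R) : smooth f -> is_derive x 1 f ((derive1 f) x).
Proof. by move=> sf; rewrite derive1E; apply/derivableP; have [] := sf 1%N. Qed.

Lemma smooth_continuous f : smooth f -> continuous f.
Proof. by move=> sf; apply: is_derive_continuous => x; exact: smooth_is_derive. Qed.

Lemma smooth_cst (c : R) : smooth (fun=> c).
Proof.
move=> n; elim: n c => // n IH c; apply/CnSP; exists (fun=> 0) => //.
by move=> x; exact: is_derive_cst.
Qed.

Lemma smooth_id : smooth id.
Proof.
by apply/smoothP; exists (fun=> 1); [move=> x; exact: is_derive_id | exact: smooth_cst].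
Qed.

Lemma CnD n f g : Cn n f -> Cn n g -> Cn n (fun x => f x + g x).
Proof.
elim: n f g => // n IH f g /CnSP[f' ff' cf'] /CnSP[g' gg' cg']; apply/CnSP.
by exists (fun x => f' x + g' x); [move=> x; exact: is_deriveD | exact: IH].
Qed.

Lemma CnM n f g : Cn n f -> Cn n g -> Cn n (fun x => f x * g x).
Proof.
elim: n f g => // n IH f g cf cg.
have /CnSP[f' ff' cf'] := cf; have /CnSP[g' gg' cg'] := cg; apply/CnSP.
exists (fun x => f x * g' x + g x * f' x).
  by move=> x; exact: is_deriveM.
by apply: CnD; apply: IH => //; exact: CnW.
Qed.

Lemma smoothD f g : smooth f -> smooth g -> smooth (fun x => f x + g x).
Proof. by move=> sf sg n; exact: CnD. Qed.

Lemma smoothM f g : smooth f -> smooth g -> smooth (fun x => f x * g x).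
Proof. by move=> sf sg n; exact: CnM. Qed.

Lemma smoothZ (c : R) f : smooth f -> smooth (fun x => c * f x).
Proof. by move=> sf; apply: smoothM => //; exact: smooth_cst. Qed.

Lemma smoothN f : smooth f -> smooth (fun x => - f x).
Proof.
move=> /(smoothZ (-1)); congr smooth.
by apply/funext => x; rewrite mulN1r.
Qed.

Lemma smooth_expR f : smooth f -> smooth (fun x => expR (f x)).
Proof.
move=> sf n; elim: n f sf => // n IH f sf; apply/CnSP.
exists (fun x => expR (f x) * (derive1 f) x).
  move=> x; have h := smooth_is_derive x sf.
  exact: (@is_derive1_comp _ expR f x _ _ (is_derive_expR _) h).
by apply: CnM; [exact: IH | exact: smooth_derive1].
Qed.

Lemma smoothV f : (forall x, f x != 0) -> smooth f -> smooth (fun x => (f x)^-1).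
Proof.
move=> f0 sf n; elim: n => // n IH; apply/CnSP.
exists (fun x => - (derive1 f) x * ((f x)^-1 * (f x)^-1)).
  move=> x; have h := smooth_is_derive x sf.
  apply: is_derive_eq (is_deriveV (f0 x) h) _.
  by rewrite mulNr scaleNr /GRing.scale/= mulrC expr2 invfM.
apply: CnM; first by apply: smoothN; exact: smooth_derive1.
exact: CnM.
Qed.

Lemma smooth_antiderivative f : smooth f -> exists2 g, (forall x : R, is_derive x 1 g (f x)) & smooth g.
Proof.
move=> sf; have [g gf] := antiderivative_exists (smooth_continuous sf).
by exists g => //; apply/smoothP; exists f.
Qed.

Lemma smooth_comp_affine (a b : R) f : smooth f -> smooth (fun x => f (a * x + b)).
Proof.
move=> sf n; elim: n f sf => // n IH f sf; apply/CnSP.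
exists (fun x => (derive1 f) (a * x + b) * a).
  move=> x; apply: is_derive1_comp; first exact: smooth_is_derive.
  have h : is_derive x (1 : R) (fun x : R => a * x + b) (a *: 1 + 0).
    by apply: is_deriveD; apply: is_deriveZ.
  by move: h; rewrite addr0 /GRing.scale/= mulr1.
apply: CnM; last exact: smooth_cst.
by apply: IH; exact: smooth_derive1.
Qed.

(** [flat 0] is the usual function exp(-1/t), flat at 0; the powers of 1/t make the family stable
    under differentiation. *)
Definition flat (m : nat) (t : R) : R := if 0 < t then t^-1 ^+ m * expR (- t^-1) else 0.

(** 1 + x <= exp x at x = 1/(t (m + 1)), raised to the power m + 1, gives t^-(m+1) <= (m + 1)^(m+1)
    exp(1/t). *)
Lemma flat_le m (t : R) : `|flat m t| <= m.+1%:R ^+ m.+1 * `|t|.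
Proof.
rewrite /flat; case: ifPn => t0; last by rewrite normr0 mulr_ge0// exprn_ge0.
have tV0 : 0 < t^-1 by rewrite invr_gt0.
rewrite ger0_norm ?mulr_ge0 ?exprn_ge0 ?expR_ge0 ?(ltW tV0)// gtr0_norm//.
have h1 : (t^-1 / m.+1%:R) ^+ m.+1 <= expR t^-1.
  have -> : expR t^-1 = expR (t^-1 / m.+1%:R) ^+ m.+1.
    by rewrite -expRM_natl; congr expR; rewrite mulrC divfK// pnatr_eq0.
  rewrite ler_pXn2r// ?nnegrE ?expR_ge0 ?divr_ge0 ?(ltW tV0)//.
  by apply: le_trans (expR_ge1Dx _); rewrite lerDr.
rewrite expRN ler_pdivrMr ?expR_gt0//.
apply: (@le_trans _ _ (m.+1%:R ^+ m.+1 * t * (t^-1 / m.+1%:R) ^+ m.+1)); last first.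
  by rewrite ler_wpM2l// mulr_ge0 ?exprn_ge0// ltW.
rewrite exprMn mulrCA mulrA mulrAC -!mulrA [_ * (_ * t)]mulrCA.
rewrite [X in _ <= _ * X]mulrA -exprMn divff ?pnatr_eq0// expr1n mul1r exprSr -mulrA.
by rewrite mulVf ?mulr1// gt_eqF.
Qed.

Lemma is_derive_flat m (x : R) : is_derive x 1 (flat m) (flat m.+2 x - m%:R * flat m.+1 x).
Proof.
have [x0|x0|->] := ltgtP x 0.
- rewrite /flat ltNge (ltW x0)/= mulr0 subr0.
  apply: (@near_eq_is_derive _ _ _ (fun=> 0)).
  near=> y; have y0 : y < 0 by near: y; exact: lt_nbhsl.
  by rewrite ltNge (ltW y0).
- rewrite /flat x0.
  apply: (@near_eq_is_derive R R R (fun t : R => t^-1 ^+ m * expR (- t^-1))).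
    near=> y; have y0 : 0 < y by near: y; exact: lt_nbhsr.
    by rewrite y0.
  have xn0 : x != 0 by rewrite gt_eqF.
  have hV : is_derive x (1 : R) (fun t : R => t^-1) (- x ^- 2).
    by apply: is_derive_eq (is_deriveV xn0 (is_derive_id _ _)) _; rewrite /GRing.scale/= mulr1.
  have hX : is_derive x (1 : R) (fun t : R => t^-1 ^+ m) (m%:R * x^-1 ^+ m.-1 * (- x ^- 2)).
    rewrite (_ : (fun t : R => t^-1 ^+ m) = (fun t : R => t^-1) ^+ m); last first.
      by apply/funext => t; rewrite fctE.
    exact: (is_deriveX m hV).
  have hE : is_derive x (1 : R) (fun t : R => expR (- t^-1)) (expR (- x^-1) * x ^- 2).
    have hN : is_derive x (1 : R) (fun t : R => - t^-1) (x ^- 2).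
      by have := is_deriveN hV; rewrite opprK.
    exact: (@is_derive1_comp _ expR _ x _ _ (is_derive_expR _) hN).
  apply: is_derive_eq (is_deriveM hX hE) _.
  rewrite /GRing.scale/= -exprVn; case: m {hX} => [|m] /=; first by ring.
  by rewrite !exprS; ring.
have f0 k : flat k 0 = 0 by rewrite /flat ltxx.
rewrite !f0 mulr0 subr0.
(* At 0 the difference quotient of [flat m] is [flat m.+1], which tends to 0 by [flat_le]. *)
have lim : h^-1 *: (flat m (h *: 1 + 0) - flat m 0) @[h --> (0 : R)^'] --> (0 : R).
  have E (h : R) : h^-1 *: (flat m (h *: 1 + 0) - flat m 0) = flat m.+1 h.
    rewrite f0 subr0 addr0 /GRing.scale/= mulr1 /flat; case: ifP => _; last by rewrite mulr0.
    by rewrite mulrA exprS.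
  under eq_fun do rewrite E.
  apply: (@cvg_le_dist R R R _ _ _ _ (fun h : R => m.+2%:R ^+ m.+2 * `|h|)).
    by move=> t; rewrite sub0r normrN; exact: flat_le.
  rewrite -[X in _ --> X](mulr0 (m.+2%:R ^+ m.+2)).
  apply: cvgM; first exact: cvg_cst.
  rewrite -[X in _ --> X](@normr0 _ R); apply: cvg_norm.
  exact: (@nbhs_dnbhs _ (0 : R)).
apply: DeriveDef; last exact: cvg_lim lim.
by apply/cvg_ex; exists 0.
Unshelve. all: by end_near. Qed.

Lemma smooth_flat m : smooth (flat m).
Proof.
move=> n; elim: n m => // n IH m; apply/CnSP.
exists (fun x => flat m.+2 x - m%:R * flat m.+1 x); first by move=> x; exact: is_derive_flat.
apply: CnD => //; rewrite (_ : (fun x => _) = (fun x => - m%:R * flat m.+1 x)).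
  by apply: CnM => //; exact: smooth_cst.
by apply/funext => x; rewrite mulNr.
Qed.

Lemma flat_gt0 (t : R) : 0 < t -> 0 < flat 0 t.
Proof. by move=> t0; rewrite /flat t0 expr0 mul1r expR_gt0. Qed.

Lemma flat_eq0 m (t : R) : t <= 0 -> flat m t = 0.
Proof. by move=> t0; rewrite /flat ltNge t0. Qed.

End smooth_functions.

(** * The radial equation, solved from the outer edge *)

Section radial_ode.
Context (R : realType).
Implicit Types (f g u v psi eta : R -> R).

(** 1/s is prolonged smoothly to the whole line as the inverse of [h]. For s >= e, h(s) = s; for s
    <= 0 the factor exp(1/e) makes the added term at least 1 + s^2, so h >= 1 + s + s^2 > 0. *)
Lemma smooth_inverse_from (e : R) : 0 < e ->
  exists2 r, smooth r & forall s, e <= s -> r s * s = 1.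
Proof.
move=> e0.
pose h (s : R) := s + expR e^-1 * ((1 + s * s) * flat 0 (-1 * s + e)).
have hpos s : 0 < h s.
  have f0 : 0 <= flat 0 (-1 * s + e).
    by rewrite /flat; case: ifP => // _; rewrite mulr_ge0 ?expR_ge0// expr0.
  have [s0|s0] := ltP 0 s.
    have s2 : 0 <= s * s by rewrite -expr2 sqr_ge0.
    by rewrite /h ltr_pwDl// mulr_ge0 ?expR_ge0// mulr_ge0// addr_ge0.
  have es : 0 < -1 * s + e by lra.
  have le1 : 1 <= expR e^-1 * flat 0 (-1 * s + e).
    rewrite /flat es expr0 mul1r -expRD -[X in X <= _]expR0 ler_expR.
    by rewrite subr_ge0 lef_pV2 ?posrE//; lra.
  rewrite /h mulrCA; move: le1; set X := expR e^-1 * _ => le1.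
  have s2 : 0 <= (2 * s + 1) * (2 * s + 1) by rewrite -expr2 sqr_ge0.
  have s3 : 0 <= (1 + s * s) * (X - 1) by rewrite mulr_ge0 ?subr_ge0// addr_ge0// -expr2 sqr_ge0.
  by nra.
have hs : smooth h.
  apply: smoothD; first exact: smooth_id.
  apply: smoothZ; apply: smoothM.
    by apply: smoothD; [exact: smooth_cst | apply: smoothM; exact: smooth_id].
  exact: (smooth_comp_affine (-1) e (@smooth_flat R 0)).
exists (fun s => (h s)^-1).
  by apply: smoothV => // s; rewrite gt_eqF.
move=> s es; have s0 : 0 < s := lt_le_trans e0 es.
by rewrite /h flat_eq0 ?mulr0 ?addr0 ?mulVf ?gt_eqF//; lra.
Qed.

Lemma continuous_bounded_itv f (a b : R) : continuous f ->
  exists2 K : R, 0 < K & forall s, a <= s <= b -> `|f s| <= K.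
Proof.
move=> cf.
have : compact (f @` `[a, b]).
  by apply: continuous_compact; [exact: continuous_subspaceT | exact: segment_compact].
move=> /compact_bounded /pinfty_ex_gt0[c c0 cP]; exists c => // s sab.
by apply: cP; exists s => //=; rewrite in_itv.
Qed.

(** [v] is the integral of [u] from s to rho; each such integration gains a power of rho - s with
    its factorial. For the bound, F - v and F + v vanish at rho and are nonincreasing on [0, rho],
    where F is the claimed majorant. *)
Lemma smooth_tail u (rho : R) : smooth u -> (forall s, rho <= s -> u s = 0) ->
  exists v, [/\ smooth v, (forall s : R, is_derive s 1 v (- u s)),
    (forall s, rho <= s -> v s = 0) &
    forall (b : R) m, (forall s, 0 <= s <= rho -> `|u s| <= b * ((rho - s) ^+ m / m`!%:R)) ->
      forall s, 0 <= s <= rho -> `|v s| <= b * ((rho - s) ^+ m.+1 / m.+1`!%:R)].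
Proof.
move=> su u0.
have [G dG sG] := smooth_antiderivative su.
pose v s := G rho - G s.
have dv (s : R) : is_derive s (1 : R) v (- u s).
  by rewrite -[- u s]add0r; apply: is_deriveB.
have vrho : v rho = 0 by rewrite /v subrr.
exists v; split => //.
- apply: smoothD; first exact: smooth_cst.
  exact: smoothN.
- move=> s rs; rewrite /v; have [c] := MVT_everywhere dG rs.
  rewrite in_itv/= => /andP[rc _]; rewrite u0// mul0r => /eqP; rewrite subr_eq0 => /eqP ->.
  by rewrite subrr.
move=> b m ub s /andP[s0 sr].
pose F (s : R) : R := b * ((rho - s) ^+ m.+1 / m.+1`!%:R).
have dF (t : R) : is_derive t (1 : R) F (- (b * ((rho - t) ^+ m / m`!%:R))).
  have h1 : is_derive t (1 : R) (fun t : R => rho - t) (-1).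
    by rewrite -[X in is_derive _ _ _ X]add0r; apply: is_deriveB.
  have h2 : is_derive t (1 : R) (fun t : R => (rho - t) ^+ m.+1) (- (m.+1%:R * (rho - t) ^+ m)).
    rewrite (_ : (fun t : R => (rho - t) ^+ m.+1) = (fun t : R => rho - t) ^+ m.+1); last first.
      by apply/funext => x; rewrite fctE.
    by apply: is_derive_eq (is_deriveX m.+1 h1) _; rewrite /GRing.scale/= mulrN1.
  have h3 := is_deriveZ (b / m.+1`!%:R) h2.
  rewrite (_ : F = (b / m.+1`!%:R) \*: (fun t : R => (rho - t) ^+ m.+1)).
    apply: is_derive_eq h3 _; rewrite /GRing.scale/= factS natrM; field.
    by rewrite pnatr_eq0 -lt0n fact_gt0 gt_eqF// ltr_pwDl.
  by apply/funext => x; rewrite /F /= /GRing.scale/= mulrAC mulrA.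
have Frho : F rho = 0 by rewrite /F subrr expr0n/= mul0r mulr0.
have d1 (t : R) : is_derive t (1 : R) (F - v) (- (b * ((rho - t) ^+ m / m`!%:R)) - - u t).
  exact: is_deriveB.
have d2 (t : R) : is_derive t (1 : R) (F + v) (- (b * ((rho - t) ^+ m / m`!%:R)) + - u t).
  exact: is_deriveD.
have [c1] := MVT_everywhere d1 sr.
rewrite in_itv/= => /andP[sc1 c1r]; rewrite !fctE vrho Frho => e1.
have [c2] := MVT_everywhere d2 sr.
rewrite in_itv/= => /andP[sc2 c2r]; rewrite !fctE vrho Frho => e2.
have := ub c1; rewrite c1r (le_trans s0 sc1) => /(_ isT); rewrite ler_norml => /andP[b1 b2].
have := ub c2; rewrite c2r (le_trans s0 sc2) => /(_ isT); rewrite ler_norml => /andP[b3 b4].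
have rs : 0 <= rho - s by rewrite subr_ge0.
rewrite -/(F s) ler_norml.
move: e1 e2 b1 b2 b3 b4; set X := b * _; set Y := b * _ => e1 e2 b1 b2 b3 b4.
by apply/andP; split; nra.
Qed.

(* [4 s eta'' + 2 n eta' = psi] solved from the right by the integrating factor
   [w = exp ((n/2) \int r)], where [r s = 1/s] on the relevant range [s >= e];
   each solution gains two powers of [rho - s]. *)
Lemma radial_ode (n : nat) (e rho : R) : 0 < e -> exists2 K : R, 0 <= K &
  forall psi, smooth psi -> (forall s, rho <= s -> psi s = 0) ->
  exists eta, [/\ smooth eta, (forall s, rho <= s -> eta s = 0),
    (forall s, e <= s -> 4 * s * (derive1 (derive1 eta)) s + 2 * n%:R * (derive1 eta) s = psi s) &
    forall (b : R) m, (forall s, 0 <= s <= rho -> `|psi s| <= b * ((rho - s) ^+ m / m`!%:R)) ->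
      forall s, 0 <= s <= rho -> `|eta s| <= K * b * ((rho - s) ^+ m.+2 / m.+2`!%:R)].
Proof.
move=> e0; have [r sr rE] := smooth_inverse_from e0.
have [P dP sP] := smooth_antiderivative sr.
(* Divided by 4 s, the equation is eta'' + c r eta' = r psi / 4, that is (w eta')' = r w psi / 4
   with w = exp(c P); hence u = - w eta' and eta' = - W u. *)
pose c : R := n%:R / 2.
pose w (s : R) := expR (c * P s).
pose W (s : R) := expR (- (c * P s)).
have sw : smooth w by apply: smooth_expR; exact: smoothZ.
have sW : smooth W by apply: smooth_expR; apply: smoothN; exact: smoothZ.
have wW s : W s * w s = 1 by rewrite /W /w -expRD addNr expR0.
have sc : smooth (fun s => r s * w s / 4).
  by apply: smoothM; [exact: smoothM | exact: smooth_cst].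
have [K1 K10 K1P] := continuous_bounded_itv 0 rho (smooth_continuous sc).
have [K2 K20 K2P] := continuous_bounded_itv 0 rho (smooth_continuous sW).
(* The two coefficients are bounded independently of psi, so k iterations cost the k-th power of one
   constant. *)
exists (K2 * K1); first by rewrite mulr_ge0// ltW.
move=> psi spsi psi0.
have [u [su du u0 ub]] := @smooth_tail (fun s => r s * w s / 4 * psi s) rho
  (smoothM sc spsi) (fun s sr => eq_trans (congr1 _ (psi0 s sr)) (mulr0 _)).
have [eta [se de eta0 etab]] := @smooth_tail (fun s => W s * u s) rho
  (smoothM sW su) (fun s sr => eq_trans (congr1 _ (u0 s sr)) (mulr0 _)).
exists eta; split => //.
- move=> s es.
  have d1 : derive1 eta = fun s => - (W s * u s).
    by apply/funext => t; rewrite derive1E; exact: derive_val.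
  have d2 : derive1 (derive1 eta) s = c * r s * W s * u s + r s / 4 * psi s.
    rewrite d1 derive1E; apply: derive_val.
    have hP : is_derive s (1 : R) (fun t => - (c * P t)) (- (c * r s)).
      by apply: is_deriveN; exact: (is_deriveZ c (dP s)).
    have hW : is_derive s (1 : R) W (W s * - (c * r s)).
      exact: (@is_derive1_comp _ expR _ s _ _ (is_derive_expR _) hP).
    have hWu := is_deriveN (is_deriveM hW (du s)).
    apply: is_derive_eq hWu _; rewrite /GRing.scale/=.
    rewrite (_ : W s * - (r s * w s / 4 * psi s) = - (W s * w s * (r s / 4 * psi s))); last by ring.
    by rewrite wW; ring.
  rewrite d2 d1; have := rE s es; rewrite /c => rs1.
  rewrite (_ : 4 * s * _ = (r s * s) * (2 * n%:R * (W s * u s) + psi s)); last by field.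
  by rewrite rs1; ring.
move=> b m psib s s0r.
have -> : K2 * K1 * b * ((rho - s) ^+ m.+2 / m.+2`!%:R) = (K2 * (K1 * b)) * ((rho - s) ^+ m.+2 / m.+2`!%:R).
  by rewrite !mulrA.
apply: etab => // t t0r; rewrite normrM -[leRHS]mulrA ler_pM ?K2P//.
apply: ub => // q q0r; rewrite normrM -[leRHS]mulrA ler_pM ?K1P//.
exact: psib.
Qed.

End radial_ode.

(** * Radial test functions and their Laplacian *)

Section radial_polynomials.
Context (R : realType) (n : nat).
Implicit Types (x y : 'rV[R]_n) (F G : 'rV[R]_n -> R) (f : R -> R).

(** The norm of ['rV[R]_n] is the maximum norm; radial functions for the Laplacian need the
    Euclidean distance, squared to be smooth at the centre. *)
Definition sqdist x y : R := \sum_(i < n) (y ord0 i - x ord0 i) ^+ 2.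

(** The derivative of a radial function is a coordinate factor times a radial function: this class
    is stable under partial derivatives, whence smoothness to all orders. *)
Inductive rpoly x : ('rV[R]_n -> R) -> Prop :=
| rpoly_radial f : smooth f -> rpoly x (fun y => f (sqdist x y))
| rpoly_coord i F : rpoly x F -> rpoly x (fun y => y ord0 i * F y)
| rpoly_add F G : rpoly x F -> rpoly x G -> rpoly x (fun y => F y + G y).

Lemma sqdist_ge0 x y : 0 <= sqdist x y.
Proof. by apply: sumr_ge0 => i _; exact: sqr_ge0. Qed.

Lemma sqdistC x y : sqdist x y = sqdist y x.
Proof. by apply: eq_bigr => j _; rewrite -sqrrN opprB. Qed.

Lemma coord_continuous_rV (i : 'I_n) : continuous (fun y : 'rV[R]_n => y ord0 i).
Proof. exact: coord_continuous. Qed.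

Lemma continuous_sumr (T : topologicalType) m (F : 'I_m -> T -> R) :
  (forall i : 'I_m, continuous (F i)) -> continuous (fun t => \sum_(i < m) F i t).
Proof.
elim: m F => [|m IH] F cF t.
  rewrite (_ : (fun t => _) = fun=> 0); first exact: cvg_cst.
  by apply/funext => u; rewrite big_ord0.
rewrite (_ : (fun t => _) = fun t => \sum_(i < m) F (widen_ord (leqnSn m) i) t + F ord_max t).
  by apply: cvgD; [exact: IH | exact: cF].
by apply/funext => u; rewrite big_ord_recr.
Qed.

Lemma sqdist_continuous x : continuous (sqdist x).
Proof.
apply: continuous_sumr => i y.
have c : (fun z : 'rV[R]_n => z ord0 i - x ord0 i) @ y --> y ord0 i - x ord0 i.
  exact: (cvgB (@coord_continuous_rV i y) (cvg_cst (x ord0 i))).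
have -> : (fun z : 'rV[R]_n => (z ord0 i - x ord0 i) ^+ 2) =
    (fun z : 'rV[R]_n => (z ord0 i - x ord0 i) * (z ord0 i - x ord0 i)).
  by apply/funext => z; rewrite expr2.
exact: (cvgM c c).
Qed.

Lemma rpoly_continuous x F : rpoly x F -> continuous F.
Proof.
elim=> [f sf|i G _ IH|G H _ IG _ IH] y.
- apply: (@continuous_comp _ _ _ (sqdist x) f); first exact: sqdist_continuous.
  exact: smooth_continuous.
- exact: (cvgM (@coord_continuous_rV i y) (IH y)).
- exact: (cvgD (IG y) (IH y)).
Qed.

Lemma rpolyZ x (c : R) F : rpoly x F -> rpoly x (fun y => c * F y).
Proof.
elim=> [f sf|i G _ IH|G H _ IG _ IH].
- exact: (rpoly_radial x (smoothZ c sf)).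
- rewrite (_ : (fun y => _) = (fun y => y ord0 i * (c * G y))); first exact: rpoly_coord.
  by apply/funext => y; rewrite mulrCA.
- rewrite (_ : (fun y => _) = (fun y => c * G y + c * H y)); first exact: rpoly_add.
  by apply/funext => y; rewrite mulrDr.
Qed.

Lemma is_derive_line F y v (d : R) :
  is_derive (0 : R) (1 : R) (fun t : R => F (t *: v + y)) d -> is_derive y v F d.
Proof.
move=> [dF <-].
have E : (fun h : R => h^-1 *: (F (h *: v + y) - F y)) =
    (fun h : R => h^-1 *: (F ((h *: (1 : R) + 0) *: v + y) - F (0 *: v + y))).
  by apply/funext => h; rewrite addr0 [_ *: (1 : R)]mulr1 scale0r add0r.
apply: DeriveDef.
  by move: dF; rewrite /derivable -E.
by rewrite /derive -E.
Qed.

Lemma is_derive_affine (a b t : R) : is_derive t (1 : R) (fun s : R => a * s + b) a.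
Proof.
have h : is_derive t (1 : R) (fun s : R => a * s + b) (a *: 1 + 0).
  by apply: is_deriveD; apply: is_deriveZ.
by move: h; rewrite addr0 /GRing.scale/= mulr1.
Qed.

Lemma sqdist_line x y (i : 'I_n) (t : R) : sqdist x (t *: delta_mx ord0 i + y) =
  sqdist x y + 2 * t * (y ord0 i - x ord0 i) + t * t.
Proof.
rewrite /sqdist (bigD1 i)//= [in RHS](bigD1 i)//= !mxE !eqxx/= mulr1.
have -> : \sum_(j < n | j != i) ((t *: delta_mx ord0 i + y) ord0 j - x ord0 j) ^+ 2 =
    \sum_(j < n | j != i) (y ord0 j - x ord0 j) ^+ 2 :> R.
  by apply: eq_bigr => j ji; rewrite !mxE (negPf ji) andbF mulr0 add0r.
by ring.
Qed.

Lemma is_derive_radial x y (i : 'I_n) f : smooth f ->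
  is_derive y (delta_mx ord0 i) (fun y => f (sqdist x y))
    (2 * (y ord0 i - x ord0 i) * (derive1 f) (sqdist x y)).
Proof.
move=> sf; apply: is_derive_line.
under eq_fun do rewrite sqdist_line.
pose p (t : R) := (2 * (y ord0 i - x ord0 i)) * t + sqdist x y + t * t.
have hp : is_derive (0 : R) (1 : R) p (2 * (y ord0 i - x ord0 i)).
  have h := is_deriveD (is_derive_affine (2 * (y ord0 i - x ord0 i)) (sqdist x y) 0)
    (is_deriveM (is_derive_id (0 : R) (1 : R)) (is_derive_id (0 : R) (1 : R))).
  by apply: is_derive_eq h _; rewrite scale0r !addr0.
have p0 : p 0 = sqdist x y by rewrite /p !mulr0 add0r addr0.
rewrite (_ : (fun t => _) = f \o p); last by apply/funext => t; rewrite /p/=; congr f; ring.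
have := @is_derive1_comp _ f p 0 ((derive1 f) (p 0)) _ (smooth_is_derive _ sf) hp.
by rewrite p0 [X in is_derive _ _ _ X]mulrC.
Qed.

Lemma rpoly_derive x F (i : 'I_n) : rpoly x F ->
  exists2 G, rpoly x G & forall y, is_derive y (delta_mx ord0 i) F (G y).
Proof.
elim=> [f sf|j F0 rF [G rG dG]|F0 G0 _ [F1 rF1 dF1] _ [G1 rG1 dG1]].
- exists (fun y => y ord0 i * (2 * (derive1 f) (sqdist x y)) + (- 2 * x ord0 i) * (derive1 f) (sqdist x y)).
    apply: rpoly_add.
      by apply/rpoly_coord/rpolyZ; apply: rpoly_radial; exact: smooth_derive1.
    by apply: rpolyZ; apply: rpoly_radial; exact: smooth_derive1.
  by move=> y; apply: is_derive_eq (is_derive_radial x y i sf) _; ring.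
- exists (fun y => (i == j)%:R * F0 y + y ord0 j * G y).
    by apply: rpoly_add; [exact: rpolyZ | exact: rpoly_coord].
  move=> y.
  have hc : is_derive y (delta_mx ord0 i) (fun z : 'rV[R]_n => z ord0 j) (i == j)%:R.
    apply: is_derive_line.
    rewrite (_ : (fun t => _) = (fun t => (i == j)%:R * t + y ord0 j)); first exact: is_derive_affine.
    by apply/funext => t; rewrite !mxE eqxx/= mulrC eq_sym.
  by apply: is_derive_eq (is_deriveM hc (dG y)) _; rewrite /GRing.scale/= addrC mulrC.
- exists (fun y => F1 y + G1 y); first exact: rpoly_add.
  by move=> y; exact: is_deriveD.
Qed.

Lemma rpoly_partial x F (i : 'I_n) : rpoly x F -> rpoly x (partial i F).
Proof.
move=> /(rpoly_derive i)[G rG dG]; rewrite (_ : partial i F = G)//.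
by apply/funext => y; exact: derive_val.
Qed.

Lemma rpoly_smooth x F : rpoly x F -> smooth_on setT F.
Proof.
move=> rF s y _.
have rs : rpoly x (partials s F).
  by elim: s => [//|i s IH] /=; exact: rpoly_partial.
split; first exact: (rpoly_continuous rs).
by move=> i; have [G _ dG] := rpoly_derive i rs; exact: ex_derive.
Qed.

Lemma coord_le_sqdist x y (i : 'I_n) : (y ord0 i - x ord0 i) ^+ 2 <= sqdist x y.
Proof.
rewrite /sqdist (bigD1 i)//= lerDl; apply: sumr_ge0 => j _; exact: sqr_ge0.
Qed.

Lemma rpoly_test_function (U : set 'rV[R]_n) x F (rho : R) : rpoly x F ->
  (forall y, rho <= sqdist x y -> F y = 0) ->
  (forall y, sqdist x y <= rho -> U y) -> test_function U F.
Proof.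
move=> rF F0 qU.
have cl : closed [set y | sqdist x y <= rho].
  apply: (@closed_comp _ _ (sqdist x) [set s | s <= rho]); last exact: closed_le.
  by move=> y _; exact: sqdist_continuous.
have sub : closure [set y | F y != 0] `<=` [set y | sqdist x y <= rho].
  rewrite [X in _ `<=` X](iffLR (closure_id _) cl); apply: closure_subset => y /=.
  by apply: contra_neqT; rewrite -ltNge => /ltW; exact: F0.
split; first exact: rpoly_smooth rF.
  apply: (subclosed_compact _ _ sub); first exact: closed_closure.
  apply: bounded_closed_compact => //.
  exists (`|x| + (`|rho| + 1)); split; first exact: num_real.
  move=> M MB y /= qy; apply: le_trans (ltW MB).
  rewrite -[y](subrK x) addrC (le_trans (ler_normD _ _))// lerD2l.
  rewrite [leLHS]/Num.norm/= mx_normrE; apply/bigmax_leP; split; first by rewrite addr_ge0.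
  move=> [i j] _ /=; rewrite (ord1 i) !mxE.
  have := coord_le_sqdist x y j; set c := _ - _ => cq.
  have cr : c ^+ 2 <= `|rho| by rewrite (le_trans cq)// (le_trans qy)// ler_norm.
  rewrite -(@ler_pXn2r _ 2)// ?nnegrE ?addr_ge0// real_normK ?num_real//.
  by rewrite (le_trans cr)// sqrrD expr1n mulr1; have := normr_ge0 rho; nra.
by move=> y /sub; exact: qU.
Qed.

Lemma laplace_radial x f y : smooth f -> laplace (fun y => f (sqdist x y)) y =
  4 * sqdist x y * (derive1 (derive1 f)) (sqdist x y) + 2 * n%:R * (derive1 f) (sqdist x y).
Proof.
move=> sf; rewrite /laplace.
have p1 i : partial i (fun y => f (sqdist x y)) =
    (fun y => 2 * (y ord0 i - x ord0 i) * (derive1 f) (sqdist x y)).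
  by apply/funext => z; apply: derive_val; exact: is_derive_radial.
have p2 i : partial i (partial i (fun y => f (sqdist x y))) y =
    2 * (derive1 f) (sqdist x y) + 4 * (y ord0 i - x ord0 i) ^+ 2 * (derive1 (derive1 f)) (sqdist x y).
  rewrite p1; apply: derive_val.
  have hc : is_derive y (delta_mx ord0 i) (fun z : 'rV[R]_n => 2 * (z ord0 i - x ord0 i)) 2.
    apply: is_derive_line.
    rewrite (_ : (fun t => _) = (fun t => 2 * t + 2 * (y ord0 i - x ord0 i))).
      exact: is_derive_affine.
    by apply/funext => t; rewrite !mxE !eqxx/=; ring.
  have := is_deriveM hc (is_derive_radial x y i (smooth_derive1 sf)).
  by move=> h; apply: is_derive_eq h _; rewrite /GRing.scale/=; ring.
under eq_bigr do rewrite p2.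
rewrite big_split/= sumr_const card_ord -mulr_suml -mulr_sumr -/(sqdist x y).
by rewrite -mulr_natr; ring.
Qed.

End radial_polynomials.

(** * Vanishing of pairings with radial functions *)

Section local_vanishing.
Context (R : realType) (n : nat) (Omega : set 'rV[R]_n) (oOmega : open Omega).
Local Notation mu := (lebesgue_on oOmega).
Context (a : nat -> L2 oOmega) (M C : R).
Hypothesis fin : (mu setT < +oo)%E.
Hypothesis chain : forall k phi, test_function Omega phi ->
  \int[mu]_x (a k.+1 x * phi x) = \int[mu]_x (a k x * laplace phi x).
Hypothesis growth : forall k, `|a k| <= M * C ^+ k * k`!%:R.

Lemma Rintegral_mul_le k (c : R) (phi : 'rV[R]_n -> R) : measurable_fun setT phi ->
  (forall y, `|phi y| <= c) ->
  `|\int[mu]_y (a k y * phi y)| <= `|a k| * (c * Num.sqrt (fine (mu setT))).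
Proof.
move=> mphi phic; have [Phi PhiE Phile] := bounded_L2 fin mphi phic.
rewrite (L2_ip_ae (a k) mphi PhiE) (le_trans (ip_abs (L2_ipP mu) _ _))//.
by rewrite ler_wpM2l.
Qed.

Lemma bin_le_exp2 N j : ('C(N, j) <= 2 ^ N)%N.
Proof.
elim: N j => [|N IH] [|j]//; first by rewrite bin0 expn_gt0.
by rewrite binS expnS mul2n -addnn leq_add.
Qed.

Lemma leq_fact_double k m : ((m + k)`! <= 2 ^ (m + k) * (m`! * k`!))%N.
Proof.
have h := @bin_fact (m + k) m (leq_addr _ _); rewrite addKn in h.
by by rewrite -h leq_mul2r bin_le_exp2 orbT.
Qed.

Lemma laplace_chain_vanish x (e rho : R) : 0 < e -> 0 < rho ->
  (forall k, \forall y \ae mu, sqdist x y < e -> a k y = 0) ->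
  (forall y, sqdist x y <= rho -> Omega y) ->
  forall m psi, smooth psi -> (forall s, rho <= s -> psi s = 0) ->
  \int[mu]_y (a m y * psi (sqdist x y)) = 0.
Proof.
move=> e0 rho0 az qO m psi spsi psi0.
have [K K0 ode] := radial_ode n rho e0.
have [b b0 bP] := @continuous_bounded_itv R psi 0 rho (smooth_continuous spsi).
have mq : measurable_fun setT (sqdist x) by apply: continuous_measurable_rV; exact: sqdist_continuous.
have mr f : smooth f -> measurable_fun setT (fun y => f (sqdist x y)).
  by move=> sf; exact: (continuous_measurable_rV (rpoly_continuous (rpoly_radial x sf))).
have iter k : exists eta, [/\ smooth eta, (forall s, rho <= s -> eta s = 0),
    (forall s, 0 <= s <= rho -> `|eta s| <= K ^+ k * b * ((rho - s) ^+ (k.*2) / (k.*2)`!%:R)) &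
    \int[mu]_y (a m y * psi (sqdist x y)) = \int[mu]_y (a (m + k)%N y * eta (sqdist x y))].
  elim: k => [|k [eta [seta eta0 etab ->]]].
    exists psi; split => //; last by rewrite addn0.
    by move=> s /bP; rewrite expr0 mul1r mul1r invr1 mulr1.
  have [th [sth th0 thE thb]] := ode eta seta eta0.
  exists th; split => //.
    move=> s sr; rewrite doubleS exprS -(mulrA K).
    exact: (thb _ _ etab).
  rewrite addnS chain; last first.
    apply: (rpoly_test_function (rho := rho) (rpoly_radial x sth)) => //.
    by move=> y; exact: th0.
  apply: ae_eq_Rintegral.
  - by apply: measurable_funM; [exact: L2_measurable | exact: mr].
  - apply: measurable_funM; first exact: L2_measurable.
    rewrite (_ : laplace _ = fun y => 4 * sqdist x y * (derive1 (derive1 th)) (sqdist x y) +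
        2 * n%:R * (derive1 th) (sqdist x y)); last by apply/funext => y; exact: laplace_radial.
    have s1 := smooth_derive1 sth; have s2 := smooth_derive1 s1.
    apply: measurable_funD; apply: measurable_funM => //; try exact: mr.
    exact: measurable_funM.
  - apply: filterS (az (m + k)%N) => y ay.
    (* Below [e] the radial equation may fail, but there [a (m + k)] vanishes. *)
    have [qe|qe] := ltP (sqdist x y) e; first by rewrite ay// !mul0r.
    by rewrite laplace_radial// thE.
set I := \int[mu]_y _ in iter *.
(* [D] collects the factors free of k. With (m + k)! <= 2^(m+k) m! k! and (k!)^2 <= (2 k)!, what
   remains is X^k / k! for X = 2 |C| K rho^2. *)
pose D := `|M| * (2 * `|C|) ^+ m * m`!%:R * b * Num.sqrt (fine (mu setT)).
have bound k : `|I| <= D * exp_coeff (2 * `|C| * K * rho ^+ 2) k.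
  have [eta [seta eta0 etab ->]] := iter k.
  have etaq y : `|eta (sqdist x y)| <= K ^+ k * b * (rho ^+ (k.*2) / (k.*2)`!%:R).
    have [qr|qr] := leP rho (sqdist x y).
      rewrite eta0// normr0 mulr_ge0// ?mulr_ge0 ?exprn_ge0 ?divr_ge0 ?exprn_ge0//; exact: ltW.
    apply: le_trans (etab _ _) _; first by rewrite sqdist_ge0 ltW.
    rewrite ler_wpM2l ?mulr_ge0 ?exprn_ge0 ?(ltW b0)// ler_wpM2r ?invr_ge0//.
    by rewrite lerXn2r ?nnegrE ?subr_ge0 ?(ltW qr) ?(ltW rho0)// gerBl sqdist_ge0.
  apply: le_trans (Rintegral_mul_le _ (mr _ seta) etaq) _.
  have ga : `|a (m + k)%N| <= `|M| * `|C| ^+ (m + k) * (2 ^+ (m + k) * (m`!%:R * k`!%:R)).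
    apply: le_trans (growth _) _.
    apply: (@le_trans _ _ (`|M| * `|C| ^+ (m + k) * (m + k)`!%:R)).
      by rewrite ler_wpM2r// -normrX -normrM ler_norm.
    rewrite ler_wpM2l ?mulr_ge0 ?exprn_ge0// -natrX -!natrM ler_nat.
    exact: leq_fact_double.
  apply: le_trans (ler_wpM2r _ ga) _.
    rewrite !mulr_ge0 ?sqrtr_ge0 ?exprn_ge0 ?invr_ge0 ?(ltW b0) ?(ltW rho0)//.
  have f2 : ((k.*2)`!%:R : R)^-1 <= k`!%:R^-1 * k`!%:R^-1.
    rewrite -invfM -natrM lef_pV2 ?posrE ?ltr0n ?muln_gt0 ?fact_gt0// ler_nat.
    have h := @bin_fact (k + k) k (leq_addr _ _); rewrite addKn in h.
    rewrite -addnn -h leq_pmull// bin_gt0 leq_addr //.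
  rewrite /D /exp_coeff/= !exprMn -[rho ^+ k * rho ^+ k]exprD addnn !exprD.
  set A := k`!%:R; set F := (k.*2)`!%:R in f2 *; set G := m`!%:R.
  have A0 : A != 0 by rewrite pnatr_eq0 -lt0n fact_gt0.
  set P := `|M| * (2 ^+ m * `|C| ^+ m) * G * b * Num.sqrt (fine (mu setT)) *
    (2 ^+ k * `|C| ^+ k * K ^+ k * rho ^+ k.*2).
  have P0 : 0 <= P.
    by rewrite /P !mulr_ge0 ?exprn_ge0 ?sqrtr_ge0 ?(ltW b0) ?(ltW rho0) ?mulr_ge0 ?exprn_ge0.
  rewrite [leLHS](_ : _ = P * (A * F^-1)); last by rewrite /P; ring.
  rewrite [leRHS](_ : _ = P * A^-1); last by rewrite /P; ring.
  rewrite ler_wpM2l// (le_trans (ler_wpM2l _ f2))// mulrA divff// mul1r//.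
have I0 : `|I| <= 0.
  have c : D * exp_coeff (2 * `|C| * K * rho ^+ 2) k @[k --> \oo] --> (0 : R).
    rewrite -[X in _ --> X](mulr0 D); apply: cvgM; first exact: cvg_cst.
    exact: cvg_exp_coeff.
  rewrite -(cvg_lim _ c)//; apply: limr_ge; first by apply/cvg_ex; exists 0.
  by apply: nearW => k; exact: bound.
by apply/eqP; rewrite -normr_le0.
Qed.

End local_vanishing.

(** * Integrable functions are determined by orthants *)

Section orthants.
Context (R : realType).

Lemma integrable_mul_bounded d (T : measurableType d) (mu : {measure set T -> \bar R})
    (f h : T -> R) (c : R) : mu.-integrable setT (EFin \o f) -> measurable_fun setT h ->
  (forall x, `|h x| <= c) -> mu.-integrable setT (EFin \o (fun x => f x * h x)).
Proof.
move=> intf mh hc; apply: (@integrableMl _ _ _ mu setT measurableT (EFin \o f) h) => //.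
exists c; split; first exact: num_real.
by move=> M cM x _ /=; exact: le_trans (hc x) (ltW cM).
Qed.

(** Dominated convergence with conditions on [g_] only where [f] is nonzero: the polynomials used
    later are bounded on the support of [f] but not globally. *)
Lemma Rintegral_mul_cvg0 d (T : measurableType d) (mu : {measure set T -> \bar R})
    (f : T -> R) (g_ : nat -> T -> R) (g : T -> R) :
  mu.-integrable setT (EFin \o f) -> (forall k, measurable_fun setT (g_ k)) ->
  (forall k x, f x != 0 -> `|g_ k x| <= 1) ->
  (forall x, f x != 0 -> g_ k x @[k --> \oo] --> g x) ->
  (forall k, \int[mu]_x (f x * g_ k x) = 0) -> \int[mu]_x (f x * g x) = 0.
Proof.
move=> intf mg g1 gg int0.
have mf : measurable_fun setT f by apply/measurable_EFinP; case/integrableP: intf.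
have le_f k x : `|f x * g_ k x| <= `|f x|.
  have [->|fx] := eqVneq (f x) 0; first by rewrite mul0r.
  by rewrite normrM ler_piMr// g1.
have dct := @dominated_cvg _ _ _ mu setT measurableT (fun k x => (f x * g_ k x)%:E)
  (fun x => (f x * g x)%:E) (fun x => `|f x|%:E).
have h : (\int[mu]_x (f x * g_ k x)%:E)%E @[k --> \oo] --> (\int[mu]_x (f x * g x)%:E)%E.
  apply: dct => //.
  - by move=> k; apply/measurable_EFinP; exact: measurable_funM.
  - move=> x _; apply: cvg_EFin; first exact: nearW.
    have [->|fx] := eqVneq (f x) 0.
      by under eq_fun do rewrite mul0r; rewrite mul0r; exact: cvg_cst.
    by apply: cvgM; [exact: cvg_cst | exact: gg].
  - exact: integrable_norm intf.
  - by move=> k x _; rewrite lee_fin; exact: le_f.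
have E : (fun k => \int[mu]_x (f x * g_ k x)%:E)%E = fun=> 0%E.
  apply/funext => k; rewrite -[LHS]fineK; first by congr EFin; exact: int0.
  apply: integrable_fin_num => //; apply: le_integrable intf => //.
    by apply/measurable_EFinP; exact: measurable_funM.
  by move=> x _; rewrite lee_fin; exact: le_f.
move: h; rewrite E => h; rewrite /Rintegral -(cvg_lim _ h)//; have -> := cvg_lim _ (@cvg_cst _ (0%E : \bar R) _ \oo _).
  by [].
exact: ereal_hausdorff.
Qed.

Context (n : nat).

Definition lower_orthant (c : 'rV[R]_n) := [set y : 'rV[R]_n | forall i, y ord0 i < c ord0 i].

Lemma measurable_lower_orthant c : measurable (lower_orthant c).
Proof.
rewrite (_ : lower_orthant c = \bigcap_(i in [set: 'I_n])
    ((fun v : 'rV[R]_n => v ord0 i) @^-1` [set` `]-oo, c ord0 i[])).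
  apply: fin_bigcap_measurable; first exact: finite_finset.
  move=> i _; rewrite -[X in measurable X]setTI.
  exact: measurable_coord.
apply/seteqP; split => y /= h i //; first by move=> _ /=; rewrite in_itv/=; exact: h.
by have := h i I; rewrite /= in_itv.
Qed.

Lemma setI_closed_lower_orthant : setI_closed (range lower_orthant).
Proof.
move=> _ _ [c _ <-] [d _ <-]; exists (\row_i Num.min (c ord0 i) (d ord0 i)) => //.
apply/seteqP; split => y /=.
  move=> h; split => i; have := h i; rewrite mxE lt_min => /andP[]//.
by move=> [hc hd] i; rewrite mxE lt_min hc hd.
Qed.

Lemma lower_orthants_generate : measurable `<=` <<s range lower_orthant >>.
Proof.
have halfspace (i : 'I_n) (b : R) :
    <<s range lower_orthant >> [set y : 'rV[R]_n | y ord0 i < b].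
  (* Bounding the other coordinates by k exhausts the half-space as k grows. *)
  rewrite (_ : mkset _ = \bigcup_k lower_orthant (\row_j (if j == i then b else k%:R))).
    apply: sigma_algebra_bigcup => k; apply: sub_sigma_algebra.
    by eexists; last reflexivity.
  apply/seteqP; split => y /=.
    move=> yb; exists (Num.truncn (\sum_(j < n) `|y ord0 j|)).+1 => // j.
    rewrite mxE; case: eqP => [->//|_].
    apply: le_lt_trans (truncnS_gt _).
    by rewrite (le_trans (ler_norm _))// (bigD1 j)//= lerDl sumr_ge0.
  by move=> [k _ /(_ i)]; rewrite mxE eqxx.
apply: smallest_sub; first exact: smallest_sigma_algebra.
move=> A; rewrite -bigcup_seq => -[i _] [B mB <-]; rewrite setTI.
suff mi : @measurable_fun _ _ (g_sigma_algebraType (range lower_orthant)) R setT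
    (fun y : 'rV[R]_n => y ord0 i).
  by have := mi measurableT B mB; rewrite setTI.
apply: (measurability (@RGenInftyO.G R)); first exact: RGenInftyO.measurableE.
move=> _ [_ [b ->] <-]; rewrite setTI.
by have := halfspace i b; congr (<<s _ >> _); apply/seteqP; split => y /=; rewrite in_itv.
Qed.

(** Dynkin's argument: the sets over which [f] integrates to 0 form a lambda-system, with [int0]
    providing the whole space, and orthants are a generating pi-system. *)
Lemma lower_orthants_separate (mu : {measure set 'rV[R]_n -> \bar R}) (f : 'rV[R]_n -> R) :
  mu.-integrable setT (EFin \o f) -> \int[mu]_y f y = 0 ->
  (forall c, \int[mu]_y (f y * \1_(lower_orthant c) y) = 0) ->
  \forall y \ae mu, f y = 0.
Proof.
move=> intf int0 orth0.
pose H := [set A : set 'rV[R]_n | measurable A /\ \int[mu]_y (f y * \1_A y) = 0].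
have intA (A : set 'rV[R]_n) : measurable A ->
    mu.-integrable setT (EFin \o (fun y => f y * \1_A y)).
  move=> mA; apply: (@integrable_mul_bounded _ _ mu f (\1_A) 1 intf); first exact: measurable_indic.
  by move=> y; rewrite indicE; case: (_ \in _); rewrite ?normr1 ?normr0.
have lH : lambda_system setT H.
  split.
  - by [].
  - split; first exact: measurableT.
    by rewrite -[RHS]int0; apply: eq_Rintegral => y _; rewrite indicT mulr1.
  - move=> A B BA [mA A0] [mB B0]; split; first exact: measurableD.
    rewrite -[RHS](subrr 0) -[in X in _ = X - _]A0 -B0 -RintegralB//; try exact: intA.
    apply: eq_Rintegral => y _; rewrite -mulrBr; congr (_ * _).
    rewrite !indicE in_setD; have : y \in B -> y \in A by rewrite !inE; exact: BA.
    by case: (y \in B); case: (y \in A) => //= h; rewrite ?subrr ?subr0//; have := h isT.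
  - move=> F ndF HF; have mF : measurable (\bigcup_i F i).
      by apply: bigcupT_measurable => i; have [] := HF i.
    split => //; apply: (@Rintegral_mul_cvg0 _ _ mu f (fun k => \1_(F k))) => //.
    + by move=> k; apply: measurable_indic; have [] := HF k.
    + by move=> k x _; rewrite indicE; case: (_ \in _); rewrite ?normr1 ?normr0.
    + move=> x _; rewrite !indicE; case: (boolP (x \in _)) => [|xF].
        rewrite inE => -[k _ Fkx]; apply: cvg_near_cst; exists k => // m /= km.
        by rewrite indicE mem_set//; have /subsetPset := ndF _ _ km; exact.
      apply: cvg_near_cst; apply: nearW => k; rewrite indicE memNset// => Fx.
      by move/negP: xF; apply; rewrite inE; exists k.
    + by move=> k; have [] := HF k.
have HA A : measurable A -> H A.
  move=> mA; apply: (lambda_system_subset setI_closed_lower_orthant lH) => //.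
    by move=> _ [c _ <-]; split; [exact: measurable_lower_orthant | exact: orth0].
  exact: lower_orthants_generate.
have /integral_ae_eq : mu.-integrable setT (EFin \o f) by [].
move=> /(_ measurableT (cst 0%E)); case => //.
- move=> E _ mE; rewrite integral0 integral_mkcond.
  have [_] := HA E mE; rewrite /Rintegral => E0.
  rewrite -[RHS]/(0 : R)%:E -[X in _ = X%:E]E0 fineK; last exact: integrable_fin_num (intA _ mE).
  apply: eq_integral => y _; rewrite epatch_indic /=; exact: esym (EFinM _ _).
- by move=> N [mN N0 sub]; exists N; split => // y fy; apply: sub => /= h; apply: fy; case: (h I).
Qed.

End orthants.

(** * From radial functions to their polynomial multiples *)

Section moments.
Context (R : realType) (n : nat) (mu : {measure set 'rV[R]_n -> \bar R}).
Implicit Types (P Q : 'rV[R]_n -> R).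

Inductive polyfun : ('rV[R]_n -> R) -> Prop :=
| polyfun_cst c : polyfun (fun=> c)
| polyfun_coord i : polyfun (fun y => y ord0 i)
| polyfun_add P Q : polyfun P -> polyfun Q -> polyfun (fun y => P y + Q y)
| polyfun_mul P Q : polyfun P -> polyfun Q -> polyfun (fun y => P y * Q y).

Lemma polyfun_exp P m : polyfun P -> polyfun (fun y => P y ^+ m).
Proof.
move=> pP; elim: m => [|m IH]; first exact: polyfun_cst.
rewrite (_ : (fun y => _) = fun y => P y * P y ^+ m); first exact: polyfun_mul.
by apply/funext => y; rewrite exprS.
Qed.

Lemma polyfun_prod m (F : 'I_m -> 'rV[R]_n -> R) : (forall i, polyfun (F i)) ->
  polyfun (fun y => \prod_(i < m) F i y).
Proof.
elim: m F => [|m IH] F pF.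
  rewrite (_ : (fun y => _) = fun=> 1); first exact: polyfun_cst.
  by apply/funext => y; rewrite big_ord0.
rewrite (_ : (fun y => _) = fun y => \prod_(i < m) F (widen_ord (leqnSn m) i) y * F ord_max y).
  by apply: polyfun_mul => //; exact: IH.
by apply/funext => y; rewrite big_ord_recr.
Qed.

Definition box_bounded P := forall L : R, exists c : R,
  forall y : 'rV[R]_n, (forall i, `|y ord0 i| <= L) -> `|P y| <= c.

Lemma polyfun_measurable P : polyfun P -> measurable_fun setT P.
Proof.
elim=> [c|i|Q S _ mQ _ mS|Q S _ mQ _ mS]; first exact: measurable_cst.
- exact: measurable_coord.
- exact: measurable_funD.
- exact: measurable_funM.
Qed.

Lemma box_boundedM P Q : box_bounded P -> box_bounded Q -> box_bounded (fun y => P y * Q y).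
Proof.
move=> bP bQ L; have [c cP] := bP L; have [d dQ] := bQ L.
by exists (c * d) => y yL; rewrite normrM ler_pM ?cP ?dQ.
Qed.

Lemma polyfun_box_bounded P : polyfun P -> box_bounded P.
Proof.
elim=> [c|i|Q S _ bQ _ bS|Q S _ bQ _ bS]; last exact: box_boundedM.
- by move=> L; exists `|c|.
- by move=> L; exists L.
- move=> L; have [c cQ] := bQ L; have [d dS] := bS L.
  by exists (c + d) => y yL; rewrite (le_trans (ler_normD _ _))// lerD ?cQ ?dS.
Qed.

Context (a : 'rV[R]_n -> R) (W : set 'rV[R]_n) (rho : R).
Hypothesis inta : mu.-integrable setT (EFin \o a).
Hypothesis oW : open W.
Hypothesis rho0 : 0 < rho.

(** One radius for all centres in an open set: differentiating in the centre requires neighbouring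
    centres. *)
Definition radially_orthogonal P := forall x psi, W x -> smooth psi ->
  (forall s, rho <= s -> psi s = 0) -> \int[mu]_y (a y * (P y * psi (sqdist x y))) = 0.

(** Uniform over centres in a box, as a dominating function must be. On the support of psi
    coordinates differ from those of [x] by at most 1 + rho, since rho <= (1 + rho)^2. *)
Lemma radial_bounded P psi (r : R) : box_bounded P -> smooth psi ->
  (forall s, rho <= s -> psi s = 0) ->
  exists2 c : R, 0 <= c & forall x y : 'rV[R]_n, (forall i, `|x ord0 i| <= r) -> `|P y * psi (sqdist x y)| <= c.
Proof.
move=> bP spsi psi0.
have [c cP] := bP (1 + rho + r).
have [b b0 bpsi] := @continuous_bounded_itv R psi 0 rho (smooth_continuous spsi).
exists (`|c| * b); first by rewrite mulr_ge0// ltW.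
move=> x y xr; have [qr|qr] := leP rho (sqdist x y).
  by rewrite psi0// mulr0 normr0 mulr_ge0// ltW.
rewrite normrM ler_pM//; last by apply: bpsi; rewrite sqdist_ge0 ltW.
apply: le_trans (ler_norm c); apply: cP => i.
rewrite -[y ord0 i](subrK (x ord0 i)) (le_trans (ler_normD _ _))// lerD//.
have := coord_le_sqdist x y i; set d := _ - _ => dq.
rewrite -(@ler_pXn2r _ 2)// ?nnegrE ?addr_ge0 ?(ltW rho0)//.
by rewrite real_normK ?num_real//; nra.
Qed.

Lemma sqdist_line_center x y (i : 'I_n) (t : R) : sqdist (t *: delta_mx ord0 i + x) y =
  (- 2 * (y ord0 i - x ord0 i)) * t + sqdist x y + t * t.
Proof. by rewrite sqdistC sqdist_line (sqdistC y); ring. Qed.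

(* Differentiating [\int a P theta(|y - x|^2) = 0] in the coordinate [x_i] of the
   centre, for [theta' = - psi], brings down the factor [y_i - x_i]. *)
Lemma radially_orthogonal_coord P (i : 'I_n) : measurable_fun setT P -> box_bounded P ->
  radially_orthogonal P -> radially_orthogonal (fun y => y ord0 i * P y).
Proof.
move=> mP bP oP x psi Wx spsi psi0.
have [th [sth dth th0 _]] := smooth_tail spsi psi0.
pose X (t : R) : 'rV[R]_n := t *: delta_mx ord0 i + x.
pose f (t : R) y := a y * (P y * th (sqdist (X t) y)).
pose f' (t : R) y := a y * (P y * (2 * (y ord0 i - x ord0 i - t) * psi (sqdist (X t) y))).
have df (t : R) y : is_derive t (1 : R) (f^~ y) (f' t y).
  have hp : is_derive t (1 : R) (fun t => sqdist (X t) y) (- 2 * (y ord0 i - x ord0 i - t)).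
    rewrite (_ : (fun t => _) = fun t =>
        (- 2 * (y ord0 i - x ord0 i)) * t + sqdist x y + t * t); last first.
      by apply/funext => s; exact: sqdist_line_center.
    have h := is_deriveD (is_derive_affine (- 2 * (y ord0 i - x ord0 i)) (sqdist x y) t)
      (is_deriveM (is_derive_id t (1 : R)) (is_derive_id t (1 : R))).
    by apply: is_derive_eq h _; rewrite /GRing.scale/=; ring.
  have h := @is_derive1_comp _ th (fun t => sqdist (X t) y) t _ _ (dth _) hp.
  have h2 := is_deriveZ (a y) (is_deriveZ (P y) h).
  by apply: is_derive_eq h2 _; rewrite /f' /GRing.scale/=; ring.
have mrad (t : R) g : smooth g -> measurable_fun setT (fun y => g (sqdist (X t) y)).
  by move=> sg; exact: (continuous_measurable_rV (rpoly_continuous (rpoly_radial (X t) sg))).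
have [d /andP[d0 d1] dW] : exists2 d : R, 0 < d <= 1 & forall t : R, `|t| < d -> W (X t).
  have : \forall t \near (0 : R), W (X t).
    have cX : X t @[t --> (0 : R)] --> x.
      have E : (0 : R) *: delta_mx ord0 i + x = x by rewrite scale0r add0r.
      rewrite -[X in _ --> X]E.
      by apply: cvgD; [apply: cvgZ; [exact: cvg_id | exact: cvg_cst] | exact: cvg_cst].
    by apply: cX; exact: open_nbhs_nbhs.
  move=> /nbhs_ballP[e /= e0 eW]; exists (Num.min e 1).
    by rewrite lt_min e0 ltr01 ge_min lexx orbT.
  move=> t; rewrite lt_min => /andP[te _]; apply: eW.
  by rewrite /ball/= sub0r normrN.
have Xr (t : R) j : `|t| < d -> `|X t ord0 j| <= 1 + \sum_(k < n) `|x ord0 k|.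
  move=> td; rewrite !mxE (le_trans (ler_normD _ _))// lerD//.
    rewrite normrM; apply: le_trans (_ : `|t| * 1 <= _); last by rewrite mulr1; lra.
    by rewrite ler_wpM2l//; case: (_ && _); rewrite ?normr1 ?normr0.
  by rewrite (bigD1 j)//= lerDl sumr_ge0.
set r := 1 + _ in Xr.
have bP' : box_bounded (fun y => (y ord0 i + - x ord0 i) * P y).
  by apply: box_boundedM => //; apply: polyfun_box_bounded; apply: polyfun_add;
    [exact: polyfun_coord | exact: polyfun_cst].
have [c1 c10 h1] := radial_bounded r bP sth th0.
have [c2 c20 h2] := radial_bounded r bP spsi psi0.
have [c3 c30 h3] := radial_bounded r bP' spsi psi0.
have I0 : `]-d, d[%classic (0 : R) by rewrite /= in_itv/= oppr_lt0 d0.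
have Itv (t : R) : `]-d, d[%classic t -> `|t| < d by rewrite /= in_itv/= ltr_norml.
have pE (t : R) y : partial1of2 f t y = f' t y by rewrite partial1of2E; exact: derive_val.
have intf (t : R) : `]-d, d[%classic t -> mu.-integrable setT (EFin \o f t).
  move=> /Itv td; apply: (integrable_mul_bounded inta (c := c1)).
    by apply: measurable_funM => //; exact: mrad.
  by move=> y; apply: h1 => j; exact: Xr.
have G0 y : 0 <= `|a y| * (2 * (c3 + c2)) by rewrite !mulr_ge0// addr_ge0.
have intG : mu.-integrable setT (EFin \o (fun y => `|a y| * (2 * (c3 + c2)))).
  have := integrableZl measurableT (2 * (c3 + c2)) (integrable_norm inta).
  by congr integrable; apply/funext => y /=; rewrite EFinM muleC.
have Gub (t : R) y : `]-d, d[%classic t -> setT y -> `|partial1of2 f t y| <= `|a y| * (2 * (c3 + c2)).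
  move=> /Itv td _; rewrite pE /f' normrM ler_wpM2l//.
  (* y_i - x_i - t is split into y_i - x_i, bounded through [c3], and t, where |t| <= 1 leaves
     [c2]. *)
  rewrite (_ : P y * _ = 2 * ((y ord0 i + - x ord0 i) * P y * psi (sqdist (X t) y) -
    t * (P y * psi (sqdist (X t) y)))); last by ring.
  rewrite normrM ger0_norm// ler_wpM2l// (le_trans (ler_normB _ _))// lerD//.
    by apply: h3 => j; exact: Xr.
  rewrite normrM -[leRHS]mul1r ler_pM//; first by rewrite (le_trans (ltW td)).
  by apply: h2 => j; exact: Xr.
have der (t : R) y : derivable (f^~ y) t (1 : R) by case: (df t y).
have := @differentiation_under_integral R _ _ mu f setT measurableT 0 (- d) d I0 intf
  (fun t y _ _ => der t y) (fun y => `|a y| * (2 * (c3 + c2))) G0 intG Gub.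
(* The integral is 0 for all centres [X t] with |t| < d, hence so is its derivative. *)
have -> : derive1 (fun t : R => \int[mu]_y f t y) 0 = 0.
  rewrite derive1E (@near_eq_derive _ _ _ _ (cst 0)) ?derive_cst//.
  exists d => // t /=; rewrite sub0r normrN => td.
  by apply: oP => //; exact: dW.
have -> : \int[mu]_y partial1of2 f 0 y =
    2 * (\int[mu]_y (a y * (y ord0 i * P y * psi (sqdist x y))) - x ord0 i * 0).
  rewrite -[X in _ - _ * X](oP x psi Wx spsi psi0).
  have X0 : X 0 = x by rewrite /X scale0r add0r.
  have xr j : `|x ord0 j| <= r by rewrite -X0; apply: Xr; rewrite normr0.
  have i1 : mu.-integrable setT (EFin \o (fun y => a y * (P y * psi (sqdist x y)))).
    apply: (integrable_mul_bounded inta (c := c2)).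
      by apply: measurable_funM => //; rewrite -X0; exact: mrad.
    by move=> y; exact: h2.
  have i2 : mu.-integrable setT (EFin \o (fun y => a y * ((y ord0 i + - x ord0 i) * P y * psi (sqdist x y)))).
    apply: (integrable_mul_bounded inta (c := c3)).
      apply: measurable_funM; last by rewrite -X0; exact: mrad.
      by apply: measurable_funM => //; apply: measurable_funD => //; exact: measurable_coord.
    by move=> y; exact: h3.
  transitivity (\int[mu]_y (2 * (a y * ((y ord0 i + - x ord0 i) * P y * psi (sqdist x y))))).
    by apply: eq_Rintegral => y _; rewrite pE /f' X0; ring.
  rewrite RintegralZl//; congr (2 * _); apply/eqP; rewrite eq_sym subr_eq eq_sym; apply/eqP.
  rewrite -RintegralZl// -RintegralD//; last first.
    by have := integrableZl measurableT (x ord0 i) i1; congr integrable; apply/funext => y /=; rewrite EFinM.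
  by apply: eq_Rintegral => y _; ring.
rewrite mulr0 subr0 => /esym/eqP.
by rewrite mulf_eq0 pnatr_eq0/= => /eqP.
Qed.

(** [P] is general in the induction so that the factors of a product are applied one after the
    other; a constant is absorbed into psi. *)
Lemma radially_orthogonal_polyfun Q : polyfun Q -> forall P, measurable_fun setT P ->
  box_bounded P -> radially_orthogonal P -> radially_orthogonal (fun y => Q y * P y).
Proof.
elim=> [c|i|Q1 Q2 p1 IH1 p2 IH2|Q1 Q2 p1 IH1 p2 IH2] P mP bP oP; last first.
- rewrite (_ : (fun y => _) = fun y => Q1 y * (Q2 y * P y)); last first.
    by apply/funext => y; rewrite mulrA.
  apply: IH1; last exact: IH2.
    by apply: measurable_funM => //; exact: polyfun_measurable.
  by apply: box_boundedM => //; exact: polyfun_box_bounded.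
- move=> x psi Wx spsi psi0.
  have intQ Q0 : polyfun Q0 -> mu.-integrable setT (EFin \o (fun y => a y * (Q0 y * P y * psi (sqdist x y)))).
    move=> pQ.
    have bQP : box_bounded (fun y => Q0 y * P y).
      by apply: box_boundedM => //; exact: polyfun_box_bounded.
    have [c c0 cP] := radial_bounded (\sum_(k < n) `|x ord0 k|) bQP spsi psi0.
    apply: (integrable_mul_bounded inta (c := c)).
      apply: measurable_funM.
        by apply: measurable_funM => //; exact: polyfun_measurable.
      exact: (continuous_measurable_rV (rpoly_continuous (rpoly_radial x spsi))).
    by move=> y; apply: cP => j; rewrite (bigD1 j)//= lerDl sumr_ge0.
  transitivity (\int[mu]_y (a y * (Q1 y * P y * psi (sqdist x y)) +
      a y * (Q2 y * P y * psi (sqdist x y)))).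
    by apply: eq_Rintegral => y _; ring.
  rewrite RintegralD//; [|exact: intQ|exact: intQ].
  by rewrite (IH1 P)// (IH2 P)// addr0.
- exact: radially_orthogonal_coord.
- move=> x psi Wx spsi psi0; rewrite -[RHS](oP x (fun s => c * psi s) Wx (smoothZ c spsi)).
    by apply: eq_Rintegral => y _; ring.
  by move=> s /psi0 ->; rewrite mulr0.
Qed.

End moments.

(** * Polynomials converging to a step function *)

Section polynomial_steps.
Context (R : realType).

Lemma bernoulli_le (x : R) N : 0 <= x -> 1 + N%:R * x <= (1 + x) ^+ N.
Proof.
move=> x0; elim: N => [|N IH]; first by rewrite mul0r addr0 expr0.
rewrite exprS -natr1; have : (0 : R) <= N%:R by [].
by move: IH; set u := (1 + x) ^+ N; nra.
Qed.

Lemma bernoulli_ge (x : R) N : 0 <= x <= 1 -> 1 - N%:R * x <= (1 - x) ^+ N.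
Proof.
move=> /andP[x0 x1]; elim: N => [|N IH]; first by rewrite mul0r subr0 expr0.
rewrite exprS -natr1; have : (0 : R) <= N%:R by [].
move: IH; set u := (1 - x) ^+ N => IH N0.
have : (1 - x) * (1 - N%:R * x) <= (1 - x) * u by rewrite ler_wpM2l// subr_ge0.
by nra.
Qed.

(** The exponent makes m (2 t)^m the decisive quantity: it tends to 0 for t < 1/2 and is at least m
    for t >= 1/2. The extra factor m settles the limit at t = 1/2 itself. *)
Definition poly_step (m : nat) (t : R) : R := (1 - t ^+ m) ^+ (m * 2 ^ m).

Lemma poly_step_itv m (t : R) : 0 <= t <= 1 -> 0 <= poly_step m t <= 1.
Proof.
move=> /andP[t0 t1]; have tm0 : 0 <= t ^+ m by rewrite exprn_ge0.
have tm1 : t ^+ m <= 1 by rewrite exprn_ile1.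
by rewrite /poly_step exprn_ge0 ?subr_ge0//= exprn_ile1 ?subr_ge0// gerBl.
Qed.

Lemma cvg_poly_step (t : R) : 0 <= t <= 1 ->
  poly_step m t @[m --> \oo] --> ((t < 1 / 2)%R%:R : R).
Proof.
move=> t01; have /andP[t0 t1] := t01; have [th|th] := ltP t (1 / 2).
  (* m (2 t)^m = (m v^m) v^m, where the first factor stays bounded and v < 1. *)
  pose v := Num.sqrt (2 * t).
  have v0 : 0 <= v by rewrite sqrtr_ge0.
  have vv : v * v = 2 * t by rewrite -expr2 sqr_sqrtr// mulr_ge0.
  have v1 : v < 1 by nra.
  (* Chosen so that (1 + s) v <= 1, whence (1 + m s) v^m <= 1 by Bernoulli. *)
  pose s := (1 - v) / 2.
  have s0 : 0 < s by rewrite /s; lra.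
  have mv m : m%:R * v ^+ m <= s^-1.
    rewrite -[leRHS]mulr1 ler_pdivlMl// mulrA.
    have h1 := @bernoulli_le s m (ltW s0).
    have h2 : (1 + s) ^+ m * v ^+ m <= 1.
      by rewrite -exprMn exprn_ile1 ?mulr_ge0// /s; nra.
    apply: le_trans h2; rewrite ler_wpM2r ?exprn_ge0//; lra.
  have lo m : 1 - s^-1 * v ^+ m <= poly_step m t.
    have tm : 0 <= t ^+ m <= 1 by rewrite exprn_ge0// exprn_ile1.
    rewrite /poly_step; apply: le_trans (bernoulli_ge _ tm); rewrite lerD2l lerN2 natrM natrX -mulrA -exprMn -vv exprMn mulrA.
    by rewrite ler_wpM2r ?exprn_ge0.
  have clo : 1 - s^-1 * v ^+ m @[m --> \oo] --> (1 : R).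
    have vc : v ^+ m @[m --> \oo] --> (0 : R) by apply: cvg_expr; rewrite ger0_norm.
    rewrite -[X in _ --> X]subr0 -[X in _ --> _ - X](mulr0 s^-1).
    have h := cvgB (@cvg_cst _ (1 : R) _ \oo _) (cvgM (@cvg_cst _ (s^-1 : R) _ \oo _) vc).
    exact: h.
  apply: (@squeeze_cvgr _ _ _ _ (fun m => 1 - s^-1 * v ^+ m) (fun=> 1)); [|exact: clo|exact: cvg_cst].
  apply: nearW => m; rewrite lo/=.
  by have /andP[] := poly_step_itv m t01.
(* For t >= 1/2 the value is at most exp(- m (2 t)^m) <= exp(- m) <= 1/(m + 1). *)
apply: (@squeeze_cvgr _ _ _ _ (fun=> 0) (fun m : nat => m.+1%:R^-1)); last exact: cvg_harmonic.
  apply: nearW => m; have /andP[-> _] /= := poly_step_itv m t01.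
  have tm1 : t ^+ m <= 1 by rewrite exprn_ile1.
  apply: (@le_trans _ _ (expR (- t ^+ m) ^+ (m * 2 ^ m))).
    rewrite /poly_step lerXn2r ?nnegrE ?subr_ge0 ?expR_ge0//.
    by have := expR_ge1Dx (- t ^+ m).
  rewrite -expRM_natl mulrN expRN lef_pV2 ?posrE ?expR_gt0//.
  apply: le_trans (expR_ge1Dx _); rewrite -natr1 addrC lerD2l natrM natrX -mulrA -exprMn.
  rewrite ler_peMr// exprn_ege1//; lra.
exact: cvg_cst.
Qed.

Lemma cvg_prod_ord n (F : 'I_n -> nat -> R) (l : 'I_n -> R) : (forall i, F i m @[m --> \oo] --> l i) ->
  \prod_(i < n) F i m @[m --> \oo] --> \prod_(i < n) l i.
Proof.
elim: n F l => [|n IH] F l Fl.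
  by rewrite big_ord0; under eq_fun do rewrite big_ord0; exact: cvg_cst.
rewrite big_ord_recr/=; under eq_fun do rewrite big_ord_recr/=.
by apply: cvgM; [apply: (IH (fun i => F (widen_ord (leqnSn n) i))) => i; exact: Fl | exact: Fl].
Qed.

End polynomial_steps.

(* The polynomials [\prod_i poly_step m (1/2 + (y_i - c_i)/(2 L))] converge boundedly
   to the indicator of an orthant on the support, so [a] integrates to zero against
   every orthant. *)
Lemma radially_orthogonal_eq0 (R : realType) n (mu : {measure set 'rV[R]_n -> \bar R})
    (a : 'rV[R]_n -> R) (W : set 'rV[R]_n) (rho : R) :
  mu.-integrable setT (EFin \o a) -> open W -> 0 < rho ->
  radially_orthogonal mu a W rho (fun=> 1) ->
  forall x, W x -> \forall y \ae mu, sqdist x y < rho -> a y = 0.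
Proof.
move=> inta oW rho0 oa x Wx.
(* Positive exactly for s < rho, so it can be divided out at the end. *)
pose psi (s : R) := flat 0 (-1 * s + rho).
have spsi : smooth psi by apply: smooth_comp_affine; exact: smooth_flat.
have psi0 s : rho <= s -> psi s = 0 by move=> rs; apply: flat_eq0; lra.
have m1 : measurable_fun setT ((fun=> 1) : 'rV[R]_n -> R) by exact: measurable_cst.
have b1 : @box_bounded R n (fun=> 1) by move=> L; exists 1 => y _; rewrite normr1.
pose f y := a y * psi (sqdist x y).
have mpsi : measurable_fun setT (fun y => psi (sqdist x y)).
  exact: (continuous_measurable_rV (rpoly_continuous (rpoly_radial x spsi))).
have [c c0 cP] := radial_bounded rho0 (\sum_(k < n) `|x ord0 k|) b1 spsi psi0.
have intf : mu.-integrable setT (EFin \o f).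
  apply: (integrable_mul_bounded inta (c := c)) => // y; rewrite -[psi _]mul1r; apply: cP => j.
  by rewrite (bigD1 j)//= lerDl sumr_ge0.
have f_poly Q : polyfun Q -> \int[mu]_y (f y * Q y) = 0.
  move=> pQ; rewrite -[RHS](radially_orthogonal_polyfun inta oW rho0 pQ m1 b1 oa Wx spsi psi0).
  by apply: eq_Rintegral => y _; rewrite /f; ring.
have f0 : \forall y \ae mu, f y = 0.
  apply: lower_orthants_separate => // [|d].
    by rewrite -[RHS](f_poly _ (polyfun_cst n 1)); apply: eq_Rintegral => y _; rewrite mulr1.
  (* [L] bounds |y_i - d_i| on the support of [f]; [tau] maps it into [0, 1] with the threshold 1/2
     at y_i = d_i. *)
  pose L := 1 + rho + \sum_(k < n) `|x ord0 k - d ord0 k|.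
  have L0 : 0 < L by rewrite ltr_wpDr ?sumr_ge0// addr_gt0.
  pose tau (i : 'I_n) (y : 'rV[R]_n) := (2 * L)^-1 * y ord0 i + (1 / 2 - d ord0 i / (2 * L)).
  have ftau y i : f y != 0 -> 0 <= tau i y <= 1.
    rewrite /f mulf_eq0 negb_or => /andP[_ py].
    have qr : sqdist x y < rho by rewrite ltNge; apply: contra_neqN py; exact: psi0.
    have := coord_le_sqdist x y i; set u := y ord0 i - x ord0 i => uq.
    have ur : `|u| <= 1 + rho.
      rewrite -(@ler_pXn2r _ 2)// ?nnegrE ?addr_ge0 ?(ltW rho0)//.
      by rewrite real_normK ?num_real//; nra.
    have yd : `|y ord0 i - d ord0 i| <= L.
      rewrite (_ : _ - _ = u + (x ord0 i - d ord0 i)); last by rewrite /u; ring.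
      rewrite (le_trans (ler_normD _ _))// lerD//.
      by rewrite [leRHS](bigD1 i)//= lerDl sumr_ge0.
    have -> : tau i y = 1 / 2 + (y ord0 i - d ord0 i) / (2 * L).
      by rewrite /tau; field; rewrite gt_eqF.
    have : `|(y ord0 i - d ord0 i) / (2 * L)| <= 1 / 2.
      rewrite normrM normfV (ger0_norm (_ : 0 <= 2 * L)) ?mulr_ge0 ?(ltW L0)//.
      by rewrite ler_pdivrMr ?mulr_gt0//; lra.
    by rewrite ler_norml => /andP[]; lra.
  have pstep m : polyfun (fun y => \prod_(i < n) poly_step m (tau i y)).
    apply: polyfun_prod => i; apply: polyfun_exp.
    rewrite (_ : (fun y => _) = fun y => 1 + -1 * tau i y ^+ m); last first.
      by apply/funext => y; rewrite mulN1r.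
    apply: polyfun_add (polyfun_cst _ _) _; apply: polyfun_mul (polyfun_cst _ _) _.
    apply: polyfun_exp; apply: polyfun_add (polyfun_cst _ _).
    exact: polyfun_mul (polyfun_cst _ _) (polyfun_coord _ _).
  apply: (@Rintegral_mul_cvg0 _ _ _ mu f (fun m y => \prod_(i < n) poly_step m (tau i y))) => //.
  - by move=> m; exact: polyfun_measurable.
  - move=> m y fy; rewrite normr_prod Num.Theory.prodr_ile1// => i _.
    by have /andP[h1 h2] := poly_step_itv m (ftau y i fy); rewrite normr_ge0/= ger0_norm.
  - move=> y fy.
    have -> : \1_(lower_orthant d) y = \prod_(i < n) (tau i y < 1 / 2)%R%:R :> R.
      have tE i : (tau i y < 1 / 2) = (y ord0 i < d ord0 i).
        have -> : tau i y = 1 / 2 + (y ord0 i - d ord0 i) / (2 * L).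
          by rewrite /tau; field; rewrite gt_eqF.
        by rewrite gtrDl pmulr_llt0 ?invr_gt0 ?mulr_gt0// subr_lt0.
      rewrite indicE; case: (boolP (y \in _)) => [|yd].
        by rewrite inE => yd; rewrite big1// => i _; rewrite tE yd.
      have [i yi] : exists i, ~~ (y ord0 i < d ord0 i).
        apply/existsP; rewrite -negb_forall; apply: contra yd => /forallP yd.
        by rewrite inE => i; exact: yd.
      by rewrite (bigD1 i)//= tE (negPf yi) mul0r.
    by apply: cvg_prod_ord => i; apply: cvg_poly_step; exact: ftau.
  - by move=> m; exact: f_poly.
apply: filterS f0 => y /eqP; rewrite /f mulf_eq0 => /orP[/eqP//|/eqP py] qr.
have : 0 < psi (sqdist x y) by apply: flat_gt0; lra.
by rewrite py ltxx.
Qed.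

(** * Propagation of zeros through the domain *)

Section unique_continuation.
Context (R : realType) (n : nat) (Omega : set 'rV[R]_n) (oOmega : open Omega).
Local Notation mu := (lebesgue_on oOmega).

Lemma sqdistxx (x : 'rV[R]_n) : sqdist x x = 0.
Proof. by apply: big1 => j _; rewrite subrr expr0n. Qed.

(** Squared distances obey the triangle inequality up to a factor 2, the origin of the radii r / 4
    and R0 / 16 below. *)
Lemma sqdist_triangle (x y z : 'rV[R]_n) : sqdist x z <= 2 * sqdist x y + 2 * sqdist y z.
Proof.
rewrite /sqdist !mulr_sumr -big_split/=; apply: ler_sum => j _.
set u := x ord0 j; set v := y ord0 j; set w := z ord0 j.
have : 0 <= ((v - u) - (w - v)) ^+ 2 by exact: sqr_ge0.
by nra.
Qed.

Lemma open_sqdist_lt (x : 'rV[R]_n) (r : R) : open [set y | sqdist x y < r].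
Proof.
apply: (@open_comp _ _ (sqdist x) [set s | s < r]); last exact: open_lt.
by move=> y _; exact: sqdist_continuous.
Qed.

Lemma open_sqdist (A : set 'rV[R]_n) x : open A -> A x ->
  exists2 r : R, 0 < r & forall y, sqdist x y <= r -> A y.
Proof.
move=> oA Ax; have /nbhs_ballP[e /= e0 eA] : nbhs x A by exact: open_nbhs_nbhs.
exists ((e / 2) ^+ 2); first by rewrite exprn_gt0// divr_gt0.
move=> y xy; apply: eA; split => // i j; rewrite ord1 /ball/= distrC.
apply: (@le_lt_trans _ _ (e / 2)); last by rewrite ltr_pdivrMr// ltr_pMr// ltr1n.
rewrite -(@ler_pXn2r _ 2)// ?nnegrE ?divr_ge0 ?(ltW e0)//.
by rewrite real_normK ?num_real// (le_trans (coord_le_sqdist x y j)).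
Qed.

Lemma rational_sqdist (x : 'rV[R]_n) (p : R) : 0 < p ->
  exists q : 'rV[rat]_n, sqdist x (map_mx ratr q) < p.
Proof.
(* e <= 1 gives e^2 <= e, and n e <= p n / (n + 1) < p. *)
move=> p0; pose e := Num.min 1 (p / n.+1%:R).
have e0 : 0 < e by rewrite lt_min ltr01 divr_gt0.
have hr i : exists r : rat, `|(ratr r : R) - x ord0 i| < e.
  have /rat_in_itvoo[r] : x ord0 i < x ord0 i + e by rewrite ltrDl.
  rewrite in_itv/= => /andP[r1 r2]; exists r.
  by rewrite gtr0_norm ?subr_gt0// ltrBlDl.
exists (\row_i sval (cid (hr i))).
apply: (@le_lt_trans _ _ (\sum_(i < n) e)).
  apply: ler_sum => i _; rewrite !mxE; case: cid => r /= re.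
  have e1 : e <= 1 by rewrite ge_min lexx.
  have := normr_ge0 (ratr r - x ord0 i : R).
  rewrite -(@real_normK _ (ratr r - x ord0 i)) ?num_real//; move: re.
  by set u := `|_|; nra.
rewrite sumr_const card_ord -mulr_natr.
apply: (@le_lt_trans _ _ (p / n.+1%:R * n%:R)); first by rewrite ler_wpM2r// ge_min lexx orbT.
by rewrite mulrAC ltr_pdivrMr// ltr_pM2l// ltr_nat.
Qed.

(** A Lindelof argument: countably many balls with rational centre and squared radius suffice, so
    only countably many null sets are united. *)
Lemma ae_local (P : 'rV[R]_n -> Prop) :
  (forall x, Omega x -> exists2 r : R, 0 < r & \forall y \ae mu, sqdist x y < r -> P y) ->
  \forall y \ae mu, P y.
Proof.
move=> loc.
pose good (k : nat) (y : 'rV[R]_n) := forall q : 'rV[rat]_n * rat, unpickle k = Some q ->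
  (\forall z \ae mu, sqdist (map_mx ratr q.1) z < ratr q.2 -> P z) ->
  sqdist (map_mx ratr q.1) y < ratr q.2 -> P y.
have aeO : \forall y \ae mu, Omega y.
  exists (~` Omega); split => //; first by apply: measurableC; exact: open_measurable_rV.
  by rewrite (_ : mu _ = lebesgue_rV R n (~` Omega `&` Omega))// setICl measure0.
have aeg : \forall y \ae mu, forall k, good k y.
  apply: ae_foralln => k; rewrite /good.
  case: (unpickle k) => [q|]; last by apply: aeW => y q.
  have [ok|nok] := pselect (\forall z \ae mu, sqdist (map_mx ratr q.1) z < ratr q.2 -> P z).
    by apply: filterS ok => y Py _ [<-] _; exact: Py.
  by apply: aeW => y _ [<-] /nok.
apply: filterS2 aeO aeg => y Oy gy; have [r r0 rP] := loc y Oy.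
have [p /andP[p0 pr]] : exists p : rat, (0 < (ratr p : R)) && ((ratr p : R) < r / 4).
  have /rat_in_itvoo[p] : 0 < r / 4 by rewrite divr_gt0.
  by rewrite in_itv/= => ?; exists p.
have [q qy] := rational_sqdist y p0.
apply: (gy (pickle (q, p)) (q, p)); rewrite ?pickleK//=; last by rewrite sqdistC.
apply: filterS rP => z Pz qz; apply: Pz.
by have := sqdist_triangle y (map_mx ratr q) z; lra.
Qed.

Context (a : nat -> L2 oOmega) (M C : R).
Hypothesis fin : (mu setT < +oo)%E.
Hypothesis chain : forall k phi, test_function Omega phi ->
  \int[mu]_x (a k.+1 x * phi x) = \int[mu]_x (a k x * laplace phi x).
Hypothesis growth : forall k, `|a k| <= M * C ^+ k * k`!%:R.

(** The radius is common to all k, since [laplace_chain_vanish] uses the vanishing of every [a k] on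
    the same ball. *)
Let zero_set : set 'rV[R]_n :=
  [set x | Omega x /\ exists2 r : R, 0 < r & forall k, \forall y \ae mu, sqdist x y < r -> a k y = 0].

Let zero_set_open : open zero_set.
Proof.
rewrite openE => x [Ox [r r0 rP]].
rewrite /interior; near=> z.
have Oz : Omega z by near: z; exact: open_nbhs_nbhs.
have xz : sqdist x z < r / 4.
  near: z; apply: open_nbhs_nbhs; split; first exact: open_sqdist_lt.
  by rewrite /= sqdistxx divr_gt0.
split => //; exists (r / 4); first by rewrite divr_gt0.
move=> k; apply: filterS (rP k) => y ay zy; apply: ay.
by have := sqdist_triangle x z y; lra.
Unshelve. all: by end_near. Qed.

(** Take x1 in the zero set with |x1 - x|^2 < R0/16. All centres z of the small ball [W] around x1
    have the [a k] zero nearby and their ball of squared radius R0/4 inside Omega; so [a m] vanishes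
    on that ball around x1, which contains the one of squared radius R0/16 around x. *)
Let zero_set_closed x : Omega x -> closure zero_set x -> zero_set x.
Proof.
move=> Ox clx; have [R0 R00 R0P] := open_sqdist oOmega Ox.
have [x1 [[Ox1 [r' r'0 r'P]] xx1]] : zero_set `&` [set y | sqdist x y < R0 / 16] !=set0.
  apply: clx; apply: open_nbhs_nbhs; split; first exact: open_sqdist_lt.
  by rewrite /= sqdistxx divr_gt0.
pose r := Num.min r' (R0 / 4).
have r0 : 0 < r by rewrite lt_min r'0 divr_gt0.
have rr' : r <= r' by rewrite ge_min lexx.
have rR : r <= R0 / 4 by rewrite ge_min lexx orbT.
pose W := [set z | sqdist x1 z < r / 4].
have Wx1 : W x1 by rewrite /W /= sqdistxx divr_gt0.
have inta k : mu.-integrable setT (EFin \o a k).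
  apply/Lfun1_integrable; apply: Lfun_subset12; last exact: Lspace_Lfun.
  by rewrite ge0_fin_numE.
split => //; exists (R0 / 16); first by rewrite divr_gt0.
move=> m; have rho0 : 0 < R0 / 4 by rewrite divr_gt0.
have orth : radially_orthogonal mu (a m) W (R0 / 4) (fun=> 1).
  move=> z psi Wz spsi psi0; under eq_Rintegral do rewrite mul1r.
  apply: (laplace_chain_vanish fin chain growth (e := r / 4) _ rho0) => //.
  - by rewrite divr_gt0.
  - move=> k; apply: filterS (r'P k) => y ay zy; apply: ay.
    by have := sqdist_triangle x1 z y; rewrite /W/= in Wz; lra.
  - move=> y zy; apply: R0P; rewrite /W/= in Wz.
    by have := sqdist_triangle x z y; have := sqdist_triangle x x1 z; rewrite /= in xx1; lra.
have := radially_orthogonal_eq0 (inta m) (@open_sqdist_lt x1 (r / 4)) rho0 orth Wx1.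
apply: filterS => y ay xy; apply: ay; rewrite /= in xx1.
by have := sqdist_triangle x1 x y; rewrite (sqdistC x1 x); lra.
Qed.

Lemma laplace_chain_unique_continuation (omega : set 'rV[R]_n) : connected Omega -> open omega ->
  omega `<=` Omega -> omega !=set0 ->
  (forall k, \forall x \ae mu, omega x -> a k x = 0) -> a 0%N = 0.
Proof.
move=> cO oomega omegaO [x0 omx0] az.
have zO : zero_set = Omega.
  apply: cO.
  - exists x0; split; first exact: omegaO.
    have [r r0 rP] := open_sqdist oomega omx0; exists r => // k.
    by apply: filterS (az k) => y ay xy; apply: ay; apply: rP; exact: ltW.
  - exists zero_set; first exact: zero_set_open.
    by apply/seteqP; split => [y zy|y []//]; split => //; case: zy.
  - exists (closure zero_set); first exact: closed_closure.
    apply/seteqP; split => [y zy|y [Oy]]; last exact: zero_set_closed.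
    by split; [case: zy | exact: subset_closure].
apply: Lspace_eqP; have a0 : \forall y \ae mu, a 0%N y = 0.
  by apply: ae_local => x; rewrite -{1}zO => -[_ [r r0 rP]]; exists r.
by apply: filterS2 a0 (Lspace_zeroE mu (lee1n 2)) => y -> ->.
Qed.

End unique_continuation.

(** A single term of the series of exp(k). It turns the growth (c k)^k of the iterated generator
    into (c e)^k k!. *)
Lemma exprnn_le_fact (R : realType) k : (k%:R : R) ^+ k <= expR 1 ^+ k * k`!%:R.
Proof.
case: k => [|k]; first by rewrite !expr0 mul1r.
rewrite -ler_pdivrMr ?ltr0n ?fact_gt0// -expRM_natl mulr1.
by apply: le_trans (expR_ge1Dxn k _); rewrite ?lerDr.
Qed.

Theorem mainTheorem4 (R : realType) (n : nat) (n_gt0 : (0 < n)%N)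
    (Omega : set 'rV[R]_n) (oOmega : open Omega)
    (Omega_connected : connected Omega) (Omega_neq0 : Omega !=set0)
    (Omega_bounded : bounded_set Omega) (Omega_smooth : smooth_boundary Omega)
    (eigenvalues_simple : forall l : R,
      op_eigenvalue (dirichlet_laplacian oOmega) l ->
      op_simple_eigenvalue (dirichlet_laplacian oOmega) l)
    (omega : set 'rV[R]_n) (oomega : open omega)
    (omega_sub : omega `<=` Omega) (omega_neq0 : omega !=set0)
    (T : R) (T_gt0 : 0 < T)
    (S : R -> L2 oOmega -> L2 oOmega)
    (S_generated : generated_by S (dirichlet_laplacian oOmega)) :
  approximately_controllable S (control_op oomega) T.
Proof.
have [S_C0 AS] := S_generated.
apply: (approximately_controllable_of_unique_continuation S_C0 (L2_ipP (lebesgue_on oOmega))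
  (control_op_linear oomega) T_gt0).
- by move=> x f y g /AS xf /AS yg; exact: dirichlet_laplacian_symmetric.
- by move=> x f /AS xf; exact: dirichlet_laplacian_dissipative.
have fin := lebesgue_on_lty oOmega Omega_bounded.
move=> a ag [M [c acM]] aB.
apply: (@laplace_chain_unique_continuation _ _ _ _ a `|M| (`|c| * expR 1) fin _ _
  omega Omega_connected oomega omega_sub omega_neq0).
- by move=> k phi tphi; apply: laplacian_test => //; have /AS[] := ag k.
- move=> k; apply: le_trans (acM k) _; apply: le_trans (ler_norm _) _.
  rewrite normrM normrX normrM normr_nat !exprMn -!mulrA !ler_wpM2l ?exprn_ge0//.
  exact: exprnn_le_fact.
- by move=> k; apply: orthogonal_control_op => v; exact: aB.
Qed.
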